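(* Let $\{S,A,(A(i),i\in S),q(j|i,a),c(i,a)\}$ be a continuous-time Markov decision model with finite state space $S$ as described in the context, and let $\lambda>0$. Assume: (i) for each $i\in S$, the set $A(i)$ is compact; (ii) for each $i,j\in S$, the functions $c(i,a)$ and $q(j|i,a)$ are continuous in $a\in A(i)$; (iii) for each $f\in F$, the corresponding continuous-time Markov chain is irreducible, i.e., for any two states $i\neq j$ there exist different states $j_1=i,j_2,\ldots,j_m$ such that $q(j_2|j_1,f)\cdots q(j|j_m,f)>0$. Fix any state $z\in S$ and let $\overline{g}$ and $h^*_{\overline{g}}$ (i.e. $h_g^*$ with $g=\overline{g}$) be as defined in the context. Then: (a) The pair $(\overline{g},h^*_{\overline{g}})$ belongs to $\mathbb{R}\times B(S)$, where $B(S)$ denotes the set of all real-valued functions on $S$, and satisfies the risk-sensitive average cost optimality equation $$\lambda\overline{g}\,e^{\lambda h^*_{\overline{g}}(i)}=\inf_{a\in A(i)}\Big\{\lambda c(i,a)e^{\lambda h^*_{\overline{g}}(i)}+\sum_{j\in S}e^{\lambda h^*_{\overline{g}}(j)}q(j|i,a)\Big\}\quad\text{for all } i\in S.$$ Moreover, there exists $f^*\in F$ such that, for every $i\in S$, $f^*(i)\in A(i)$ attains the infimum on the right-hand side. (b) For any $f^*\in F$ such that, for every $i\in S$, $f^*(i)\in A(i)$ attains the infimum in the equation in (a), we have $J^*(i)=J(i,f^* )=\overline{g}$ for all $i\in S$. Hence the policy $f^*$ is risk-sensitive average optimal (i.e., optimal within the class $\Pi$ of all randomized Markov policies).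
   Context: Model. $S$ is a finite set (state space, discrete topology); $A$ is a Borel space (action space) with Borel $\sigma$-algebra $\mathcal{B}(A)$; for each $i\in S$, $A(i)\in\mathcal{B}(A)$ is the nonempty set of admissible actions in state $i$; $K:=\{(i,a)\,|\,i\in S,\ a\in A(i)\}$. The transition rates $q(j|i,a)$ are real-valued, measurable in $a\in A(i)$ for each $i,j\in S$, satisfy $q(j|i,a)\ge 0$ for all $(i,a)\in K$ and $j\ne i$, and $\sum_{j\in S}q(j|i,a)=0$ for all $(i,a)\in K$. The cost rate $c(i,a)$ is real-valued (of arbitrary sign) and measurable in $a\in A(i)$ for each $i\in S$. Sample space. $(\Omega,\mathcal{F})$ is the canonical space of sequences $\omega=(i_0,\theta_1,i_1,\theta_2,\ldots)$ of states $i_l\in S$ and sojourn times $\theta_l\in(0,\infty)$, either infinite or terminating after finitely many jumps (then continued by $\infty,i_\infty,\infty,i_\infty,\ldots$, with $i_\infty\notin S$ an isolated cemetery point). Put $T_0:=0$, $T_m:=\theta_1+\cdots+\theta_m$, $X_m:=i_m$, $T_\infty:=\lim_m T_m$; the state process is $\xi_t:=i_m$ for $T_m\le t<T_{m+1}$ and $\xi_t:=i_\infty$ for $t\ge T_\infty$. At $i_\infty$ there is a single action $a_\infty$ (an isolated point), with $q(i_\infty|i_\infty,a_\infty)=0$, $c(i_\infty,a_\infty)=0$; write $S_\infty=S\cup\{i_\infty\}$, $A_\infty=A\cup\{a_\infty\}$, $A(i_\infty)=\{a_\infty\}$. Let $\mathcal{F}_t:=\sigma(\{T_m\le s,X_m=i\}:i\in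 S,s\le t,m\ge 0)$, and let $\mathcal{P}$ be the predictable $\sigma$-algebra on $\Omega\times[0,\infty)$ associated with $\{\mathcal{F}_t\}$. Policies. A randomized Markov policy $\pi$ is a $\mathcal{P}$-measurable transition probability $\pi(\cdot|\omega,t)$ on $(A_\infty,\mathcal{B}(A_\infty))$, concentrated on $A(\xi_{t-}(\omega))$, of the form $\pi(\cdot|\omega,t)=\varphi(\cdot|\xi_{t-}(\omega),t)$ for some kernel $\varphi$ on $A_\infty$ given $S_\infty\times[0,\infty)$; one writes $\pi(da|i,t)$ for $\varphi(da|i,t)$. $\Pi$ is the set of all such policies. A policy is deterministic stationary if $\pi(\cdot|\omega,t)=\delta_{f(\xi_{t-}(\omega))}(\cdot)$ for a function $f$ with $f(i)\in A(i)$ for all $i\in S_\infty$; $F$ is the set of all deterministic stationary policies, identified with such functions $f$. Write $q(j|i,f):=q(j|i,f(i))$ and $c(i,f):=c(i,f(i))$. Process law. For $i\in S$ and $\pi\in\Pi$, $P_i^\pi$ (with expectation $E_i^\pi$) is the unique probability measure on $(\Omega,\mathcal{F})$ under which $\xi_0=i$ almost surely and the process jumps at time $t$ to state $j\ne\xi_{t-}$ with (predictable) intensity $\int_A q(j|\xi_{t-},a)\,\pi(da|\xi_{t-},t)$. For $f\in F$, under $P_i^f$ the process $\xi$ is the continuous-time Markov chain with transition rates $q(\cdot|\cdot,f)$ started at $i$. Criterion. Fix $\lambda>0$. For $i\in S$ and $\pi\in\Pi$, $$J(i,\pi):=\limsup_{T\to\infty}\frac{1}{\lambda T}\ln E_i^{\pi}\Big[e^{\lambda\int_0^T\int_A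 c(\xi_t,a)\pi(da|\xi_t,t)\,dt}\Big],\qquad J^*(i):=\inf_{\pi\in\Pi}J(i,\pi).$$ A policy $\pi^*\in\Pi$ is (risk-sensitive average) optimal if $J(i,\pi^* )=J^*(i)$ for all $i\in S$. First passage quantities. Fix $z\in S$ and set $\tau_z:=\inf\{t\ge T_1:\xi_t=z\}$, with $\inf\emptyset:=\infty$. For $g\in\mathbb{R}$, $i\in S$, $f\in F$, $$h_{g}(i,f):=\frac{1}{\lambda}\ln E_i^f\Big[e^{\lambda\int_0^{\tau_z}(c(\xi_t,f)-g)\,dt}\Big],\qquad h_g^*(i):=\inf_{f\in F}h_g(i,f)$$ (a priori extended-real valued, with $\ln\infty=\infty$, $\ln 0=-\infty$), and $$G:=\{g\in\mathbb{R}\,|\,h_g^*(z)\le 0\},\qquad \overline{g}:=\inf G.$$ *)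

(* Defs.v *)
From HB Require Import structures.
From mathcomp Require Import all_boot all_order all_algebra.
From mathcomp Require Import all_classical all_reals all_analysis.
From mathcomp Require Import measurable_realfun.

Set Implicit Arguments.
Unset Strict Implicit.
Unset Printing Implicit Defensive.

Import Order.TTheory GRing.Theory Num.Def Num.Theory.
Import numFieldNormedType.Exports.

Local Open Scope classical_set_scope.
Local Open Scope ring_scope.
Local Open Scope ereal_scope.

(* Nonempty finite types.  The library's measurable types are pointed, so the
   trajectory space below needs an inhabitant; the point plays no other role. *)
#[short(type="pfinType")]
HB.structure Definition PointedFinite := {S of Finite S & isPointed S}.

Definition borel (A : ptopologicalType) := g_sigma_algebraType (@open A).

(* A is homeomorphic to a Borel subset of a complete separable metric space;
   [f] is the embedding.  A Hausdorff pseudometric is a metric. *)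
Definition borel_space (R : realType) (A : ptopologicalType) : Prop :=
  exists (X : completePseudoMetricType R) (f : A -> X),
    [/\ hausdorff_space X /\ (exists2 D : set X, countable D & dense D),
        injective f,
        (forall U : set A, open U <-> exists2 V : set X, open V & U = f @^-1` V) &
        measurable (range f : set (borel X))].

(* [rate i a j] is q(j|i,a); [rate] and [cost] are only meaningful on
   [a \in adm i]. *)
Record ctmdp (R : realType) (S : pfinType) (A : ptopologicalType) := Ctmdp {
  adm : S -> set A ;
  rate : S -> A -> S -> R ;
  cost : S -> A -> R ;
  ctmdp_borel : borel_space R A ;
  adm_measurable : forall i, measurable (adm i : set (borel A)) ;
  adm_nonempty : forall i, adm i !=set0 ;
  rate_measurable : forall i j,
    measurable_fun (adm i : set (borel A)) ((fun a => rate i a j) : borel A -> R) ;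
  rate_ge0 : forall i a j, adm i a -> j != i -> (0 <= rate i a j)%R ;
  rate_sum0 : forall i a, adm i a -> (\sum_j rate i a j = 0)%R ;
  cost_measurable : forall i,
    measurable_fun (adm i : set (borel A)) (cost i : borel A -> R) }.

(* [None] is the cemetery i_oo; [st w m] is i_m and [soj w m] is theta_(m+1). *)
Record traj (R : realType) (S : pfinType) := Traj {
  st : nat -> option S ;
  soj : nat -> \bar R ;
  traj_start : st 0%N <> None ;
  traj_soj_gt0 : forall m, 0 < soj m ;
  traj_stop : forall m, soj m = +oo <-> st m.+1 = None ;
  traj_absorb : forall m, st m = None -> st m.+1 = None }.

Section traj_instances.
Variables (R : realType) (S : pfinType).

HB.instance Definition _ := gen_eqMixin (traj R S).
HB.instance Definition _ := gen_choiceMixin (traj R S).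

Definition traj_point : traj R S.
Proof.
exists (fun m => if m is 0%N then Some (point : S) else None) (fun=> +oo) => //.
Defined.

HB.instance Definition _ := isPointed.Build (traj R S) traj_point.

Definition cylinders : set (set (traj R S)) :=
  [set C | exists m x, C = [set w | st w m = x]] `|`
  [set C | exists m (B : set (\bar R)), measurable B /\ C = [set w | B (soj w m)]].

Definition Omega := g_sigma_algebraType cylinders.

End traj_instances.

Section process.
Variables (R : realType) (S : pfinType).
Implicit Types (w : Omega R S) (t : R) (z : S).

Definition jump_time w (m : nat) : \bar R := \sum_(l < m) soj w l.

(* The index m below is unique if it exists, and exists iff t < T_oo. *)
Definition xi w t : option S :=
  xget None [set x | exists m,
    [/\ jump_time w m <= t%:E, t%:E < jump_time w m.+1 & x = st w m]].

(* The left limit of xi at t, with xi_(0-) = xi_0 and value i_oo from T_oo on. *)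
Definition xi_left w t : option S :=
  if (t <= 0)%R then st w 0%N else
  xget None [set x | exists m,
    [/\ jump_time w m < t%:E, t%:E <= jump_time w m.+1 & x = st w m]].

Definition filt t : set (set (Omega R S)) :=
  <<s [set B | exists (m : nat) (s : R) (i : S), (s <= t)%R /\
         B = [set w | jump_time w m <= s%:E /\ st w m = Some i]] >>.

Definition predictable_dom : set (Omega R S * R) :=
  [set: Omega R S] `*` [set t | (0 <= t)%R].

Definition predictable_sigma : set (set (Omega R S * R)) :=
  <<s predictable_dom,
      [set C | exists2 B, filt 0%R B & C = B `*` [set 0%R]] `|`
      [set C | exists s B,
         [/\ (0 <= s)%R, filt s B & C = B `*` [set t | (s < t)%R]]] >>.

Definition predictable (H : Omega R S -> R -> \bar R) : Prop :=
  forall Y : set (\bar R), measurable Y ->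
    predictable_sigma (predictable_dom `&` [set p | Y (H p.1 p.2)]).

(* First hitting time of z after the first jump, +oo if there is none. *)
Definition tau z w : \bar R :=
  ereal_inf [set t%:E | t in [set t | jump_time w 1 <= t%:E /\ xi w t = Some z]].

End process.

Section control.
Variables (R : realType) (S : pfinType) (A : ptopologicalType).
Variable M : ctmdp R S A.

(* A randomized Markov policy is given by its kernel phi(da|i,t).  At the
   cemetery the action a_oo is forced, with zero cost and zero rates, so only
   i \in S is recorded, and the functions below vanish at [None].  Kernels are
   taken on the whole line; their values at t < 0 are never used. *)
Record policy := Policy {
  pol_ker :> S -> R.-pker (measurableTypeR R) ~> (borel A) ;
  pol_adm : forall i t, (0 <= t)%R -> pol_ker i t (adm M i) = 1 }.

Record spolicy := SPolicy {
  sel :> S -> A ;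
  sel_adm : forall i, adm M i (sel i) }.

Definition stat_ker (f : spolicy) (i : S) :
    R.-pker (measurableTypeR R) ~> (borel A) :=
  kdirac (measurable_cst (f i : borel A)).

Lemma stat_ker_adm (f : spolicy) i t :
  (0 <= t)%R -> stat_ker f i t (adm M i) = 1.
Proof.
move=> _; rewrite /stat_ker /= /kdirac diracE mem_set //; exact: sel_adm.
Qed.

Definition stat (f : spolicy) : policy := Policy (@stat_ker_adm f).

Definition pol_rate (pi : policy) (x : option S) (t : R) (j : S) : \bar R :=
  if x is Some i then \int[pi i t]_(a in adm M i) (rate M i a j)%:E else 0.

Definition pol_cost (pi : policy) (x : option S) (t : R) : \bar R :=
  if x is Some i then \int[pi i t]_(a in adm M i) (cost M i a)%:E else 0.

Definition sel_cost (f : spolicy) (x : option S) : R :=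
  if x is Some i then cost M i (f i) else 0%R.

(* P is the law P_i^pi: xi_0 = i almost surely, and the predictable compensator
   of the random measure sum_(m >= 1, T_m < oo) delta_(T_m, X_m) on
   (0,oo) x S is  1_{j <> xi_(t-)} (int_A q(j|xi_(t-),a) pi(da|xi_(t-),t)) dt.
   The latter is expressed by testing against all nonnegative predictable H. *)
Definition process_law (i : S) (pi : policy) (P : probability (Omega R S) R) :
    Prop :=
  P [set w | st w 0%N = Some i] = 1 /\
  forall H : Omega R S -> R -> S -> \bar R,
    (forall w t j, 0 <= H w t j) ->
    (forall j, predictable (fun w t => H w t j)) ->
    \int[P]_w (\sum_(0 <= m <oo)
        if st w m.+1 is Some j then H w (fine (jump_time w m.+1)) j else 0) =
    \int[P]_w (\int[lebesgue_measure]_(t in [set t : R | (0 <= t)%R])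
        \sum_(j | Some j != xi_left w t)
          H w t j * pol_rate pi (xi_left w t) t j).

Variables (P : S -> policy -> probability (Omega R S) R) (lambda : R).

Definition J (i : S) (pi : policy) : \bar R :=
  limf_esup
    (fun T : R => ((lambda * T)^-1)%:E *
      lne (\int[P i pi]_w
        expeR (lambda%:E *
          \int[lebesgue_measure]_(t in `[0%R, T]) pol_cost pi (xi w t) t)))
    (pinfty_nbhs R).

Definition Jstar (i : S) : \bar R := ereal_inf (range (J i)).

Definition optimal (pi : policy) : Prop := forall i, J i pi = Jstar i.

Variable z : S.

(* The time integral is extended-valued: tau may be infinite. *)
Definition hfun (g : R) (i : S) (f : spolicy) : \bar R :=
  (lambda^-1)%:E *
  lne (\int[P i (stat f)]_w
    expeR (lambda%:E *
      \int[lebesgue_measure]_(t in [set t : R | (0 <= t)%R /\ t%:E < tau z w])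
        (sel_cost f (xi w t) - g)%:E)).

Definition hstar (g : R) (i : S) : \bar R := ereal_inf (range (hfun g i)).

Definition Gset : set R := [set g | hstar g z <= 0].

Definition gbar : \bar R := ereal_inf (EFin @` Gset).

(* The last arrow goes from the last state of [i :: s] to j: [nth] returns the
   default j at index [size (i :: s)]. *)
Definition irreducible (f : spolicy) : Prop :=
  forall i j : S, i != j -> exists s : seq S, uniq (i :: s) /\
    (0 < \prod_(k < (size s).+1)
       rate M (nth j (i :: s) k) (f (nth j (i :: s) k)) (nth j (i :: s) k.+1))%R.

Definition oe_rhs (h : S -> R) (i : S) (a : A) : R :=
  (lambda * cost M i a * expR (lambda * h i) +
   \sum_j expR (lambda * h j) * rate M i a j)%R.

Definition oe_inf (h : S -> R) (i : S) : \bar R :=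
  ereal_inf [set (oe_rhs h i a)%:E | a in adm M i].

Definition attains (h : S -> R) (f : spolicy) : Prop :=
  forall i, (oe_rhs h i (f i))%:E = oe_inf h i.

End control.

(* Main.v *)
(* Write [u = exp (lambda h)].  The optimality equation says that [lambda g] is the
   eigenvalue of the concave operator [u |-> inf_a (lambda c u + q u)]; it is
   obtained as the least [rho] for which [inf_a (lambda c u + q u) <= rho u] has a
   nonnegative solution of total mass 1.  A minimizer exists by compactness;
   irreducibility makes [u] positive, and a strict inequality at one state could
   be propagated to all states, contradicting minimality.

   Everything probabilistic comes from Dynkin's formula up to a jump number [m]
   and a horizon [T], which is read off the compensator in the definition of the
   process law, with functions allowed to depend on [m].  Applied to [u] it
   bounds [E exp (lambda int_0^T c)] above and below by multiples of
   [exp (lambda g T)], hence [J >= g] for every policy, with equality for an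
   attaining selector.  Stopped at [tau z] it gives [exp (lambda h_g(i,f)) >= u i],
   with equality if [f] is attaining.  For [g' < g] the slack in the equation
   allows the value of [u] at [z] to be raised at time 0, uniformly in [f], so
   that [hstar g' z > 0]; hence [gbar = g]. *)

Require Import Defs.
From HB Require Import structures.
From mathcomp Require Import all_boot all_order all_algebra.
From mathcomp Require Import all_classical all_reals all_analysis.
From mathcomp Require Import measurable_realfun.
From mathcomp Require Import ring lra.

Set Implicit Arguments.
Unset Strict Implicit.
Unset Printing Implicit Defensive.

Import Order.TTheory GRing.Theory Num.Def Num.Theory.
Import numFieldNormedType.Exports.

Local Open Scope classical_set_scope.
Local Open Scope ring_scope.

(** * The optimality equation *)

(** The law is available only through its compensator: neither the Markov property nor an explicit
    distribution of the jumps is at hand. Non-explosion and almost sure hitting of [z] are therefore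
    obtained from the same formula, by a choice of test functions. Dependence on the jump number
    makes this possible: weights [2 ^ m] control the number of jumps, and since [tau z] disregards
    the initial position, a function may take different values at [z] before the first jump and on
    return. This is why the stopped inequalities concern [z] only for [m = 0].

    The two directions differ. For a supersolution the mass that has not reached [z] is nonnegative
    and is discarded. For a subsolution it must be shown to vanish, although the reward may make it
    grow; a discount larger than the reward, together with a weight [psi] that drifts towards [z],
    bounds it by the tail of the hitting sum. With a single state there is no jump and [tau z] is
    infinite almost surely, so that case is computed directly. *)

Section bounded_minimum.
Import ArrowAsProduct.

(** A product of segments is compact by Tychonoff. Closedness of [K] is phrased by uniform
    approximation, which for a finite index set is closedness in the product topology and keeps that
    topology out of the later arguments. *)
Lemma coordinate_minimum (R : realType) (I : finType) (K : set (I -> R))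
    (C : R) (k0 : I) : K !=set0 ->
  (forall v k, K v -> `|v k| <= C) ->
  (forall v, (forall e, 0 < e -> exists2 v', K v' & forall k, `|v' k - v k| < e) ->
     K v) ->
  exists2 v, K v & forall v', K v' -> v k0 <= v' k0.
Proof.
move=> K0 Kb Kc.
have cK : compact K.
  apply: (@subclosed_compact _ K [set f : forall _ : I, R | forall i, `[- C, C]%classic (f i)]).
  - move=> v cv; apply: Kc => e e0.
    have nb : nbhs v (fun v' : I -> R => forall k, `|v' k - v k| < e).
      apply: (@filter_forall (I -> R) I (fun k v1 => `|v1 k - v k| < e) (nbhs (v : prod_topology (fun _ : I => R)))) => k.
      apply: (@proj_continuous I (fun _ => R) k v (fun y => `|y - v k| < e)).
      have nB : nbhs (v k) (ball (v k) e) by exact: nbhsx_ballx.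
      by apply: filterS nB => y; rewrite /ball /= distrC.
    by have [v' [Kv' /= vv']] := cv _ nb; exists v'.
  - apply: (@tychonoff I (fun _ => R) (fun _ => `[- C, C]%classic)) => i.
    exact: segment_compact.
  - by move=> v Kv i /=; rewrite in_itv /= -ler_norml Kb.
have cf : {within K, continuous (fun v : I -> R => v k0)}.
  by apply: continuous_subspaceT => v; exact: (@proj_continuous I (fun _ => R^o)).
have [v vK vmin] := compact_EVT_min K0 cK cf.
exists v; first by rewrite inE in vK.
by move=> v' Kv'; apply: vmin; rewrite inE.
Qed.

End bounded_minimum.

(* The only form in which irreducibility is used. *)
Definition crossing (R : numDomainType) (S : finType) (q : S -> S -> R) : Prop :=
  forall (B : pred S) k b, ~~ B k -> B b ->
  exists k' b', [/\ ~~ B k', B b' & 0 < q k' b'].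

Section optimality_equation.
Variables (R : realType) (S : finType) (s0 : S) (A : topologicalType).
Variables (adm : S -> set A) (r : S -> A -> R) (q : S -> A -> S -> R).
Hypothesis adm0 : forall i, adm i !=set0.
Hypothesis admc : forall i, compact (adm i).
Hypothesis rc : forall i, {within adm i, continuous (r i)}.
Hypothesis qc : forall i j, {within adm i, continuous (fun a => q i a j)}.
Hypothesis q0 : forall i a j, adm i a -> j != i -> 0 <= q i a j.
Hypothesis qs : forall i a, adm i a -> \sum_j q i a j = 0.
Hypothesis irr : forall f : S -> A, (forall i, adm i (f i)) ->
  crossing (fun i => q i (f i)).

Let L (u : S -> R) i a := r i a * u i + \sum_j q i a j * u j.

Lemma generator_minimum u i :
  exists2 a, adm i a & forall a', adm i a' -> L u i a <= L u i a'.
Proof.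
have cL : {within adm i, continuous (L u i)}.
  move=> a; apply: cvgD; first by apply: cvgMr_tmp; exact: rc.
  apply: cvg_big => [|j _]; first exact: add_continuous.
  by apply: cvgMr_tmp; exact: qc.
have [a ai amin] := compact_EVT_min (adm0 i) (@admc i) cL.
exists a; first by rewrite inE in ai.
by move=> a' aa'; apply: amin; rewrite inE.
Qed.

Lemma coefficients_bounded : exists2 C, 0 < C & forall i a, adm i a ->
  `|r i a| <= C /\ forall j, `|q i a j| <= C.
Proof.
have bnd (f : A -> R) i : {within adm i, continuous f} ->
    exists C, forall a, adm i a -> `|f a| <= C.
  move=> cf.
  have cn : {within adm i, continuous (fun a => `|f a|)}.
    by move=> a; apply: cvg_norm; exact: cf.
  have [c _ cmax] := compact_EVT_max (adm0 i) (@admc i) cn.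
  by exists `|f c| => a aa; apply: cmax; rewrite inE.
have /choice[Cr Crb] i := bnd _ _ (@rc i).
have /choice[Cq Cqb] (p : S * S) := bnd _ _ (@qc p.1 p.2).
exists (1 + \sum_i `|Cr i| + \sum_p `|Cq p|).
  by rewrite -addrA ltr_pwDl// addr_ge0// sumr_ge0.
move=> i a aa; split=> [|j].
  apply: (le_trans (Crb _ _ aa)); rewrite (le_trans (ler_norm _))//.
  rewrite (bigD1 i)//= addrCA -!addrA lerDl !addr_ge0// ?sumr_ge0//.
apply: (le_trans (Cqb (i, j) _ aa)); rewrite (le_trans (ler_norm _))//.
by rewrite (bigD1 (i, j))//= addrCA lerDl !addr_ge0// sumr_ge0.
Qed.

(* Propagation along [irr]: the zero set of a supersolution has no exit. *)
Lemma supersolution_gt0 f rho u : (forall i, adm i (f i)) ->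
  (forall i, 0 <= u i) -> (exists i, u i != 0) ->
  (forall i, L u i (f i) <= rho * u i) -> forall i, 0 < u i.
Proof.
move=> fa u0 [b ub] Lu i; rewrite lt_neqAle u0 andbT eq_sym.
apply/negP => ui.
have iB : ~~ [pred k | u k != 0] i by rewrite /= ui.
have [k [l [/= + ul qkl]]] := irr fa iB ub.
rewrite negbK => /eqP uk.
have := Lu k; rewrite /L uk !mulr0 add0r leNgt => /negP; apply.
rewrite (bigD1 l)//= ltr_pwDl ?mulr_gt0// ?lt_neqAle ?u0 ?andbT 1?eq_sym//.
apply: sumr_ge0 => j _; have [->|jk] := eqVneq j k; first by rewrite uk mulr0.
by rewrite mulr_ge0// q0.
Qed.

(** At a state minimising [u] the jump part of [L] is nonnegative, so [rho] dominates the reward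
    there. The bound keeps the rate of a competing supersolution inside the box in which compactness
    is used. *)
Lemma supersolution_rate_lb f rho u C : (forall i, adm i (f i)) ->
  (forall i, 0 < u i) -> (forall i, `|r i (f i)| <= C) ->
  (forall i, L u i (f i) <= rho * u i) -> - C <= rho.
Proof.
move=> fa u0 rC Lu.
case: (@arg_minP _ _ _ s0 predT u isT) => i _ imin.
have : r i (f i) * u i <= rho * u i.
  apply: le_trans (Lu i); rewrite /L lerDl.
  have -> : \sum_j q i (f i) j * u j = \sum_j q i (f i) j * (u j - u i).
    under [RHS]eq_bigr do rewrite mulrBr.
    by rewrite sumrB -mulr_suml qs ?mul0r ?subr0.
  apply: sumr_ge0 => j _; have [->|ji] := eqVneq j i; first by rewrite subrr mulr0.
  by rewrite mulr_ge0 ?q0 ?subr_ge0 ?imin.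
rewrite ler_pM2r// => /(le_trans _); apply.
by have := rC i; rewrite ler_norml => /andP[].
Qed.

(* Lowering [u] slightly at a strict state keeps it strict and makes its
   predecessors strict. *)
Lemma supersolution_strict f rho u : (forall i, adm i (f i)) ->
  (forall i, 0 < u i) -> (forall i, L u i (f i) <= rho * u i) ->
  (exists i, L u i (f i) < rho * u i) ->
  exists2 u', forall i, 0 < u' i & forall i, L u' i (f i) < rho * u' i.
Proof.
move=> fa.
have [n] := ubnP #|[pred i | ~~ (L u i (f i) < rho * u i)]|.
elim: n u => // n IH u + u0 Lu [b0 ub0].
rewrite ltnS => cB.
have [/forallP BT|] := boolP [forall i, L u i (f i) < rho * u i].
  by exists u.
rewrite negb_forall => /existsP[i iB].
have {i iB}[k [b [/= kB ub qkb]]] :=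
  irr (B := [pred i | L u i (f i) < rho * u i]) fa iB ub0.
set s := rho * u b - L u b (f b).
have s0' : 0 < s by rewrite subr_gt0.
set D := `|rho - r b (f b) - q b (f b) b| + 1.
have D0 : 0 < D by rewrite ltr_pwDr.
(* The first bound keeps [u'] positive at [b]; the second keeps [b] strict, because lowering [u b]
   by [e] costs at most [D * e] of the slack [s]. *)
pose e := Num.min (u b / 2) (s / (2 * D)).
have e0 : 0 < e by rewrite lt_min !divr_gt0 ?mulr_gt0.
have eub : e < u b.
  rewrite gt_min; apply/orP; left; rewrite ltr_pdivrMr//.
  by have := u0 b; lra.
have eD : e * D < s.
  apply: (@le_lt_trans _ _ (s / 2)).
    have -> : s / 2 = s / (2 * D) * D by field; rewrite gt_eqF.
    by rewrite ler_pM2r// ge_min lexx orbT.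
  by rewrite ltr_pdivrMr//; lra.
pose u' i := u i - e *+ (i == b).
have u'0 i : 0 < u' i.
  by rewrite /u'; have [->|] := eqVneq i b; rewrite ?mulr1n ?mulr0n ?subr0 ?subr_gt0.
have Lu' i : L u' i (f i) = L u i (f i) - (r i (f i) *+ (i == b) + q i (f i) b) * e.
  rewrite /L /u'.
  under eq_bigr do rewrite mulrBr.
  rewrite sumrB (_ : \sum_j q i (f i) j * (e *+ (j == b)) = q i (f i) b * e).
    by case: eqVneq => [->|_]; rewrite ?mulr1n ?mulr0n; ring.
  rewrite (bigD1 b)//= eqxx big1 ?addr0// => j /negPf->.
  by rewrite mulr0n mulr0.
have Lb : L u' b (f b) < rho * u' b.
  rewrite Lu' /u' eqxx !mulr1n.
  have : (rho - r b (f b) - q b (f b) b) * e <= D * e.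
    by rewrite ler_pM2r// /D (le_trans (ler_norm _))// lerDl.
  by move: eD; rewrite /s; lra.
have Li i : i != b -> L u' i (f i) = L u i (f i) - q i (f i) b * e /\ u' i = u i.
  by move=> ib; rewrite Lu' /u' (negPf ib) !mulr0n add0r subr0.
apply: (IH u') => //; last by exists b.
- apply: leq_trans cB; apply: proper_card; apply/properP; split.
    apply/fintype.subsetP => j; rewrite !inE; apply: contra => Lj.
    have [->//|jb] := eqVneq j b; have [-> ->] := Li _ jb.
    by rewrite (le_lt_trans _ Lj)// gerBl mulr_ge0 ?(ltW e0)// q0// eq_sym.
  exists k; rewrite !inE//= negbK.
  have kb : k != b by apply: contraNneq kB => ->.
  have [-> ->] := Li _ kb.
  by rewrite (lt_le_trans _ (Lu k))// gtrBl mulr_gt0.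
- move=> i; have [->|ib] := eqVneq i b; first exact: ltW.
  have [-> ->] := Li _ ib; rewrite (le_trans _ (Lu i))// gerBl.
  by rewrite mulr_ge0 ?(ltW e0)// q0// eq_sym.
Qed.

Theorem optimality_equation_solution : exists rho u,
  [/\ forall i, 0 < u i,
      forall i a, adm i a -> rho * u i <= L u i a &
      exists2 f, forall i, adm i (f i) & forall i, L u i (f i) = rho * u i].
Proof.
have [C C0 rqC] := coefficients_bounded.
(* [None] carries the rate and [Some i] the value at [i], so that minimising the rate is minimising
   one coordinate. Mass 1 excludes the zero solution and, with nonnegativity, bounds the values. *)
pose K : set (option S -> R) := [set v |
  [/\ forall k, `|v k| <= C + 1, forall i, 0 <= v (Some i),
      \sum_i v (Some i) = 1 &
      forall i, exists2 a, adm i a & L (v \o Some) i a <= v None * v (Some i)]].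
have n0 : 0 < #|S|%:R :> R by rewrite ltr0n; apply/card_gt0P; exists s0.
have K0 : K !=set0.
  (* On a constant function the jump part vanishes, so the rate [C] suffices. *)
  exists (fun k => if k is Some _ then #|S|%:R^-1 else C); split => /=.
  - case=> [i|]; last by rewrite gtr0_norm ?lerDl.
    rewrite gtr0_norm ?invr_gt0// ler_wpDl ?(ltW C0)// invf_le1// ler1n.
    by apply/card_gt0P; exists s0.
  - by move=> _; rewrite invr_ge0 ltW.
  - by rewrite sumr_const -[_ *+ _]mulr_natr mulVf ?gt_eqF.
  - move=> i; have [a aa] := adm0 i; exists a => //.
    rewrite /L -mulr_suml qs// mul0r addr0 ler_wpM2r ?invr_ge0 ?(ltW n0)//.
    by rewrite (le_trans (ler_norm _))//; have [] := rqC _ _ aa.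
have Kc v : (forall e, 0 < e -> exists2 v', K v' & forall k, `|v' k - v k| < e) ->
    K v.
  move=> Kv.
  have approx (x y D : R) : 0 <= D -> (forall e, 0 < e -> e <= 1 -> x <= y + D * e) -> x <= y.
    move=> D0 xy; apply/ler_addgt0Pr => e e0.
    have m0 : 0 < Num.min 1 (e / (D + 1)).
      by rewrite lt_min ltr01/= divr_gt0// ltr_wpDl.
    have m1 : Num.min 1 (e / (D + 1)) <= 1 by rewrite ge_min lexx.
    apply: le_trans (xy _ m0 m1) _; rewrite lerD2l.
    apply: (@le_trans _ _ (D * (e / (D + 1)))).
      by rewrite ler_wpM2l// ge_min lexx orbT.
    rewrite mulrCA ler_piMr ?(ltW e0)// ler_pdivrMr ?mul1r ?lerDl//.
    by rewrite ltr_wpDl.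
  split.
  - move=> k; apply: (@approx _ _ 1) => // e e0 _; rewrite mul1r.
    have [v' [v'C _ _ _] vv'] := Kv _ e0.
    have -> : v k = v' k - (v' k - v k) by ring.
    by rewrite (le_trans (ler_normB _ _))// lerD// ltW.
  - move=> i; apply: (@approx _ _ 1) => // e e0 _; rewrite mul1r.
    have [v' [_ v'0 _ _] vv'] := Kv _ e0.
    have := v'0 i; have := vv' (Some i); rewrite ltr_norml => /andP[_].
    by lra.
  - have sb e : 0 < e -> `|\sum_i v (Some i) - 1| <= #|S|%:R * e.
      move=> e0; have [v' [_ _ vs' _] vv'] := Kv _ e0.
      rewrite -[X in `|_ - X|]vs' -sumrB (le_trans (ler_norm_sum _ _ _))//.
      rewrite [leRHS](_ : _ = \sum_(j : S) e).
        by apply: ler_sum => i _; rewrite distrC ltW.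
      by rewrite sumr_const mulr_natl.
    apply/eqP; rewrite -subr_eq0 -normr_le0.
    by apply: (@approx _ _ #|S|%:R) => // e e0 _; rewrite add0r sb.
  (* The actions witnessing the approximations [v'] need not converge. Instead the minimiser for [v]
     is compared with each of them, and the errors are linear in [e]; [D] collects their
     constants. *)
  - move=> i; have [a aa amin] := generator_minimum (v \o Some) i.
    exists a => //.
    set D := C + C * #|S|%:R + (C + 1) + (C + 1) + 1.
    have D0 : 0 <= D by rewrite /D; have := mulr_gt0 C0 n0; lra.
    apply: (approx _ _ D D0) => e e0 e1.
    have [v' [v'C v'0 _ Lv'] vv'] := Kv _ e0.
    have [a' aa' La'] := Lv' i.
    have [ra' qa'] := rqC _ _ aa'.
    apply: (le_trans (amin _ aa')).
    have : L (v \o Some) i a' - L (v' \o Some) i a' <= (C + C * #|S|%:R) * e.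
      rewrite /L /=.
      have -> : r i a' * v (Some i) + \sum_j q i a' j * v (Some j) -
        (r i a' * v' (Some i) + \sum_j q i a' j * v' (Some j)) =
        r i a' * (v (Some i) - v' (Some i)) +
        \sum_j q i a' j * (v (Some j) - v' (Some j)).
        under [X in _ = _ + X]eq_bigr do rewrite mulrBr.
        by rewrite sumrB; ring.
      have bnd x j : `|x| <= C -> x * (v (Some j) - v' (Some j)) <= C * e.
        move=> xC; rewrite (le_trans (ler_norm _))// normrM ler_pM//.
        by rewrite distrC ltW.
      rewrite mulrDl lerD ?bnd//.
      rewrite [leRHS](_ : _ = \sum_(j : S) C * e); last first.
        by rewrite sumr_const -[RHS]mulr_natr; ring.
      by apply: ler_sum => j _; exact: bnd.
    have : v' None * v' (Some i) - v None * v (Some i) <= ((C + 1) + (C + 1) + 1) * e.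
      have -> : v' None * v' (Some i) - v None * v (Some i) =
        v' None * (v' (Some i) - v (Some i)) + (v' None - v None) * (v' (Some i) - (v' (Some i) - v (Some i))) by ring.
      have h1 : v' None * (v' (Some i) - v (Some i)) <= (C + 1) * e.
        by rewrite (le_trans (ler_norm _))// normrM ler_pM// ltW.
      have h2 : (v' None - v None) * (v' (Some i) - (v' (Some i) - v (Some i))) <= e * ((C + 1) + 1).
        rewrite (le_trans (ler_norm _))// normrM ler_pM ?(ltW (vv' _))//.
        rewrite (le_trans (ler_normB _ _))// lerD//.
        by rewrite (le_trans _ e1)// ltW.
      by move: h1 h2; lra.
    by move: La'; rewrite /D; lra.
have Kb v k : K v -> `|v k| <= C + 1 by case.
have [v [vC v0 vs Lv] vmin] := coordinate_minimum None K0 Kb Kc.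
set rho := v None; set u := v \o Some; exists rho, u.
have /choice[f fP] i : exists a, adm i a /\ forall a', adm i a' -> L u i a <= L u i a'.
  by have [a ? ?] := generator_minimum u i; exists a.
have fa i : adm i (f i) by have [] := fP i.
have Lf i : L u i (f i) <= rho * u i.
  by have [a aa La] := Lv i; apply: le_trans La; apply: (fP i).2.
have u0 : forall i, 0 < u i.
  apply: (supersolution_gt0 fa v0 _ Lf).
  apply/not_existsP => un; have : \sum_i v (Some i) = 0.
    by apply: big1 => i _; apply/eqP/negPn/negP/un.
  by rewrite vs; apply/eqP; rewrite oner_eq0.
suff Le i : L u i (f i) = rho * u i.
  split => //; last by exists f.
  by move=> i a aa; rewrite -Le; exact: (fP i).2.
apply/eqP; rewrite eq_le Lf/= leNgt; apply/negP => Li.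
(* Strictness everywhere lets the rate drop to the largest ratio [rho'], which is below [rho];
   normalising [w] to mass 1 gives a point of [K] that contradicts minimality. *)
have [w w0 Lw] := supersolution_strict fa u0 Lf (ex_intro _ i Li).
have [k _ kmax] := @arg_maxP _ _ _ s0 predT (fun k => L w k (f k) / w k) isT.
set rho' := L w k (f k) / w k in kmax.
have rr : rho' < rho by rewrite /rho' ltr_pdivrMr.
have Lw' j : L w j (f j) <= rho' * w j by rewrite -ler_pdivrMr//; exact: kmax.
have rC' : - C <= rho'.
  by apply: (supersolution_rate_lb fa w0 _ Lw') => j; have [] := rqC _ _ (fa j).
have sw : 0 < \sum_j w j.
  by rewrite (bigD1 s0)//= ltr_pwDl// sumr_ge0// => j _; exact: ltW.
suff /vmin : K (fun k => if k is Some j then w j / \sum_j w j else rho').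
  by rewrite leNgt rr.
split => /=.
- case=> [j|].
    rewrite ger0_norm; last by rewrite divr_ge0// ltW.
    rewrite ler_wpDl ?(ltW C0)// ler_pdivrMr// mul1r.
    by rewrite (bigD1 j)//= lerDl sumr_ge0// => l _; exact: ltW.
  have := vC None; rewrite !ler_norml -/rho => /andP[_ +].
  by move: rr rC'; lra.
- by move=> j; rewrite divr_ge0// ltW.
- by rewrite -mulr_suml divff// gt_eqF.
- move=> j; exists (f j) => //.
  have -> : L ((fun k => if k is Some j then w j / \sum_j w j else rho') \o Some) j (f j)
    = L w j (f j) / \sum_j w j.
    rewrite /L /= mulrDl mulr_suml; congr (_ + _); first by rewrite mulrA.
    by apply: eq_bigr => l _; rewrite mulrA.
  by rewrite mulrA ler_pM2r// invr_gt0.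
Qed.

End optimality_equation.

(** Follow the path from [k] to [b]: the first state in [B] is entered from outside, and a factor of
    a positive product is nonzero. The default [b] of [nth] supplies the endpoint. *)
Lemma irreducible_crossing (R : realType) (S : pfinType) (A : ptopologicalType)
    (M : ctmdp R S A) (f : spolicy M) :
  irreducible f -> crossing (fun i => rate M i (f i)).
Proof.
move=> irr B k b kB bB.
have kb : k != b by apply: contraNneq kB => ->.
have [s [us]] := irr _ _ kb; set p := nth b (k :: s) => prod0.
have exB : exists n, B (p n).
  by exists (size s).+1; rewrite /p nth_default.
have [n Bn nmin] := ex_minnP exB.
have n0 : (0 < n)%N by case: n Bn {nmin} => //; rewrite /p /= (negPf kB).
have ns : (n.-1 < (size s).+1)%N.
  by rewrite prednK// nmin// /p nth_default.
have Bn1 : ~~ B (p n.-1).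
  by apply: contraTN n0 => /nmin; case: (n) => //= m; rewrite ltnn.
exists (p n.-1), (p n); split => //.
rewrite lt_neqAle rate_ge0 ?andbT; [|exact: sel_adm|]; last first.
  by apply: contraNneq Bn1 => <-.
have /prodf_neq0/(_ (Ordinal ns) isT)/= := lt0r_neq0 prod0.
by rewrite prednK// eq_sym.
Qed.

(* Growing the support of [psi] from [z]: a new state only needs a weight small
   enough for the single arrow into the current support to dominate. *)
Lemma hitting_weight (R : realFieldType) (S : finType) (q : S -> S -> R) (z : S)
    (kappa : R) :
  (forall i j, j != i -> 0 <= q i j) -> crossing q ->
  exists psi : S -> R, [/\ forall i, 0 < psi i, psi z = 1 &
    forall i, i != z -> kappa * psi i <= \sum_j q i j * psi j].
Proof.
move=> q0 qB.
(* With the diagonal moved to the left, the right-hand side can only grow when a further value of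
   [psi] becomes positive; the absolute value makes the denominator [D] below positive. *)
suff [psi [psi0 psiz psi1]] : exists psi : S -> R,
    [/\ forall i, 0 < psi i, psi z = 1 &
    forall i, i != z -> `|kappa - q i i| * psi i <= \sum_(j | j != i) q i j * psi j].
  exists psi; split => // i iz; have h := psi1 _ iz.
  rewrite [leRHS](bigD1 i)//=.
  have : (kappa - q i i) * psi i <= `|kappa - q i i| * psi i.
    by rewrite ler_pM2r// ler_norm.
  by move: h; lra.
suff H n : forall psi : S -> R, (#|[pred i | psi i == 0%R]| < n)%N ->
    (forall i, 0 <= psi i) -> psi z = 1 ->
    (forall i, i != z -> 0 < psi i ->
       `|kappa - q i i| * psi i <= \sum_(j | j != i) q i j * psi j) ->
    exists psi : S -> R, [/\ forall i, 0 < psi i, psi z = 1 &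
    forall i, i != z -> `|kappa - q i i| * psi i <= \sum_(j | j != i) q i j * psi j].
  apply: (H _ (fun i => (i == z)%:R) (ltnSn _)); first by move=> i; rewrite ler0n.
    by rewrite eqxx.
  by move=> i /negPf->; rewrite ltxx.
elim: n => // n IH psi; rewrite ltnS => cpsi psi0 psiz psi1.
have [/forallP p0|] := boolP [forall i, psi i != 0].
  have pp i : 0 < psi i by rewrite lt_neqAle psi0 eq_sym p0.
  by exists psi; split => // i iz; exact: psi1.
rewrite negb_forall => /existsP[i]; rewrite negbK => i0.
have i0' : ~~ [pred k | psi k != 0] i by rewrite /= i0.
have z1 : [pred k | psi k != 0] z by rewrite /= psiz oner_eq0.
have {i i0 i0' z1}[k [b [/= + pb qkb]]] := qB _ _ _ i0' z1.
rewrite negbK => /eqP pk.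
have kz : k != z by apply: contra_eq_neq pk => ->; rewrite psiz oner_neq0.
have bk : b != k by apply: contraNneq pb => ->; rewrite pk.
have pb0 : 0 < psi b by rewrite lt_neqAle psi0 eq_sym pb.
set D := `|kappa - q k k| + 1.
have D0 : 0 < D by rewrite ltr_wpDl.
pose w := q k b * psi b / D.
have w0 : 0 < w by rewrite !mulr_gt0// invr_gt0.
pose psi' i := if i == k then w else psi i.
have le' i : psi i <= psi' i by rewrite /psi'; case: eqVneq => // ->; rewrite pk ltW.
apply: (IH psi').
- apply: leq_trans cpsi; apply: proper_card; apply/properP; split.
    apply/fintype.subsetP => j; rewrite !inE /psi'; case: (eqVneq j k) => // _.
    by rewrite (gt_eqF w0).
  by exists k; rewrite !inE ?pk// /psi' eqxx gt_eqF.
- by move=> i; rewrite (le_trans (psi0 i)).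
- by rewrite /psi' eq_sym (negPf kz).
- move=> i iz; rewrite {1 2}/psi'; case: eqVneq => [->|ik] pi0.
    rewrite (bigD1 b)//= /psi' (negPf bk) -[leLHS]addr0 lerD//; last first.
      apply: sumr_ge0 => j /andP[jk _]; rewrite mulr_ge0 ?q0//.
      by case: ifP => // _; exact: ltW.
    rewrite /w mulrA ler_pdivrMr// mulrC ler_pM2l ?mulr_gt0//.
    by rewrite lerDl.
  apply: (le_trans (psi1 _ iz pi0)); apply: ler_sum => j ji.
  by rewrite ler_wpM2l// q0.
Qed.

(** * Bounded measurable functions and their primitives *)

Section bounded_measurable.
Context d (T : measurableType d) (R : realType).

(** Bounds are required on the whole space, so integrability against a finite measure or over a
    bounded interval is automatic. *)
Definition bmfun (f : T -> R) :=
  measurable_fun setT f /\ exists C, forall x, `|f x| <= C.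

Lemma eq_bmfun f g : f =1 g -> bmfun f -> bmfun g.
Proof. by move=> /funext->. Qed.

Lemma bmfun_cst c : bmfun (fun=> c).
Proof. by split; [exact: measurable_cst|exists `|c|]. Qed.

Lemma bmfunD f g : bmfun f -> bmfun g -> bmfun (fun x => f x + g x).
Proof.
move=> [mf [C fC]] [mg [D gD]]; split; first exact: measurable_funD.
by exists (C + D) => x; rewrite (le_trans (ler_normD _ _))// lerD.
Qed.

Lemma bmfunM f g : bmfun f -> bmfun g -> bmfun (fun x => f x * g x).
Proof.
move=> [mf [C fC]] [mg [D gD]]; split; first exact: measurable_funM.
by exists (C * D) => x; rewrite normrM ler_pM.
Qed.

Lemma bmfunB f g : bmfun f -> bmfun g -> bmfun (fun x => f x - g x).
Proof.
move=> bf bg; rewrite (_ : (fun _ => _) = fun x => f x + -1 * g x).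
  by apply: bmfunD => //; apply: bmfunM => //; exact: bmfun_cst.
by apply/funext => x; rewrite mulN1r.
Qed.

Lemma bmfun_sum (I : Type) (s : seq I) (P : pred I) (f : I -> T -> R) :
  (forall i, bmfun (f i)) -> bmfun (fun x => \sum_(i <- s | P i) f i x).
Proof.
move=> bf; elim: s => [|i s IH].
  rewrite (_ : (fun _ => _) = fun=> 0); first exact: bmfun_cst.
  by apply/funext => x; rewrite big_nil.
rewrite (_ : (fun _ => _) = fun x => (P i)%:R * f i x + \sum_(i <- s | P i) f i x).
  by apply: bmfunD => //; apply: bmfunM => //; exact: bmfun_cst.
by apply/funext => x; rewrite big_cons; case: ifP => _; rewrite ?mul1r// mul0r add0r.
Qed.

Lemma bmfun_indic (A : set T) : measurable A -> bmfun (\1_A : T -> R).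
Proof.
move=> mA; split; first exact: measurable_indic.
by exists 1 => x; rewrite indicE; case: (_ \in _); rewrite ?normr1// normr0.
Qed.

Lemma bmfun_integrable (mu : {finite_measure set T -> \bar R}) D f :
  measurable D -> bmfun f -> mu.-integrable D (EFin \o f).
Proof.
move=> mD [mf [C fC]]; apply: measurable_bounded_integrable => //.
- by rewrite ltey_eq fin_num_measure.
- exact: measurable_funTS.
- exists C; split; first by rewrite num_real.
  by move=> x Cx y _ /=; rewrite (le_trans (fC _))// ltW.
Qed.

End bounded_measurable.

Section primitive.
Context (R : realType).
Implicit Types (f g : R -> R) (a b t : R).
Local Notation mu := (@lebesgue_measure R).

Lemma bmfun_itv_integrable f (b b' : bool) a a' : bmfun f ->
  mu.-integrable [set` Interval (BSide b a) (BSide b' a')] (EFin \o f).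
Proof.
move=> [mf [C fC]]; apply: measurable_bounded_integrable => //.
- rewrite /= lebesgue_measure_itv/=; case: ifP => _; rewrite ?ltry//.
- exact: measurable_funTS.
- exists C; split; first by rewrite num_real.
  by move=> z Cz y' _ /=; rewrite (le_trans (fC _))// ltW.
Qed.

Definition prim f t := \int[mu]_(s in `[0, t]) f s.

Lemma primB f a b : bmfun f -> 0 <= a -> a <= b ->
  prim f b - prim f a = \int[mu]_(s in `]a, b]) f s.
Proof.
move=> bf a0 ab; rewrite /prim Rintegral_itvB ?bnd_simp//.
exact: bmfun_itv_integrable.
Qed.

Lemma prim_ge0 f a b : bmfun f -> 0 <= a -> a <= b ->
  (forall s, a < s <= b -> 0 <= f s) -> 0 <= prim f b - prim f a.
Proof.
move=> bf a0 ab f0; rewrite primB//; apply: Rintegral_ge0 => s /=.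
by rewrite in_itv/=; exact: f0.
Qed.

Lemma primD f g t : bmfun f -> bmfun g ->
  prim (fun s => f s + g s) t = prim f t + prim g t.
Proof. by move=> bf bg; rewrite /prim RintegralD//; exact: bmfun_itv_integrable. Qed.

Lemma primZ c f t : bmfun f -> prim (fun s => c * f s) t = c * prim f t.
Proof. by move=> bf; rewrite /prim RintegralZl//; exact: bmfun_itv_integrable. Qed.

Lemma prim_cst c t : 0 <= t -> prim (fun=> c) t = c * t.
Proof.
rewrite /prim Rintegral_cst//= lebesgue_measure_itv/= lte_fin sube0.
by rewrite le_eqVlt => /predU1P[<-|->]; rewrite ?ltxx ?mulr0//=.
Qed.

Lemma prim0 f : prim f 0 = 0.
Proof. by rewrite /prim set_itv1 Rintegral_set1. Qed.

Lemma eq_prim f g t : (forall s, 0 <= s <= t -> f s = g s) -> prim f t = prim g t.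
Proof.
by move=> fg; apply: eq_Rintegral => s; rewrite inE/= in_itv/=; exact: fg.
Qed.

Lemma prim_Lipschitz f C a b : bmfun f -> (forall s, `|f s| <= C) ->
  0 <= a -> a <= b -> `|prim f b - prim f a| <= C * (b - a).
Proof.
move=> bf fC a0 ab.
rewrite primB//; apply: (le_trans (le_normr_Rintegral _ _)) => //.
  exact: bmfun_itv_integrable.
have -> : C * (b - a) = \int[mu]_(s in `]a, b]) C.
  rewrite Rintegral_cst//= lebesgue_measure_itv/= lte_fin.
  case: ltP => [_|ba]//=.
  by rewrite (_ : a = b) ?subrr//; apply/le_anti; rewrite ab.
apply: le_Rintegral => //; last exact/bmfun_itv_integrable/bmfun_cst.
apply: bmfun_itv_integrable; case: bf => mf [D fD]; split.
  exact: measurableT_comp.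
by exists D => x; rewrite normr_id.
Qed.

Lemma prim_le0 f t : t < 0 -> prim f t = 0.
Proof.
by move=> t0; rewrite /prim set_itv_ge ?Rintegral_set0// bnd_simp -ltNge.
Qed.

Lemma continuous_prim f : bmfun f -> continuous (prim f).
Proof.
move=> bf; have [_ [C0 fC0]] := bf; set C := `|C0| + 1.
have C0' : 0 < C by rewrite ltr_wpDl.
have fC s : `|f s| <= C by rewrite (le_trans (fC0 s))// (le_trans (ler_norm _))// lerDl.
have H a b : a <= b -> `|prim f b - prim f a| <= C * (b - a).
  move=> ab; have [b0|b0] := ltP b 0.
    rewrite !prim_le0 ?(le_lt_trans ab)// subrr normr0 mulr_ge0 ?subr_ge0//.
    exact: ltW.
  have [a0|a0] := ltP a 0; last exact: prim_Lipschitz.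
  rewrite (prim_le0 _ a0) -[X in _ - X](prim0 f).
  apply: (le_trans (prim_Lipschitz bf fC _ b0)) => //.
  by rewrite ler_pM2l// lerB// ltW.
have HH a b : `|prim f a - prim f b| <= C * `|a - b|.
  have [ab|ba] := leP a b.
    by rewrite distrC (distrC a) (ger0_norm (x := b - a)) ?subr_ge0// H.
  by rewrite (ger0_norm (x := a - b)) ?subr_ge0 ?H// ltW.
move=> x; apply/cvgrPdist_le => e e0.
near=> y; rewrite (le_trans (HH _ _))// mulrC -ler_pdivlMr//.
near: y; apply: cvgr_dist_le => //; exact: divr_gt0.
Unshelve. all: by end_near. Qed.

Lemma measurable_prim f : bmfun f -> measurable_fun setT (prim f).
Proof. by move=> bf; apply: continuous_measurable_fun; exact: continuous_prim. Qed.

Local Opaque expR prim.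

(** Cutting [[a, b]] into [n.+1] equal pieces bounds the increment by [D / n.+1]. This replaces a
    derivative, which a primitive of a merely measurable function need not have at every point. *)
Lemma quadratic_increment_cst (F : R -> R) (K a b : R) : a <= b ->
  (forall x y, a <= x -> x <= y -> y <= b -> `|F y - F x| <= K * (y - x) ^+ 2) ->
  F b = F a.
Proof.
move=> ab H; pose D := K * (b - a) ^+ 2.
have D0 : 0 <= D by apply: le_trans (H a b _ _ _).
have Hn n : `|F b - F a| <= D / n.+1%:R.
  pose d := (b - a) / n.+1%:R.
  have d0 : 0 <= d by rewrite divr_ge0// subr_ge0.
  have nd : n.+1%:R * d = b - a by rewrite /d mulrC divfK.
  have S k : (k <= n.+1)%N -> `|F (a + k%:R * d) - F a| <= k%:R * (K * d ^+ 2).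
    elim: k => [|k IH] kn; first by rewrite !mul0r addr0 subrr normr0.
    have -> : F (a + k.+1%:R * d) - F a =
      (F (a + k.+1%:R * d) - F (a + k%:R * d)) + (F (a + k%:R * d) - F a) by ring.
    rewrite (le_trans (ler_normD _ _))//.
    rewrite -[X in _ <= X%:R * _]addn1 natrD mulrDl addrC lerD ?IH ?(ltnW kn)//.
    rewrite mul1r; apply: le_trans (H _ _ _ _ _) _.
    - by rewrite lerDl mulr_ge0.
    - by rewrite lerD2l ler_wpM2r// ler_nat.
    - by rewrite -[leRHS](subrK a) -nd addrC lerD2r ler_wpM2r// ler_nat.
    - rewrite (_ : a + k.+1%:R * d - (a + k%:R * d) = d)//.
      by rewrite -addn1 natrD; ring.
  have := S n.+1 (leqnn _); rewrite nd (addrC a) subrK => /le_trans; apply.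
  rewrite /D -nd le_eqVlt; apply/orP; left; apply/eqP.
  have : n.+1%:R != 0 :> R by rewrite pnatr_eq0.
  by move: (n.+1%:R : R) => N N0; clearbody d; field.
apply/eqP; rewrite -subr_eq0 -normr_le0; apply/ler_addgt0Pr => e e0.
rewrite add0r; pose n := Num.bound (D / e).
apply: (le_trans (Hn n)); rewrite ler_pdivrMr// mulrC -ler_pdivrMr//.
have De : 0 <= D / e by rewrite divr_ge0// ltW.
by rewrite ltW// (lt_trans (archi_boundP De))// ltr_nat.
Qed.

(** Two tangent-line inequalities: at [y] for the left one, at [x] for the right one. *)
Lemma expR_remainder (x y : R) :
  0 <= expR x - expR y - expR y * (x - y) <= (expR x - expR y) * (x - y).
Proof.
have H (u v : R) : expR v * (u - v) <= expR u - expR v.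
  have := expR_ge1Dx (u - v).
  rewrite expRB ler_pdivlMr ?expR_gt0//; lra.
have := H x y; have := H y x; lra.
Qed.

Lemma expR_dist (x y E K : R) : expR x <= E -> expR y <= E -> `|x - y| <= K ->
  `|expR x - expR y| <= E * K.
Proof.
move=> xE yE xyK.
have K0 : 0 <= K by apply: le_trans xyK.
have H (u v : R) : expR v <= E -> `|u - v| <= K -> - (E * K) <= expR u - expR v.
  move=> vE uvK; have /andP[+ _] := expR_remainder u v.
  have : `|expR v * (u - v)| <= E * K by rewrite normrM ler_pM// ger0_norm ?expR_ge0.
  rewrite ler_norml => /andP[+ _].
  set a := expR v * _; lra.
rewrite ler_norml H//= -[leRHS]opprK lerNr opprB H// distrC//.
Qed.

Lemma bmfun_expR d (T : measurableType d) (f : T -> R) : bmfun f ->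
  bmfun (fun x => expR (f x)).
Proof.
move=> [mf [C fC]]; split.
  by apply: measurableT_comp => //; exact: measurable_expR.
exists (expR C) => x; rewrite ger0_norm ?expR_ge0// ler_expR.
by rewrite (le_trans (ler_norm _)).
Qed.

(** The exponential of a primitive is bounded only on bounded intervals; the cut-off turns it into a
    [bmfun]. *)
Definition upto f (T t : R) := f t * (0 <= t <= T)%R%:R.

Lemma bmfun_upto f T : measurable_fun setT f ->
  (exists C, forall t, 0 <= t <= T -> `|f t| <= C) -> bmfun (upto f T).
Proof.
move=> mf [C fC]; split.
  apply: measurable_funM => //.
  rewrite (_ : (fun _ => _) = \1_(`[0, T]%classic : set R)); first exact: measurable_indic.
  by apply/funext => t; rewrite indicE mem_setE in_itv.
exists `|C| => t; rewrite /upto normrM; case: (boolP (0 <= t <= T)) => h.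
  by rewrite normr1 mulr1 (le_trans (fC _ h))// ler_norm.
by rewrite normr0 mulr0.
Qed.

Lemma bmfun_expR_prim f g T : bmfun f -> bmfun g ->
  bmfun (upto (fun t => g t * expR (prim f t)) T).
Proof.
move=> bf [mg [D gD]]; apply: bmfun_upto.
  apply: measurable_funM => //; apply: measurableT_comp => //.
  exact: measurable_prim.
have [_ [C fC]] := bf.
exists (D * expR (C * T)) => t /andP[t0 tT].
rewrite normrM ler_pM// ger0_norm ?expR_ge0// ler_expR.
have := prim_Lipschitz bf fC (lexx _) t0; rewrite prim0 !subr0 => /(le_trans (ler_norm _))/le_trans; apply.
by rewrite ler_wpM2l// (le_trans _ (fC 0)).
Qed.

(* [prim f] is only Lipschitz, so the chain rule is not available pointwise:
   the difference of the two sides has quadratic increments. *)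
Lemma expR_prim f T t : bmfun f -> 0 <= t -> t <= T ->
  expR (prim f t) = 1 + prim (upto (fun s => f s * expR (prim f s)) T) t.
Proof.
move=> bf t0 tT; set g := upto _ _.
have [_ [C fC]] := bf.
have bg : bmfun g by exact: bmfun_expR_prim.
have C0 : 0 <= C by apply: le_trans (fC 0).
pose E := expR (C * T).
have prim_le s : 0 <= s -> s <= T -> expR (prim f s) <= E.
  move=> s0 sT; rewrite ler_expR.
  have := prim_Lipschitz bf fC (lexx _) s0; rewrite prim0 !subr0 => /(le_trans (ler_norm _))/le_trans; apply.
  by rewrite ler_wpM2l.
have E0 : 0 <= E by exact: expR_ge0.
have dexp x y : 0 <= x -> x <= y -> y <= T -> `|expR (prim f y) - expR (prim f x)| <= E * (C * (y - x)).
  move=> x0 xy yT.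
  have y0 := le_trans x0 xy; have xT := le_trans xy yT.
  by apply: expR_dist; [exact: prim_le|exact: prim_le|exact: prim_Lipschitz].
pose F s := expR (prim f s) - prim g s.
suff : F t = F 0.
  by rewrite /F !prim0 expR0 subr0 => /eqP; rewrite subr_eq => /eqP.
apply: (@quadratic_increment_cst _ (E * C * C + C * (E * C))) => // x y x0 xy yt.
have yT := le_trans yt tT; have xT := le_trans xy yT.
have y0 := le_trans x0 xy.
(* Both primitives are put under one integral over []x, y]], whose integrand is of order [y - x];
   the integral is then of order [(y - x) ^ 2]. *)
have gE : prim g y - prim g x - expR (prim f x) * (prim f y - prim f x) =
    \int[mu]_(s in `]x, y]) (f s * (expR (prim f s) - expR (prim f x)) * (0 <= s <= T)%R%:R).
  rewrite (primB bg x0 xy) (primB bf x0 xy).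
  rewrite -(RintegralZl _ _ (bmfun_itv_integrable _ _ _ _ bf))//.
  rewrite -RintegralB//.
  - apply: eq_Rintegral => s; rewrite inE/= in_itv/= => /andP[xs sy].
    rewrite /g /upto (ltW (le_lt_trans x0 xs)) (le_trans sy yT)/=.
    by move: (expR _) (expR _) => u v; ring.
  - exact: bmfun_itv_integrable.
  - by apply: bmfun_itv_integrable; apply: bmfunM => //; exact: bmfun_cst.
have -> : F y - F x = (expR (prim f y) - expR (prim f x) - expR (prim f x) * (prim f y - prim f x)) -
   (prim g y - prim g x - expR (prim f x) * (prim f y - prim f x)).
  have id (u v a b c d : R) :
    (u - a) - (v - b) = (u - v - v * (c - d)) - (a - b - v * (c - d)) by ring.
  exact: id.
rewrite (le_trans (ler_normB _ _))// mulrDl lerD//.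
  have /andP[r0 r1] := expR_remainder (prim f y) (prim f x).
  rewrite ger0_norm// (le_trans r1)// (le_trans (ler_norm _))// normrM.
  rewrite (_ : E * C * C * (y - x) ^+ 2 = (E * (C * (y - x))) * (C * (y - x))); last by ring.
  by rewrite ler_pM// ?dexp// prim_Lipschitz.
rewrite gE.
have bh : bmfun (fun s => f s * (expR (prim f s) - expR (prim f x)) * (0 <= s <= T)%R%:R).
  apply: (@eq_bmfun _ _ _ (fun s => g s - upto (fun s => f s * expR (prim f x)) T s)).
    by move=> s; rewrite /g /upto; move: (expR _) (expR _) => u v; ring.
  apply: bmfunB; first exact: bg.
  apply: bmfun_upto.
    by apply: measurable_funM => //; case: bf.
  by exists (C * expR (prim f x)) => s _; rewrite normrM ler_pM// ger0_norm ?expR_ge0.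
apply: (le_trans (le_normr_Rintegral _ _)) => //; first exact: bmfun_itv_integrable.
have -> : C * (E * C) * (y - x) ^+ 2 = \int[mu]_(s in `]x, y]) (C * (E * (C * (y - x)))).
  rewrite Rintegral_cst//= lebesgue_measure_itv/= lte_fin.
  case: ltP => [_|ba]/=; first by ring.
  by rewrite (_ : x = y); [ring|apply/le_anti; rewrite xy].
apply: le_Rintegral => //.
- apply: bmfun_itv_integrable; case: bh => mh [D hD]; split.
    exact: measurableT_comp.
  by exists D => s; rewrite normr_id.
- exact/bmfun_itv_integrable/bmfun_cst.
- move=> s /=; rewrite in_itv/= => /andP[xs sy].
  have s0 : 0 <= s by rewrite ltW// (le_lt_trans x0).
  rewrite s0 (le_trans sy yT)/= mulr1 normrM ler_pM//.
  apply: (le_trans (dexp _ _ x0 (ltW xs) (le_trans sy yT))).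
  by rewrite ler_wpM2l// ler_wpM2l// lerD2r.
Qed.

End primitive.

(** * Trajectories and predictability *)

Section trajectories.
Context (R : realType) (S : pfinType).
Implicit Types (w : Omega R S) (m l : nat).

Lemma jump_time0 w : jump_time w 0 = 0%E.
Proof. by rewrite /jump_time big_ord0. Qed.

Lemma jump_timeS w m : jump_time w m.+1 = (jump_time w m + soj w m)%E.
Proof. by rewrite /jump_time big_ord_recr. Qed.

Lemma jump_time_ge0 w m : (0 <= jump_time w m)%E.
Proof. by apply: sume_ge0 => l _; exact/ltW/traj_soj_gt0. Qed.

Lemma le_jump_time w l m : (l <= m)%N -> (jump_time w l <= jump_time w m)%E.
Proof.
elim: m => [|m IH]; first by rewrite leqn0 => /eqP->.
rewrite leq_eqVlt => /predU1P[->//|/IH/le_trans]; apply.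
by rewrite jump_timeS leeDl// ltW// traj_soj_gt0.
Qed.

Lemma st_None_le w l m : (l <= m)%N -> st w l = None -> st w m = None.
Proof.
elim: m => [|m IH]; first by rewrite leqn0 => /eqP->.
rewrite leq_eqVlt => /predU1P[->//|/IH h /h]; exact: traj_absorb.
Qed.

Lemma jump_time_None w m : st w m = None -> jump_time w m = +oo%E.
Proof.
case: m => [/traj_start//|m] /traj_stop soo.
by rewrite jump_timeS soo addey// gt_eqF// (lt_le_trans _ (jump_time_ge0 _ _)).
Qed.

Lemma jump_time_fin w m : st w m <> None -> (jump_time w m < +oo)%E.
Proof.
move=> sm; apply: lte_sum_pinfty => l _; rewrite ltey; apply/eqP => /traj_stop sl.
by apply: sm; apply: st_None_le sl; exact: ltn_ord.
Qed.

Lemma jump_time_fin_num w m : st w m <> None -> jump_time w m \is a fin_num.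
Proof. by move=> /jump_time_fin h; rewrite ge0_fin_numE ?jump_time_ge0. Qed.

Lemma lt_jump_time w l m : (l < m)%N -> (jump_time w l < +oo)%E ->
  (jump_time w l < jump_time w m)%E.
Proof.
move=> lm loo; apply: lt_le_trans (le_jump_time w lm).
rewrite jump_timeS lteDl ?traj_soj_gt0//.
by rewrite ge0_fin_numE ?jump_time_ge0.
Qed.

Lemma measurable_st m (x : option S) : measurable [set w : Omega R S | st w m = x].
Proof. by apply: sub_sigma_algebra; left; exists m, x. Qed.

Lemma measurable_soj m : measurable_fun [set: Omega R S] (fun w => soj w m).
Proof.
by move=> _ Y mY; rewrite setTI; apply: sub_sigma_algebra; right; exists m, Y.
Qed.

Lemma measurable_jump_time m : measurable_fun [set: Omega R S] (fun w => jump_time w m).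
Proof. by apply: emeasurable_sum => l; exact: measurable_soj. Qed.

(* Jump times truncated at the horizon [T]; being bounded reals, all
   expectations below are of bounded variables. *)
Definition theta (T : R) m w : R := fine (mine (jump_time w m) T%:E).

Lemma theta_fin T m w : 0 <= T -> (theta T m w)%:E = mine (jump_time w m) T%:E.
Proof.
move=> T0; rewrite fineK// ge0_fin_numE ?le_min ?jump_time_ge0 ?lee_fin//.
by rewrite gt_min ltry orbT.
Qed.

Lemma theta_le T m w : 0 <= T -> theta T m w <= T.
Proof. by move=> T0; rewrite -lee_fin theta_fin// ge_min lexx orbT. Qed.

Lemma theta_ge0 T m w : 0 <= T -> 0 <= theta T m w.
Proof. by move=> T0; rewrite -lee_fin theta_fin// le_min jump_time_ge0 lee_fin. Qed.

Lemma le_theta T l m w : 0 <= T -> (l <= m)%N -> theta T l w <= theta T m w.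
Proof.
move=> T0 lm; rewrite -lee_fin !theta_fin// le_min !ge_min lexx orbT andbT.
by rewrite le_jump_time.
Qed.

Lemma theta_jump T m w : 0 <= T -> (jump_time w m <= T%:E)%E ->
  (theta T m w)%:E = jump_time w m.
Proof. by move=> T0 h; rewrite theta_fin// min_l. Qed.

Lemma theta_T T m w : 0 <= T -> (T%:E <= jump_time w m)%E -> theta T m w = T.
Proof. by move=> T0 h; rewrite /theta min_r. Qed.

Lemma theta0 T w : 0 <= T -> theta T 0 w = 0.
Proof. by move=> T0; rewrite /theta jump_time0 min_l ?lee_fin. Qed.

Lemma measurable_theta T m : measurable_fun setT (theta T m).
Proof.
apply: measurableT_comp; first exact: fine_measurable.
by apply: measurable_mine => //; exact: measurable_jump_time.
Qed.

Lemma measurable_natr d (U : measurableType d) (b : U -> bool) :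
  measurable_fun setT b -> measurable_fun setT (fun u => (b u)%:R : R).
Proof. by move=> mb; apply: (@measurableT_comp _ _ _ _ _ _ (fun x : bool => x%:R : R)). Qed.

Lemma bmfun_natr d (U : measurableType d) (b : U -> bool) :
  measurable_fun setT b -> bmfun (fun u => (b u)%:R : R).
Proof.
move=> mb; split; first exact: measurable_natr.
by exists 1 => u; case: (b u); rewrite ?normr1 ?normr0.
Qed.

Lemma measurable_jump_le m T :
  measurable_fun setT (fun w => (jump_time w m <= T%:E)%E).
Proof.
apply: (measurable_fun_bool true); rewrite setTI.
rewrite (_ : _ @^-1` _ = (fun w => jump_time w m) @^-1` `]-oo, T%:E]).
  rewrite -[X in measurable X]setTI; apply: measurable_jump_time => //.
  exact: emeasurable_itv.
by apply/seteqP; split => w /=; rewrite in_itv.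
Qed.

Lemma measurable_st_eq m x : measurable_fun setT (fun w => st w m == x).
Proof.
apply: (measurable_fun_bool true); rewrite setTI.
rewrite (_ : _ @^-1` _ = [set w | st w m = x]); first exact: measurable_st.
by apply/seteqP; split => w /eqP.
Qed.

Lemma bmfun_st m (Z : option S -> Omega R S -> R) : (forall x, bmfun (Z x)) ->
  bmfun (fun w => Z (st w m) w).
Proof.
move=> bZ; apply: (@eq_bmfun _ _ _ (fun w => \sum_x Z x w * (st w m == x)%:R)).
  move=> w; rewrite (bigD1 (st w m))//= eqxx mulr1 big1 ?addr0// => x.
  by rewrite eq_sym => /negPf->; rewrite mulr0.
apply: bmfun_sum => x; apply: bmfunM => //; apply: bmfun_natr.
exact: measurable_st_eq.
Qed.

Lemma bmfun_comp d (U : measurableType d) (g : U -> R) (f : R -> R) a b :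
  measurable_fun setT f -> measurable_fun setT g ->
  (exists C, forall t, a <= t <= b -> `|f t| <= C) ->
  (forall u, a <= g u <= b) -> bmfun (fun u => f (g u)).
Proof.
move=> mf mg [C fC] gab; split; first exact: measurableT_comp.
by exists C => u; exact: fC.
Qed.

End trajectories.

Section predictable_processes.
Context (R : realType) (S : pfinType).
Local Notation Om := (Omega R S).
Local Notation pdom := (@predictable_dom R S).

Definition filt_gens (t : R) : set (set Om) :=
  [set B | exists (m : nat) (s : R) (i : S), s <= t /\
     B = [set w | (jump_time w m <= s%:E)%E /\ st w m = Some i]].

Lemma filt_measurable t B : filt t B <-> measurable (B : set (g_sigma_algebraType (filt_gens t))).
Proof. by []. Qed.

Lemma filt_state t m x : filt t [set w : Om | (jump_time w m <= t%:E)%E /\ st w m = x].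
Proof.
case: x => [i|]; first by apply: sub_sigma_algebra; exists m, t, i.
rewrite (_ : [set _ | _] = set0); first exact: sigma_algebra0.
apply/seteqP; split => // w /= [h /jump_time_None e].
by rewrite e in h.
Qed.

Lemma filt_jump t m : filt t [set w : Om | (jump_time w m <= t%:E)%E].
Proof.
apply/filt_measurable.
rewrite (_ : [set _ | _] = \bigcup_(x in [set: option S]) [set w : Om | (jump_time w m <= t%:E)%E /\ st w m = x]).
  by apply: fin_bigcup_measurable => // x _; exact: filt_state.
by apply/seteqP; split => [w h|w [x _ []]//]; exists (st w m).
Qed.

(* The trace on [predictable_dom], so that measurability lemmas for total
   functions apply. *)
Definition pred_sets : set (set (Om * R)) :=
  [set C | predictable_sigma (pdom `&` C)].

Definition predictable_space := g_sigma_algebraType pred_sets.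

Lemma sigma_algebra_pred_sets : sigma_algebra setT pred_sets.
Proof.
split.
- by rewrite /pred_sets /= setI0; exact: sigma_algebra0.
- move=> C mC; rewrite /pred_sets /= (_ : _ `&` _ = pdom `\` (pdom `&` C)).
    exact: sigma_algebraCD.
  by apply/seteqP; split => p /= [pD]; [case=> _ nC|move=> nC]; split => //; [case|split => // pC; apply: nC].
- move=> F mF; rewrite /pred_sets /= setI_bigcupr.
  exact: sigma_algebra_bigcup.
Qed.

Lemma measurable_predT (C : set predictable_space) :
  measurable C <-> predictable_sigma (pdom `&` C).
Proof.
rewrite /measurable /=.
by rewrite (sigma_algebra_id sigma_algebra_pred_sets).
Qed.

Lemma measurable_after (s : R) (B : set Om) : 0 <= s -> filt s B ->
  measurable (B `*` [set t | s < t] : set predictable_space).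
Proof.
move=> s0 fB; apply/measurable_predT.
rewrite (_ : _ `&` _ = B `*` [set t | s < t]).
  by apply: sub_sigma_algebra; right; exists s, B.
apply/seteqP; split => [p [_ []]//|p [pB st]]; split => //; split => //=.
by rewrite (le_trans s0)// ltW.
Qed.

Lemma measurable_jump_lt_state m x :
  measurable ([set p | (jump_time p.1 m < p.2%:E)%E /\ st p.1 m = x] : set predictable_space).
Proof.
(* A nonnegative rational [r] strictly before [t] and not before the jump reduces the event to a
   countable union of generators of the predictable sigma-algebra. *)
rewrite (_ : [set _ | _] = \bigcup_(r : rat) (if 0 <= ratr r :> R then
  [set w : Om | (jump_time w m <= (ratr r)%:E)%E /\ st w m = x] `*` [set t | ratr r < t]
  else set0)).
  apply: bigcupT_measurable_rat => r; case: ifPn => // r0.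
  by apply: measurable_after => //; exact: filt_state.
apply/seteqP; split => [p /= [h sx]|p [r _]].
  have jf : jump_time p.1 m \is a fin_num.
    by rewrite ge0_fin_numE ?jump_time_ge0// (lt_trans h)// ltry.
  have : fine (jump_time p.1 m) < p.2 by rewrite -lte_fin fineK.
  move=> /rat_in_itvoo[r]; rewrite in_itv/= => /andP[jr rp].
  exists r => //; rewrite ifT; last first.
    by rewrite (le_trans _ (ltW jr))// fine_ge0// jump_time_ge0.
  split => //=; split => //.
  by rewrite -(fineK jf) lee_fin ltW.
by case: ifP => // r0 [[/= h sx] rp]; split => //; rewrite (le_lt_trans h)// lte_fin.
Qed.

Lemma measurable_jump_lt m :
  measurable_fun [set: predictable_space] (fun p => (jump_time p.1 m < p.2%:E)%E).
Proof.
apply: (measurable_fun_bool true); rewrite setTI.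
rewrite (_ : _ @^-1` _ = \bigcup_(x in [set: option S])
    [set p | (jump_time p.1 m < p.2%:E)%E /\ st p.1 m = x]).
  by apply: fin_bigcup_measurable => // x _; exact: measurable_jump_lt_state.
by apply/seteqP; split => [p h|p [x _ []]//]; exists (st p.1 m).
Qed.

(** The jump time itself is not known before it occurs, but its minimum with the current time is: it
    exceeds [x >= 0] exactly when [t > x] and the jump has not occurred by time [x]. *)
Lemma measurable_min_jump m :
  measurable_fun [set: predictable_space] (fun p => fine (mine (jump_time p.1 m) p.2%:E) : R).
Proof.
apply: (measurability _ (RGenOInfty.measurableE R)) => //= _ [_ [x ->] <-].
rewrite setTI.
have mlt (p : predictable_space) : (x < fine (mine (jump_time p.1 m) p.2%:E)) =
    (x%:E < jump_time p.1 m)%E && (x < p.2).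
  rewrite -lte_fin fineK ?lt_min ?lte_fin//.
  rewrite fin_numElt gt_min ltry orbT andbT lt_min ltNyr andbT.
  by rewrite (lt_le_trans _ (jump_time_ge0 _ _)).
have [x0|x0] := leP 0 x.
  rewrite (_ : _ @^-1` _ = (~` [set w : Om | (jump_time w m <= x%:E)%E]) `*` [set t | x < t]).
    apply: measurable_after => //; apply: sigma_algebraC; exact: filt_jump.
  apply/seteqP; split => p /=; rewrite in_itv/= andbT mlt.
    by move=> /andP[h1 h2]; split => //=; apply/negP; rewrite -ltNge.
  by move=> [/= /negP]; rewrite -ltNge => -> ->.
apply/measurable_predT.
rewrite (_ : _ `&` _ = pdom `&` setT).
  by apply/measurable_predT; exact: measurableT.
apply/seteqP; split => p [pD] //= _; split => //.
rewrite in_itv/= andbT mlt (lt_le_trans x0 pD.2) andbT.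
by rewrite (lt_le_trans _ (jump_time_ge0 _ _)).
Qed.

Lemma measurable_time : measurable_fun [set: predictable_space] (snd : predictable_space -> R).
Proof.
apply: (measurability _ (RGenOInfty.measurableE R)) => //= _ [_ [x ->] <-].
rewrite setTI.
have [x0|x0] := leP 0 x.
  rewrite (_ : _ @^-1` _ = [set: Om] `*` [set t | x < t]).
    by apply: measurable_after => //; apply/filt_measurable; exact: measurableT.
  by apply/seteqP; split => p /=; rewrite in_itv/= andbT => // -[].
apply/measurable_predT.
rewrite (_ : _ `&` _ = pdom `&` setT).
  by apply/measurable_predT; exact: measurableT.
apply/seteqP; split => p [pD] //= _; split => //.
by rewrite in_itv/= andbT (lt_le_trans x0 pD.2).
Qed.

(* [Z] is measurable with respect to the history up to and including the m-th
   jump. *)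
Definition past (m : nat) (Z : Om -> R) : Prop :=
  measurable_fun [set: predictable_space] (fun p => Z p.1 * (jump_time p.1 m < p.2%:E)%E%:R).

Lemma eq_past m Z Z' : Z =1 Z' -> past m Z -> past m Z'.
Proof. by move=> /funext->. Qed.

Lemma past_cst m c : past m (fun=> c).
Proof.
apply: measurable_funM => //; apply: measurable_natr; exact: measurable_jump_lt.
Qed.

Lemma pastM m Z Z' : past m Z -> past m Z' -> past m (fun w => Z w * Z' w).
Proof.
move=> pZ pZ'; rewrite /past (_ : (fun _ => _) = (fun p : predictable_space =>
  (Z p.1 * (jump_time p.1 m < p.2%:E)%E%:R) * (Z' p.1 * (jump_time p.1 m < p.2%:E)%E%:R))).
  exact: measurable_funM.
apply/funext => p; case: (_ < _)%E; rewrite ?mulr1 ?mulr0//.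
Qed.

Lemma past_sum (I : Type) (s : seq I) m (Z : I -> Om -> R) :
  (forall i, past m (Z i)) -> past m (fun w => \sum_(i <- s) Z i w).
Proof.
move=> pZ; rewrite /past (_ : (fun _ => _) = (fun p : predictable_space =>
  \sum_(i <- s) (Z i p.1 * (jump_time p.1 m < p.2%:E)%E%:R))).
  by apply: measurable_sum => i; exact: pZ.
by apply/funext => p; rewrite mulr_suml.
Qed.

Lemma past_le l m Z : (l <= m)%N -> past l Z -> past m Z.
Proof.
move=> lm pZ; rewrite /past (_ : (fun _ => _) = (fun p : predictable_space =>
  (Z p.1 * (jump_time p.1 l < p.2%:E)%E%:R) * (jump_time p.1 m < p.2%:E)%E%:R)).
  apply: measurable_funM => //; apply: measurable_natr; exact: measurable_jump_lt.
apply/funext => p; have [h|_] := boolP (jump_time p.1 m < _)%E; rewrite ?mulr0// !mulr1.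
by rewrite (le_lt_trans (le_jump_time _ lm) h) mulr1.
Qed.

Lemma past_st_eq m x : past m (fun w => (st w m == x)%:R).
Proof.
rewrite /past (_ : (fun _ => _) = (fun p : predictable_space =>
  ((jump_time p.1 m < p.2%:E)%E && (st p.1 m == x))%:R)).
  apply: measurable_natr; apply: (measurable_fun_bool true); rewrite setTI.
  rewrite (_ : _ @^-1` _ = [set p | (jump_time p.1 m < p.2%:E)%E /\ st p.1 m = x]).
    exact: measurable_jump_lt_state.
  by apply/seteqP; split => p /=; [move=> /andP[-> /eqP]|move=> [-> /eqP]].
by apply/funext => p; rewrite -natrM mulnb andbC.
Qed.

Lemma past_st m l (Z : option S -> Om -> R) : (l <= m)%N -> (forall x, past m (Z x)) ->
  past m (fun w => Z (st w l) w).
Proof.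
move=> lm pZ; apply: (@eq_past _ (fun w => \sum_x Z x w * (st w l == x)%:R)).
  move=> w; rewrite (bigD1 (st w l))//= eqxx mulr1 big1 ?addr0// => x.
  by rewrite eq_sym => /negPf->; rewrite mulr0.
apply: past_sum => x; apply: pastM => //; apply: past_le lm _; exact: past_st_eq.
Qed.

Lemma past_theta T m l (g : R -> R) : 0 <= T -> (l <= m)%N -> measurable_fun setT g ->
  past m (fun w => g (theta T l w)).
Proof.
(* On the event that the [m]-th jump lies before [t], cutting the [l]-th jump time at [t] changes
   nothing, and the cut version is predictable. *)
move=> T0 lm mg; rewrite /past (_ : (fun _ => _) = (fun p : predictable_space =>
  g (Num.min (fine (mine (jump_time p.1 l) p.2%:E)) T) * (jump_time p.1 m < p.2%:E)%E%:R)).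
  apply: measurable_funM; last by apply: measurable_natr; exact: measurable_jump_lt.
  apply: measurableT_comp => //; apply: measurable_minr => //.
  exact: measurable_min_jump.
apply/funext => p; have [h|_] := boolP (jump_time p.1 m < _)%E; rewrite ?mulr0//.
have hl := le_lt_trans (le_jump_time _ lm) h.
have jf : jump_time p.1 l \is a fin_num.
  by rewrite ge0_fin_numE ?jump_time_ge0// (lt_trans hl)// ltry.
congr (g _ * _); rewrite /theta (min_l (ltW hl)).
by rewrite -(fineK jf) -EFin_min.
Qed.

End predictable_processes.

Section state_process.
Context (R : realType) (S : pfinType).
Implicit Types (w : Omega R S) (m : nat) (t : R).

Lemma xi_leftE w t m : (jump_time w m < t%:E)%E -> (t%:E <= jump_time w m.+1)%E ->
  xi_left w t = st w m.
Proof.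
move=> mt tm; rewrite /xi_left leNgt -lte_fin (le_lt_trans (jump_time_ge0 _ _) mt)/=.
apply: xget_unique; first by exists m.
move=> _ [n [nt tn ->]]; congr (st w _); apply/eqP.
rewrite eqn_leq; apply/andP; split; rewrite leqNgt; apply/negP => h.
- by have := lt_le_trans nt (le_trans tm (le_jump_time w h)); rewrite ltxx.
- by have := lt_le_trans mt (le_trans tn (le_jump_time w h)); rewrite ltxx.
Qed.

Lemma xiE w t m : (jump_time w m <= t%:E)%E -> (t%:E < jump_time w m.+1)%E ->
  xi w t = st w m.
Proof.
move=> mt tm; apply: xget_unique; first by exists m.
move=> _ [n [nt tn ->]]; congr (st w _); apply/eqP.
rewrite eqn_leq; apply/andP; split; rewrite leqNgt; apply/negP => h.
- by have := le_lt_trans nt (lt_le_trans tm (le_jump_time w h)); rewrite ltxx.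
- by have := le_lt_trans mt (lt_le_trans tn (le_jump_time w h)); rewrite ltxx.
Qed.

Lemma theta_lt_itv T m w t : 0 <= T ->
  [&& (jump_time w m < t%:E)%E, (t%:E <= jump_time w m.+1)%E & t <= T] =
  (theta T m w < t <= theta T m.+1 w).
Proof.
move=> T0.
have -> : (theta T m w < t) = (jump_time w m < t%:E)%E || (T < t).
  by rewrite -lte_fin theta_fin// gt_min lte_fin.
have -> : (t <= theta T m.+1 w) = (t%:E <= jump_time w m.+1)%E && (t <= T).
  by rewrite -lee_fin theta_fin// le_min lee_fin.
have [tT|] := leP t T; last by rewrite !andbF.
by rewrite orbF andbT.
Qed.

End state_process.

(** * The compensator tested on a single jump *)

Lemma Rintegral_indic_itv (R : realType) (f : R -> R) (a b c : R) :
  bmfun f -> 0 <= a -> a <= b ->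
  (\int[lebesgue_measure]_(t in [set t : R | (0 <= t)%R])
     (c * (f t * (a < t <= b)%R%:R))%:E = (c * (prim f b - prim f a))%:E)%E.
Proof.
move=> bf a0 ab.
have fi : lebesgue_measure.-integrable `]a, b] (EFin \o f) by exact: bmfun_itv_integrable.
rewrite primB// -RintegralZl// /Rintegral fineK; last first.
  apply: integrable_fin_num => //.
  by apply: (@bmfun_itv_integrable _ (fun t => c * f t)); apply: bmfunM => //; exact: bmfun_cst.
rewrite [in RHS](_ : [set` `]a, b]] = [set t | 0 <= t] `&` [set` `]a, b]]); last first.
  apply/seteqP; split => t /=; last by case.
  by rewrite in_itv/= => /andP[at1 tb]; rewrite (le_trans a0 (ltW at1)) at1.
rewrite [RHS]integral_mkcondr; apply: eq_integral => t _.
rewrite patchE mem_setE in_itv/=; case: ifP => _; rewrite ?mulr1// !mulr0//.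
Qed.

Section compensator.
Context (R : realType) (S : pfinType) (A : ptopologicalType) (M : ctmdp R S A).
Variables (i0 : S) (pi : policy M) (P : probability (Omega R S) R).
Hypothesis law : process_law i0 pi P.
Variable q : S -> S -> R -> R.
Hypothesis qE : forall i j t, 0 <= t -> pol_rate pi (Some i) t j = (q i j t)%:E.
Hypothesis bq : forall i j, bmfun (q i j).

(** The test process is [Z * phi t] on []T_m, T_(m+1)]], cut at [T], for trajectories whose [m]-th
    state is [i], and charges only jumps into [j]. On the jump side only the jump number [m + 1]
    survives; on the compensator side the time integral runs over one sojourn. *)
Lemma compensator_step (T : R) m i j (Z : Omega R S -> R) (phi : R -> R) :
  0 <= T -> (forall w, 0 <= Z w) -> past m Z ->
  (forall t, 0 <= phi t) -> bmfun phi ->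
  \int[P]_w (Z w * (st w m == Some i)%:R * (st w m.+1 == Some j)%:R *
    (jump_time w m.+1 <= T%:E)%E%:R * phi (theta T m.+1 w)) =
  \int[P]_w ((j != i)%:R * (Z w * (st w m == Some i)%:R) *
    (prim (fun t => phi t * q i j t) (theta T m.+1 w) -
     prim (fun t => phi t * q i j t) (theta T m w))).
Proof.
move=> T0 Z0 pZ phi0 bphi.
pose H (w : Omega R S) (t : R) (j' : S) : \bar R :=
  ((j' == j)%:R * (Z w * (st w m == Some i)%:R * (jump_time w m < t%:E)%E%:R *
   ((t%:E <= jump_time w m.+1)%E%:R * (t <= T)%R%:R * phi t)))%:E.
have H0 w t j' : (0 <= H w t j')%E by rewrite lee_fin !mulr_ge0.
have pH j' : predictable (fun w t => H w t j').
  move=> Y mY; apply/measurable_predT.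
  have mH : measurable_fun [set: predictable_space R S] (fun p => H p.1 p.2 j').
    apply/measurable_EFinP; apply: measurable_funM => //; apply: measurable_funM.
      have pst : past m (fun w : Omega R S => (st w m == Some i)%:R).
        exact: past_st_eq.
      exact: (pastM pZ pst).
    apply: measurable_funM; last first.
      by apply: measurableT_comp; [exact: bphi.1|exact: measurable_time].
    apply: measurable_funM; apply: measurable_natr.
      rewrite (_ : (fun _ => _) = (fun p : predictable_space R S => ~~ (jump_time p.1 m.+1 < p.2%:E)%E)).
        apply: measurable_neg; exact: measurable_jump_lt.
      by apply/funext => p; rewrite leNgt.
    by apply: measurable_fun_ler => //; exact: measurable_time.
  by rewrite -[[set p | _]]setTI; exact: mH.
have := law.2 H H0 pH; rewrite /Rintegral.
move=> LR; congr fine; apply: etrans; last apply: (etrans LR).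
- apply: eq_integral => w _.
  (* Earlier jumps occur no later than [T_m] and later ones after [T_(m+1)], so their test values
     vanish. *)
  rewrite (@nneseriesD1 _ _ m xpredT)//; last first.
    by move=> k _; case: (st w k.+1) => [j'|//]; exact: H0.
  rewrite [X in (_ + X)%E]eseries0 ?adde0; last first.
    move=> k _ /= km; case sk: (st w k.+1) => [j'|//]; congr (_%:E).
    have sk' : st w k.+1 <> None by rewrite sk.
    rewrite fineK ?jump_time_fin_num//.
    have [h|h|/eqP] := ltngtP k m; last by rewrite (negPf km).
    + have -> : (jump_time w m < jump_time w k.+1)%E = false.
        by apply/negbTE; rewrite -leNgt le_jump_time.
      by rewrite !(mulr0, mul0r).
    + have -> : (jump_time w k.+1 <= jump_time w m.+1)%E = false.
        apply/negbTE; rewrite -ltNge lt_jump_time//.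
        by rewrite (le_lt_trans (le_jump_time w (_ : _ <= k.+1)%N))// ?jump_time_fin// ltnW.
      by rewrite !(mulr0, mul0r).
  case sm: (st w m.+1) => [j'|]; last by rewrite !(mulr0, mul0r).
  have sm' : st w m.+1 <> None by rewrite sm.
  congr (_%:E).
  rewrite fineK ?jump_time_fin_num// lexx lt_jump_time//; last first.
    by rewrite (le_lt_trans (le_jump_time w (leqnSn m)))// jump_time_fin.
  rewrite -lee_fin fineK ?jump_time_fin_num//.
  rewrite (_ : (Some j' == Some j) = (j' == j))//.
  have [h|_] := boolP (jump_time w m.+1 <= T%:E)%E; last by rewrite !(mulr0, mul0r).
  have -> : theta T m.+1 w = fine (jump_time w m.+1) by rewrite /theta min_l.
  by rewrite /= !mulr1 !mul1r mulrAC mulrC.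
- apply: eq_integral => w _.
  rewrite -Rintegral_indic_itv; [|exact: bmfunM|exact: theta_ge0|exact: le_theta].
  apply: eq_integral => t; rewrite inE/= => t0.
  rewrite -theta_lt_itv//.
  have [h|h] := boolP [&& _, _ & _]; last first.
    rewrite !(mulr0, mul0r) big1// => j' _; rewrite /H.
    move: h; rewrite !negb_and => /or3P[] /negPf->;
      by rewrite !(mulr0, mul0r, mul0e).
  have /and3P[h1 h2 h3] := h.
  rewrite (xi_leftE h1 h2); case: (eqVneq (st w m) (Some i)) => [sm|sm]; last first.
    rewrite !(mulr0, mul0r) big1// => j' _.
    by rewrite /H (negPf sm) !(mulr0, mul0r, mul0e).
  rewrite sm (eq_bigr (fun j' => (H w t j' * (q i j' t)%:E)%E)); last first.
    by move=> j' _; rewrite qE.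
  have [ji|ji] := eqVneq j i.
    rewrite !mul0r big1// => j'; rewrite /H => ji'.
    rewrite (_ : (j' == j)= false) ?mul0r ?mul0e//.
    by apply/negP => /eqP e; move: ji'; rewrite e ji eqxx.
  rewrite (bigD1 j)/=; last by apply: contraNneq ji => -[->].
  rewrite [X in (_ + X)%E]big1 ?adde0; last first.
    by move=> j' /andP[_ /negPf e]; rewrite /H e mul0r mul0e.
  rewrite /H eqxx sm eqxx h1 h2 h3 -EFinM; congr (_%:E).
  by rewrite !mulr1 !mul1r mulrA.
Qed.

End compensator.

Local Opaque expR prim.

(** * Dynkin's formula *)

Section expectation.
Context d (T : measurableType d) (R : realType) (P : probability T R).
Implicit Types f g : T -> R.

Definition Ex f := \int[P]_w f w.

Lemma bmfun_int f : bmfun f -> P.-integrable setT (EFin \o f).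
Proof. by move=> bf; apply: bmfun_integrable. Qed.

Lemma ExE f : bmfun f -> (Ex f)%:E = (\int[P]_w (f w)%:E)%E.
Proof. by move=> bf; rewrite /Ex /Rintegral fineK// integrable_fin_num//; exact: bmfun_int. Qed.

Lemma ExD f g : bmfun f -> bmfun g -> Ex (fun w => f w + g w) = Ex f + Ex g.
Proof. by move=> bf bg; rewrite /Ex RintegralD//; exact: bmfun_int. Qed.

Lemma ExB f g : bmfun f -> bmfun g -> Ex (fun w => f w - g w) = Ex f - Ex g.
Proof. by move=> bf bg; rewrite /Ex RintegralB//; exact: bmfun_int. Qed.

Lemma ExZ c f : bmfun f -> Ex (fun w => c * f w) = c * Ex f.
Proof. by move=> bf; rewrite /Ex RintegralZl//; exact: bmfun_int. Qed.

Lemma Ex_cst c : Ex (fun=> c) = c.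
Proof. by rewrite /Ex Rintegral_cst//= probability_setT mulr1. Qed.

Lemma Ex_ge0 f : (forall w, 0 <= f w) -> 0 <= Ex f.
Proof. by move=> f0; apply: Rintegral_ge0. Qed.

Lemma le_Ex f g : bmfun f -> bmfun g -> (forall w, f w <= g w) -> Ex f <= Ex g.
Proof. by move=> bf bg fg; apply: le_Rintegral => //; exact: bmfun_int. Qed.

Lemma Ex_sum (I : Type) (s : seq I) (F : I -> T -> R) : (forall i, bmfun (F i)) ->
  Ex (fun w => \sum_(i <- s) F i w) = \sum_(i <- s) Ex (F i).
Proof.
move=> bF; elim: s => [|i s IH].
  by rewrite big_nil -[RHS](Ex_cst 0); congr Ex; apply/funext => w; rewrite big_nil.
rewrite big_cons -IH -ExD//; last exact: bmfun_sum.
by congr Ex; apply/funext => w; rewrite big_cons.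
Qed.

Lemma eq_Ex f g : f =1 g -> Ex f = Ex g.
Proof. by move=> /funext->. Qed.

End expectation.

(** Here [p0] and [p] are the exponentials at the two ends of the [m]-th sojourn, [p'] is the
    inverse of [p0], [a1] and [b1] indicate that the jumps [m] and [m + 1] occur by the horizon, [v]
    and [v'] are values of [V], and [s] collects the jump terms of the drift. The first hypothesis
    holds because the truncated sojourn is empty when [a1 = 0]. *)
Fact stage_algebra (R : comRingType) (a W p p0 p' v v' a1 b1 s : R) :
  (p - p0) * a1 = p - p0 -> p0 * p' = 1 ->
  a * (W * (p * p')) * v * (a1 - b1) + a * W * (p * p') * v' * b1 -
  (a * W * v * a1 + a * W * p' * (v * (p - p0) + s)) =
  a * W * p' * p * ((v' - v) * b1) - a * W * p' * s.
Proof.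
move=> h1 h2.
have -> : a * (W * (p * p')) * v * (a1 - b1) =
  a * W * v * (p' * ((p - p0) * a1) + p0 * p' * a1 - p * p' * b1) by ring.
rewrite h1 h2; ring.
Qed.

Section dynkin.
Context (R : realType) (S : pfinType) (A : ptopologicalType) (M : ctmdp R S A).
Variables (i0 : S) (pi : policy M) (P : probability (Omega R S) R).
Hypothesis law : process_law i0 pi P.
Variable q : S -> S -> R -> R.
Hypothesis qE : forall i j t, 0 <= t -> pol_rate pi (Some i) t j = (q i j t)%:E.
Hypothesis bq : forall i j, bmfun (q i j).

Section functional.
Variables (ok : pred (option S)) (gam : option S -> R -> R).
Hypothesis bgam : forall x, bmfun (gam x).
Implicit Types (V : nat -> option S -> R) (w : Omega R S) (T : R) (m n : nat).

(* [weight T m] is exp of the integral of [gam (xi t) t] over [0, T_m /\ T]. *)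
Fixpoint weight T m w : R := if m is l.+1 then
  weight T l w * (expR (prim (gam (st w l)) (theta T l.+1 w)) *
                  expR (- prim (gam (st w l)) (theta T l w))) else 1.

Fixpoint alive m w : bool := if m is l.+1 then alive l w && ok (st w l.+1) else true.

(* The process is killed on leaving [ok].  At horizon [T], [entry] is the part
   that reaches the m-th jump, [stay] the part found in the m-th sojourn and
   [exit] the part killed at the (m+1)-st jump. *)
Definition entry V T m w : R :=
  (alive m w)%:R * weight T m w * V m (st w m) * (jump_time w m <= T%:E)%E%:R.

Definition stay V T m w : R := (alive m w)%:R * weight T m.+1 w * V m (st w m) *
  ((jump_time w m <= T%:E)%E%:R - (jump_time w m.+1 <= T%:E)%E%:R).

Definition exit V T m w : R := (alive m w)%:R * (~~ ok (st w m.+1))%:R *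
  weight T m.+1 w * V m.+1 (st w m.+1) * (jump_time w m.+1 <= T%:E)%E%:R.

(** The generator acts on functions of the pair of jump number and state: a jump to [j] also moves
    [m] to [m.+1]. *)
Definition gen V m i t : R := gam (Some i) t * V m (Some i) +
  \sum_(j | j != i) q i j t * (V m.+1 (Some j) - V m (Some i)).

(** The integral over the [m]-th sojourn, up to [T], of the running weight times [gen]; the negative
    exponent restarts the running exponential at the beginning of the sojourn. *)
Definition drift V T m w : R := (alive m w)%:R * weight T m w *
  \sum_i (st w m == Some i)%:R * expR (- prim (gam (Some i)) (theta T m w)) *
    (prim (upto (fun t => gen V m i t * expR (prim (gam (Some i)) t)) T) (theta T m.+1 w) -
     prim (upto (fun t => gen V m i t * expR (prim (gam (Some i)) t)) T) (theta T m w)).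

Lemma bmfun_prim_theta x T m : 0 <= T -> bmfun (fun w => prim (gam x) (theta T m w)).
Proof.
move=> T0; apply: (@bmfun_comp _ _ _ _ _ 0 T).
- exact: measurable_prim.
- exact: measurable_theta.
- have [_ [C gC]] := bgam x; exists (C * T) => t /andP[t0 tT].
  have := prim_Lipschitz (bgam x) gC (lexx _) t0; rewrite prim0 !subr0 => /le_trans; apply.
  by rewrite ler_wpM2l// (le_trans _ (gC 0)).
- by move=> w; rewrite theta_ge0// theta_le.
Qed.

Lemma bmfunN d (U : measurableType d) (f : U -> R) : bmfun f -> bmfun (fun x => - f x).
Proof.
move=> bf; apply: (@eq_bmfun _ _ _ (fun x => -1 * f x)).
  by move=> x; rewrite mulN1r.
by apply: bmfunM => //; exact: bmfun_cst.
Qed.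

Lemma bmfun_weight T m : 0 <= T -> bmfun (weight T m).
Proof.
move=> T0; elim: m => [|m IH]; first exact: bmfun_cst.
apply: bmfunM; first exact: IH.
apply: (@bmfun_st _ _ m (fun x w => expR (prim (gam x) (theta T m.+1 w)) *
                  expR (- prim (gam x) (theta T m w)))) => x.
apply: bmfunM; apply: bmfun_expR; first exact: bmfun_prim_theta.
by apply: bmfunN; exact: bmfun_prim_theta.
Qed.

Lemma bmfun_alive m : bmfun (fun w => (alive m w)%:R : R).
Proof.
elim: m => [|m IH]; first exact: bmfun_cst.
apply: (@eq_bmfun _ _ _ (fun w => (alive m w)%:R * (ok (st w m.+1))%:R)).
  by move=> w /=; rewrite -natrM mulnb.
apply: bmfunM => //.
by apply: (@bmfun_st _ _ m.+1 (fun x w => (ok x)%:R)) => x; exact: bmfun_cst.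
Qed.

Lemma past_weight T m : 0 <= T -> past m (weight T m).
Proof.
move=> T0; elim: m => [|m IH]; first exact: past_cst.
apply: pastM; first exact: (past_le (leqnSn m) IH).
apply: (@past_st _ _ m.+1 m (fun x w => expR (prim (gam x) (theta T m.+1 w)) *
                  expR (- prim (gam x) (theta T m w)))) => // x.
apply: pastM.
  apply: (@past_theta _ _ T _ _ (fun t => expR (prim (gam x) t))) => //.
  by apply: measurableT_comp => //; exact: measurable_prim.
apply: (@past_theta _ _ T _ _ (fun t => expR (- prim (gam x) t))) => //.
by apply: measurableT_comp => //; apply: measurable_funN; exact: measurable_prim.
Qed.

Lemma past_alive m : past m (fun w => (alive m w)%:R : R).
Proof.
elim: m => [|m IH]; first exact: past_cst.
apply: (@eq_past _ _ _ (fun w => (alive m w)%:R * (ok (st w m.+1))%:R)).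
  by move=> w /=; rewrite -natrM mulnb.
apply: pastM; first exact: (past_le (leqnSn m) IH).
by apply: (@past_st _ _ m.+1 m.+1 (fun x w => (ok x)%:R)) => // x; exact: past_cst.
Qed.

Lemma weight_gt0 T m w : 0 < weight T m w.
Proof. by elim: m => //= m IH; rewrite !mulr_gt0// expR_gt0. Qed.

Lemma bmfun_jump_le m T : bmfun (fun w : Omega R S => (jump_time w m <= T%:E)%E%:R : R).
Proof. by apply: bmfun_natr; exact: measurable_jump_le. Qed.

Lemma bmfun_stV V m n : bmfun (fun w : Omega R S => V m (st w n)).
Proof. by apply: (@bmfun_st _ _ n (fun x w => V m x)) => x; exact: bmfun_cst. Qed.

Lemma bmfun_entry V T m : 0 <= T -> bmfun (entry V T m).
Proof.
move=> T0; apply: bmfunM; last exact: bmfun_jump_le.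
apply: bmfunM; last exact: bmfun_stV.
by apply: bmfunM; [exact: bmfun_alive|exact: bmfun_weight].
Qed.

Lemma bmfun_stay V T m : 0 <= T -> bmfun (stay V T m).
Proof.
move=> T0; apply: bmfunM; last by apply: bmfunB; exact: bmfun_jump_le.
apply: bmfunM; last exact: bmfun_stV.
by apply: bmfunM; [exact: bmfun_alive|exact: bmfun_weight].
Qed.

Lemma bmfun_exit V T m : 0 <= T -> bmfun (exit V T m).
Proof.
move=> T0; apply: bmfunM; last exact: bmfun_jump_le.
apply: bmfunM; last exact: bmfun_stV.
apply: bmfunM; last exact: bmfun_weight.
apply: bmfunM; first exact: bmfun_alive.
by apply: (@bmfun_st _ _ m.+1 (fun x w => (~~ ok x)%:R)) => x; exact: bmfun_cst.
Qed.

Lemma bmfun_gen V m i : bmfun (gen V m i).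
Proof.
apply: bmfunD; first by apply: bmfunM => //; exact: bmfun_cst.
by apply: bmfun_sum => j; apply: bmfunM => //; exact: bmfun_cst.
Qed.

Lemma bmfun_gen_exp V m i T :
  bmfun (upto (fun t => gen V m i t * expR (prim (gam (Some i)) t)) T).
Proof. by apply: bmfun_expR_prim => //; exact: bmfun_gen. Qed.

Lemma bmfun_prim_comp f T m : 0 <= T -> bmfun f ->
  bmfun (fun w : Omega R S => prim f (theta T m w)).
Proof.
move=> T0 bf; apply: (@bmfun_comp _ _ _ _ _ 0 T).
- exact: measurable_prim.
- exact: measurable_theta.
- have [_ [C gC]] := bf; exists (C * T) => t /andP[t0 tT].
  have := prim_Lipschitz bf gC (lexx _) t0; rewrite prim0 !subr0 => /le_trans; apply.
  by rewrite ler_wpM2l// (le_trans _ (gC 0)).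
- by move=> w; rewrite theta_ge0// theta_le.
Qed.

Lemma bmfun_drift V T m : 0 <= T -> bmfun (drift V T m).
Proof.
move=> T0; apply: bmfunM.
  by apply: bmfunM; [exact: bmfun_alive|exact: bmfun_weight].
apply: bmfun_sum => i; apply: bmfunM; last first.
  by apply: bmfunB; apply: bmfun_prim_comp => //; exact: bmfun_gen_exp.
apply: bmfunM; first by apply: bmfun_natr; exact: measurable_st_eq.
by apply: bmfun_expR; apply: bmfunN; exact: bmfun_prim_comp.
Qed.

Lemma prim_sum (I : Type) (s : seq I) (Q : pred I) (f : I -> R -> R) t :
  (forall i, bmfun (f i)) ->
  prim (fun u => \sum_(i <- s | Q i) f i u) t = \sum_(i <- s | Q i) prim (f i) t.
Proof.
move=> bf; elim: s => [|i s IH].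
  rewrite big_nil -[RHS](mul0r (prim (fun=> 0 : R) t)) -primZ; last exact: bmfun_cst.
  by congr prim; apply/funext => u; rewrite big_nil mul0r.
rewrite big_cons -IH; case: ifP => Qi; last first.
  by congr prim; apply/funext => u; rewrite big_cons Qi.
rewrite -primD//; last exact: bmfun_sum.
by congr prim; apply/funext => u; rewrite big_cons Qi.
Qed.

(* The stage identity reduces, pathwise, to a linear combination of the
   differences whose expectations vanish by [compensator_step]. *)
Lemma stage V T m : 0 <= T -> (forall m, V m None = 0) ->
  Ex P (stay V T m) + Ex P (exit V T m) + Ex P (entry V T m.+1) =
  Ex P (entry V T m) + Ex P (drift V T m).
Proof.
move=> T0 VN.
(* The exponential accumulated since time 0 serves as [phi] in [compensator_step]; its value at the
   beginning of the sojourn is divided out by [Z], which depends on the past only. *)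
pose ph i := upto (fun t => 1 * expR (prim (gam (Some i)) t)) T.
have bph i : bmfun (ph i) by apply: bmfun_expR_prim => //; exact: bmfun_cst.
have ph0 i t : 0 <= ph i t by rewrite /ph /upto mul1r mulr_ge0// expR_ge0.
pose Z i w : R := (alive m w)%:R * weight T m w * expR (- prim (gam (Some i)) (theta T m w)).
have Z0 i w : 0 <= Z i w.
  by rewrite !mulr_ge0// ?expR_ge0// ltW// weight_gt0.
have pZ i : past m (Z i).
  apply: pastM; first by apply: pastM; [exact: past_alive|exact: past_weight].
  apply: (@past_theta _ _ T _ _ (fun t => expR (- prim (gam (Some i)) t))) => //.
  by apply: measurableT_comp => //; apply: measurable_funN; exact: measurable_prim.
have bZ i : bmfun (Z i).
  apply: bmfunM; first by apply: bmfunM; [exact: bmfun_alive|exact: bmfun_weight].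
  by apply: bmfun_expR; apply: bmfunN; exact: bmfun_prim_comp.
pose L (p : S * S) w : R := Z p.1 w * (st w m == Some p.1)%:R * (st w m.+1 == Some p.2)%:R *
    (jump_time w m.+1 <= T%:E)%E%:R * ph p.1 (theta T m.+1 w).
pose D (p : S * S) w : R := (p.2 != p.1)%:R * (Z p.1 w * (st w m == Some p.1)%:R) *
    (prim (fun t => ph p.1 t * q p.1 p.2 t) (theta T m.+1 w) -
     prim (fun t => ph p.1 t * q p.1 p.2 t) (theta T m w)).
have LD p : Ex P (L p) = Ex P (D p) by exact: (compensator_step law qE bq).
have bL p : bmfun (L p).
  apply: bmfunM; last first.
    apply: (@bmfun_comp _ _ _ _ _ 0 T); first by case: (bph p.1).
    - exact: measurable_theta.
    - by have [_ [C HC]] := bph p.1; exists C => t _.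
    - by move=> w; rewrite theta_ge0// theta_le.
  apply: bmfunM; last exact: bmfun_jump_le.
  apply: bmfunM; last by apply: bmfun_natr; exact: measurable_st_eq.
  by apply: bmfunM => //; apply: bmfun_natr; exact: measurable_st_eq.
have bD p : bmfun (D p).
  apply: bmfunM; last first.
    by apply: bmfunB; apply: bmfun_prim_comp => //; exact: bmfunM.
  apply: bmfunM; first exact: bmfun_cst.
  by apply: bmfunM => //; apply: bmfun_natr; exact: measurable_st_eq.
have [bs be ben ben1 bd] : [/\ bmfun (stay V T m), bmfun (exit V T m), bmfun (entry V T m),
    bmfun (entry V T m.+1) & bmfun (drift V T m)].
  by split; [exact: bmfun_stay|exact: bmfun_exit|exact: bmfun_entry|exact: bmfun_entry|exact: bmfun_drift].
apply/eqP; rewrite -subr_eq0; apply/eqP.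
rewrite -ExD// -ExD//; last exact: bmfunD.
rewrite -ExD// -ExB//; [|by apply: bmfunD => //; exact: bmfunD|exact: bmfunD].
rewrite (@eq_Ex _ _ _ _ _ (fun w => \sum_(p : S * S)
   (V m.+1 (Some p.2) - V m (Some p.1)) * (L p w - D p w))).
  rewrite Ex_sum; last first.
    by move=> p; apply: bmfunM; [exact: bmfun_cst|exact: bmfunB].
  apply: big1 => p _; rewrite ExZ; last exact: bmfunB.
  by rewrite ExB// LD subrr mulr0.
move=> w; rewrite -(pair_bigA _ (fun i j => (V m.+1 (Some j) - V m (Some i)) * (L (i, j) w - D (i, j) w)))/=.
case sm: (st w m) => [i|]; last first.
  have sm1 : st w m.+1 = None by apply: (@st_None_le _ _ w m).
  rewrite big1 => [|i _]; last first.
    by rewrite big1// => j _; rewrite /L /D sm !(mulr0, mul0r) subrr mulr0.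
  rewrite /stay /exit /entry /drift sm sm1 !VN big1; last first.
    by move=> i _; rewrite !mul0r.
  by rewrite !(mulr0, mul0r) !addr0 subrr.
rewrite (bigD1 i)//= [X in _ = _ + X]big1 ?addr0; last first.
  move=> i' /negPf ii'; rewrite big1// => j _.
  rewrite /L /D /= sm (_ : (Some i == Some i') = false) ?(mulr0, mul0r) ?subrr ?mulr0//.
  by rewrite -ii' eq_sym.
set aW := (alive m w)%:R * weight T m w.
set a1 : R := (jump_time w m <= T%:E)%E%:R; set b1 : R := (jump_time w m.+1 <= T%:E)%E%:R.
set th := theta T m w; set th' := theta T m.+1 w.
have [th0 thT th'0 th'T] : [/\ 0 <= th, th <= T, 0 <= th' & th' <= T].
  by split; rewrite ?theta_ge0 ?theta_le.
set p := expR (prim (gam (Some i)) th'); set p0 := expR (prim (gam (Some i)) th).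
have [p' pp'] : exists p', expR (- prim (gam (Some i)) th) = p' /\ p0 * p' = 1.
  by exists (expR (- prim (gam (Some i)) th)); rewrite expRxMexpNx_1.
move: pp' => [p'E pp'].
have ppa : (p - p0) * a1 = p - p0.
  rewrite /a1; case: leP => [_|Tm]; first by rewrite mulr1.
  rewrite mulr0 /p /p0 /th /th' !theta_T ?subrr ?(ltW Tm)//.
  by rewrite (le_trans (ltW Tm))// le_jump_time.
pose Dl j := prim (fun t => ph i t * q i j t) th' - prim (fun t => ph i t * q i j t) th.
(* [expR_prim] integrates the term [gam * V] of the generator exactly, which leaves only jump terms
   of the kind met in [compensator_step]. *)
have gE t : 0 <= t -> t <= T ->
    prim (upto (fun t => gen V m i t * expR (prim (gam (Some i)) t)) T) t =
    V m (Some i) * (expR (prim (gam (Some i)) t) - 1) +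
    \sum_(j | j != i) (V m.+1 (Some j) - V m (Some i)) * prim (fun t => ph i t * q i j t) t.
  move=> t0 tT; rewrite (expR_prim (bgam _) t0 tT) [1 + _]addrC addrK.
  rewrite [X in _ = _ + X](_ : _ = \sum_(j | j != i)
      prim (fun t => (V m.+1 (Some j) - V m (Some i)) * (ph i t * q i j t)) t); last first.
    by apply: eq_bigr => j _; rewrite primZ//; exact: bmfunM.
  rewrite -prim_sum; last by move=> j; apply: bmfunM; [exact: bmfun_cst|exact: bmfunM].
  rewrite -primZ; last exact: bmfun_expR_prim.
  rewrite -primD; last 2 first.
  - by apply: bmfunM; [exact: bmfun_cst|exact: bmfun_expR_prim].
  - by apply: bmfun_sum => j; apply: bmfunM; [exact: bmfun_cst|exact: bmfunM].
  congr prim; apply/funext => u; rewrite /ph /upto /gen.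
  rewrite mulrDl mulrDl mulr_suml mulr_suml; congr (_ + _).
    by move: (expR _) => e; ring.
  by apply: eq_bigr => j _; move: (expR _) => e; ring.
have drE : drift V T m w = aW * p' * (V m (Some i) * (p - p0) +
    \sum_(j | j != i) (V m.+1 (Some j) - V m (Some i)) * Dl j).
  rewrite /drift -/aW (bigD1 i)//= sm eqxx big1 ?addr0; last first.
    move=> j ji; rewrite (_ : (Some i == Some j) = false) ?mul0r//.
    by apply/negbTE; apply: contraNneq ji => -[->].
  rewrite mul1r -/th -/th' p'E !gE// -/p -/p0 -mulrA; congr (_ * (_ * _)).
  rewrite opprD addrACA -mulrBr -sumrB; congr (_ + _).
    by congr (_ * _); ring.
  by apply: eq_bigr => j _; rewrite /Dl mulrBr.
have phE : ph i th' = p by rewrite /ph /upto th'0 th'T mulr1 mul1r.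
have RE : \sum_j (V m.+1 (Some j) - V m (Some i)) * (L (i, j) w - D (i, j) w) =
    aW * p' * p * ((V m.+1 (st w m.+1) - V m (Some i)) * b1) -
    aW * p' * \sum_(j | j != i) (V m.+1 (Some j) - V m (Some i)) * Dl j.
  under eq_bigr do rewrite mulrBr.
  rewrite sumrB; congr (_ - _).
    rewrite /L /= sm eqxx phE /Z p'E -/aW -/b1.
    case sm1: (st w m.+1) => [j|]; last first.
      rewrite /b1 (jump_time_None sm1) leye_eq/= !mulr0 big1// => j _.
      by rewrite !(mulr0, mul0r).
    rewrite (bigD1 j)//= eqxx big1 ?addr0; last first.
      move=> k kj; rewrite (_ : (Some j == Some k) = false) ?(mulr0, mul0r)//.
      by apply/negbTE; apply: contraNneq kj => -[->].
    by rewrite /=; clearbody p b1 aW; ring.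
  rewrite (bigD1 i)//= {1}/D /= eqxx !mul0r mulr0 add0r mulr_sumr.
  apply: eq_bigr => j ji; rewrite /D /= ji sm eqxx /Z p'E -/aW -/(Dl j).
  by rewrite mulr1 mul1r mulrCA.
rewrite RE drE /stay /exit /entry sm /= -/a1 -/b1.
rewrite sm -/th -/th' -/p p'E.
have okE : (alive m w)%:R * (~~ ok (st w m.+1))%:R * (weight T m w * (p * p')) * V m.+1 (st w m.+1) * b1 +
  (alive m w && ok (st w m.+1))%:R * (weight T m w * (p * p')) * V m.+1 (st w m.+1) * b1 =
  aW * (p * p') * V m.+1 (st w m.+1) * b1.
  rewrite /aW; case: (alive m w); case: (ok _) => /=; move: (p) => p1; ring.
rewrite -[X in X - _ = _]addrA okE /aW.
move: (\sum_(j | _) _) (V m.+1 _) => s0 v'.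
exact: stage_algebra.
Qed.

End functional.
End dynkin.

Section dynkin_bounds.
Context (R : realType) (S : pfinType) (A : ptopologicalType) (M : ctmdp R S A).
Variables (i0 : S) (pi : policy M) (P : probability (Omega R S) R).
Hypothesis law : process_law i0 pi P.
Variable q : S -> S -> R -> R.
Hypothesis qE : forall i j t, 0 <= t -> pol_rate pi (Some i) t j = (q i j t)%:E.
Hypothesis bq : forall i j, bmfun (q i j).
Implicit Types (V : nat -> option S -> R) (w : Omega R S) (T : R) (m n : nat).
Implicit Types (ok : pred (option S)) (gam : option S -> R -> R).

Lemma Ex_entry0 ok gam V T : 0 <= T -> (forall x, bmfun (gam x)) ->
  Ex P (entry ok gam V T 0) = V 0%N (Some i0).
Proof.
move=> T0 bg; pose bad w : R := (st w 0 != Some i0)%:R.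
have bbad : bmfun bad by apply: bmfun_natr; apply: measurable_neg; exact: measurable_st_eq.
have Ebad : Ex P bad = 0.
  have [P1 _] := law.
  have bst : bmfun (fun w => (st w 0 == Some i0)%:R : R).
    by apply: bmfun_natr; exact: measurable_st_eq.
  have -> : bad = fun w => 1 - (st w 0 == Some i0)%:R.
    by apply/funext => w; rewrite /bad; case: (_ == _); rewrite /= ?subrr// subr0.
  rewrite ExB//; last exact: bmfun_cst.
  rewrite Ex_cst (_ : Ex P _ = 1) ?subrr//; apply: EFin_inj.
  rewrite ExE//.
  have -> : (fun w => ((st w 0 == Some i0)%:R : R)%:E) =
      (fun w => (\1_[set w | st w 0 = Some i0] w)%:E).
    apply/funext => w; rewrite indicE; congr ((nat_of_bool _)%:R%:E).
    by apply/idP/idP => [/eqP h|/set_mem/eqP//]; apply/mem_set.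
  rewrite integral_indic ?setIT//; exact: measurable_st.
have [_ [C VC]] := @bmfun_stV R S V 0 0.
pose D := C + `|V 0%N (Some i0)|.
(* The initial state is [i0] only almost surely. On the exceptional event the error is at most [D],
   and its indicator has expectation 0; the signs [s = 1] and [s = -1] give both inequalities. *)
have H (s : R) : `|s| = 1 ->
    Ex P (fun w => s * entry ok gam V T 0 w) <= s * V 0%N (Some i0).
  move=> s1; rewrite -[leRHS]addr0 -[X in _ + X](mulr0 D) -Ebad -ExZ// -[X in X + _](Ex_cst P) -ExD//; last 2 first.
  - exact: bmfun_cst.
  - by apply: bmfunM => //; exact: bmfun_cst.
  apply: le_Ex.
  - by apply: bmfunM; [exact: bmfun_cst|exact: bmfun_entry].
  - by apply: bmfunD; [exact: bmfun_cst|apply: bmfunM => //; exact: bmfun_cst].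
  move=> w; rewrite /entry /= jump_time0 lee_fin T0 /= !(mulr1, mul1r).
  rewrite /bad; case: eqVneq => [->|_] /=; first by rewrite mulr0 addr0.
  rewrite mulr1 -lerBlDl -mulrBr (le_trans (ler_norm _))// normrM s1 mul1r.
  by rewrite (le_trans (ler_normB _ _))// /D lerD2r.
apply/le_anti/andP; split.
  have := H 1; rewrite normr1 => /(_ erefl); rewrite mul1r => /(le_trans _); apply.
  by rewrite ExZ ?mul1r//; exact: bmfun_entry.
have := H (-1); rewrite normrN1 => /(_ erefl); rewrite ExZ; last exact: bmfun_entry.
by rewrite !mulN1r lerN2.
Qed.

Lemma dynkin_sum ok gam V T n : 0 <= T -> (forall x, bmfun (gam x)) ->
  (forall m, V m None = 0) ->
  \sum_(m < n) (Ex P (stay ok gam V T m) + Ex P (exit ok gam V T m)) +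
    Ex P (entry ok gam V T n) =
  V 0%N (Some i0) + \sum_(m < n) Ex P (drift q ok gam V T m).
Proof.
move=> T0 bg VN; elim: n => [|n IH].
  by rewrite !big_ord0 add0r addr0 Ex_entry0.
rewrite !big_ord_recr/= -addrA.
by rewrite (stage law qE bq) // addrA IH addrA.
Qed.

Lemma alive_ok ok m i w : alive ok m w -> st w m = Some i -> (m == 0)%N || ok (Some i).
Proof. by case: m => //= m /andP[_ +] sm; rewrite sm. Qed.

Lemma weight_eq gam T T' m w : 0 <= T -> T <= T' -> (jump_time w m <= T%:E)%E ->
  weight gam T m w = weight gam T' m w.
Proof.
move=> T0 TT'; have T'0 := le_trans T0 TT'.
have tE l : (jump_time w l <= T%:E)%E -> theta T l w = theta T' l w.
  move=> h; apply: EFin_inj; rewrite !theta_jump//.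
  by rewrite (le_trans h)// lee_fin.
elim: m => [|m IH] h; first by [].
have h' := le_trans (le_jump_time w (leqnSn m)) h.
by rewrite /= (IH h') (tE _ h) (tE _ h').
Qed.

Lemma eq_upto f T T' t : T <= T' -> t <= T -> upto f T t = upto f T' t :> R.
Proof.
by move=> TT' tT; rewrite /upto tT (le_trans tT TT').
Qed.

Section sub.
Variables (ok : pred (option S)) (gam : option S -> R -> R) (V : nat -> option S -> R).
Hypothesis bgam : forall x, bmfun (gam x).
Hypothesis VN : forall m, V m None = 0.
Hypothesis gen0 : forall m i t, 0 <= t -> (m == 0)%N || ok (Some i) ->
  0 <= gen q gam V m i t.

(** A longer horizon does not change the integrand before the shorter one; it only lengthens the
    interval over which a nonnegative function is integrated. *)
Lemma le_drift T T' m w : 0 <= T -> T <= T' ->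
  0 <= drift q ok gam V T m w <= drift q ok gam V T' m w.
Proof.
move=> T0 TT'; have T'0 := le_trans T0 TT'.
rewrite /drift; case: (boolP (alive ok m w)) => al; last by rewrite !mul0r lexx.
rewrite !mul1r.
have inc U i a b : (m == 0)%N || ok (Some i) -> 0 <= a -> a <= b ->
    0 <= prim (upto (fun t => gen q gam V m i t * expR (prim (gam (Some i)) t)) U) b -
         prim (upto (fun t => gen q gam V m i t * expR (prim (gam (Some i)) t)) U) a.
  move=> oki a0 ab; apply: prim_ge0 => //; first exact: bmfun_gen_exp.
  move=> s /andP[as1 _]; have s0 : 0 <= s by rewrite (le_trans a0)// ltW.
  by rewrite /upto mulr_ge0// mulr_ge0 ?expR_ge0// gen0.
have term0 U i : 0 <= U -> 0 <= (st w m == Some i)%:R * expR (- prim (gam (Some i)) (theta U m w)) *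
   (prim (upto (fun t => gen q gam V m i t * expR (prim (gam (Some i)) t)) U) (theta U m.+1 w) -
    prim (upto (fun t => gen q gam V m i t * expR (prim (gam (Some i)) t)) U) (theta U m w)).
  move=> U0; case: eqVneq => [sm|]; last by rewrite !mul0r.
  rewrite mulr_ge0// ?mul1r ?expR_ge0// inc ?theta_ge0 ?le_theta//.
  exact: alive_ok sm.
have W0 U : 0 <= weight gam U m w by rewrite ltW// weight_gt0.
apply/andP; split; first by rewrite mulr_ge0// sumr_ge0// => i _; exact: term0.
have [h|h] := leP (jump_time w m) T%:E; last first.
  rewrite big1 ?mulr0 ?mulr_ge0 ?sumr_ge0// => i _; first exact: term0.
  by rewrite !theta_T ?subrr ?mulr0 ?(ltW h)// (le_trans (ltW h))// le_jump_time.
rewrite (weight_eq _ T0 TT' h) ler_wpM2l// ler_sum// => i _.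
have tE : theta T' m w = theta T m w.
  by apply: EFin_inj; rewrite !theta_jump// (le_trans h)// lee_fin.
rewrite tE -!mulrA; case: eqVneq => [sm|]; last by rewrite !mul0r.
rewrite !mul1r ler_wpM2l ?expR_ge0//.
have pE t : t <= T ->
    prim (upto (fun t => gen q gam V m i t * expR (prim (gam (Some i)) t)) T) t =
    prim (upto (fun t => gen q gam V m i t * expR (prim (gam (Some i)) t)) T') t.
  by move=> tT; apply: eq_prim => s /andP[_ st']; apply: eq_upto => //; exact: le_trans tT.
rewrite (pE _ (theta_le m.+1 w T0)) (pE _ (theta_le m w T0)) lerD2r -subr_ge0; apply: inc.
- exact: alive_ok sm.
- exact: theta_ge0.
- by rewrite -lee_fin !theta_fin// le_min !ge_min lexx/= lee_fin TT' orbT.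
Qed.

Lemma dynkin_ge T n : 0 <= T -> V 0%N (Some i0) <=
  \sum_(m < n) (Ex P (stay ok gam V T m) + Ex P (exit ok gam V T m)) +
    Ex P (entry ok gam V T n).
Proof.
move=> T0; rewrite (dynkin_sum ok n T0 bgam VN) lerDl; apply: sumr_ge0 => m _.
by apply: Ex_ge0 => w; have /andP[] := le_drift m w T0 (lexx T).
Qed.

(** Comparing two horizons, rather than a horizon with time 0, is what later trades the mass alive
    at [T] for what happens between [T] and [T']. *)
Lemma dynkin_mono T T' n : 0 <= T -> T <= T' ->
  \sum_(m < n) (Ex P (stay ok gam V T m) + Ex P (exit ok gam V T m)) +
    Ex P (entry ok gam V T n) <=
  \sum_(m < n) (Ex P (stay ok gam V T' m) + Ex P (exit ok gam V T' m)) +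
    Ex P (entry ok gam V T' n).
Proof.
move=> T0 TT'; have T'0 := le_trans T0 TT'.
rewrite (dynkin_sum ok n T0 bgam VN) (dynkin_sum ok n T'0 bgam VN) lerD2l.
apply: ler_sum => m _; apply: le_Ex; [exact: bmfun_drift|exact: bmfun_drift|].
by move=> w; have /andP[] := le_drift m w T0 TT'.
Qed.

End sub.

(** This is [dynkin_ge] for [- V], as every term is linear in [V]. *)
Lemma dynkin_le ok gam V T n : (forall x, bmfun (gam x)) -> (forall m, V m None = 0) ->
  (forall m i t, 0 <= t -> (m == 0)%N || ok (Some i) -> gen q gam V m i t <= 0) ->
  0 <= T ->
  \sum_(m < n) (Ex P (stay ok gam V T m) + Ex P (exit ok gam V T m)) +
    Ex P (entry ok gam V T n) <= V 0%N (Some i0).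
Proof.
move=> bg VN gen0 T0.
have := @dynkin_ge ok gam (fun m x => - V m x) bg _ _ T n T0.
have EN f g : bmfun f -> (forall w, g w = - f w) -> Ex P g = - Ex P f.
  move=> bf gf; rewrite -mulN1r -ExZ//; apply: eq_Ex => w; rewrite gf mulN1r//.
have sN m : Ex P (stay ok gam (fun m x => - V m x) T m) = - Ex P (stay ok gam V T m).
  by apply: EN; [exact: bmfun_stay|move=> w; rewrite /stay mulrN mulNr].
have eN m : Ex P (exit ok gam (fun m x => - V m x) T m) = - Ex P (exit ok gam V T m).
  by apply: EN; [exact: bmfun_exit|move=> w; rewrite /exit mulrN mulNr].
rewrite (_ : Ex P (entry ok gam (fun m x => - V m x) T n) = - Ex P (entry ok gam V T n)); last first.
  by apply: EN; [exact: bmfun_entry|move=> w; rewrite /entry mulrN mulNr].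
under eq_bigr do rewrite sN eN -opprD.
rewrite sumrN -opprD lerN2; apply => [m|m i t t0 h]; first by rewrite VN oppr0.
rewrite (_ : gen _ _ _ _ _ _ = - gen q gam V m i t) ?oppr_ge0 ?gen0//.
rewrite /gen opprD mulrN; congr (_ + _); rewrite -sumrN; apply: eq_bigr => j _.
by rewrite opprK -mulrN opprB addrC.
Qed.

Section tail.

Lemma jump_rate_bounded : exists2 Lam, 0 <= Lam &
  forall i t, \sum_(j | j != i) q i j t <= Lam.
Proof.
have /choice[C HC] (p : S * S) : exists C, forall t, `|q p.1 p.2 t| <= C.
  by have [_ [C HC]] := bq p.1 p.2; exists C.
have C0 p : 0 <= C p by apply: le_trans (HC p 0).
exists (\sum_p C p); first exact: sumr_ge0.
move=> i t; apply: (@le_trans _ _ (\sum_j C (i, j))).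
  rewrite big_mkcond/=; apply: ler_sum => j _; case: ifP => _ //.
  by rewrite (le_trans (ler_norm _))// (HC (i, j)).
have -> : \sum_p C p = \sum_k \sum_j C (k, j).
  by rewrite pair_bigA; apply: eq_bigr => -[].
rewrite [leRHS](bigD1 i)//= lerDl.
by apply: sumr_ge0 => k _; apply: sumr_ge0.
Qed.

(* Dynkin with the weights [2 ^ m]: discounting at the maximal jump rate makes
   them a supersolution. *)
Lemma jump_tail T : 0 <= T -> exists2 K, 0 <= K & forall n,
  Ex P (fun w => (jump_time w n <= T%:E)%E%:R) <= K / 2 ^+ n.
Proof.
move=> T0; have [Lam L0 qL] := jump_rate_bounded.
exists (expR (Lam * T)) => [|n]; first exact: expR_ge0.
pose V m (x : option S) : R := if x is Some _ then 2 ^+ m else 0.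
pose gam (x : option S) (t : R) : R := - Lam.
have bg x : bmfun (gam x) by exact: bmfun_cst.
have := @dynkin_le predT gam V T n bg _ _ T0.
have p2 m : 0 <= 2 ^+ m :> R by exact: exprn_ge0.
have al m w : alive predT m w by elim: m => //= m ->.
have ct x t : 0 <= t -> prim (gam x) t = - Lam * t by move=> t0; exact: prim_cst.
have WE m w : st w m <> None -> weight gam T m w = expR (- Lam * theta T m w).
  elim: m => [|m IH] sm; first by rewrite /= theta0// mulr0 expR0.
  have sm' : st w m <> None by move=> /traj_absorb.
  rewrite /= (IH sm') !ct ?theta_ge0// -!expRD; congr expR.
  by rewrite addrC subrK.
move=> /(_ _ _)H; rewrite ler_pdivlMr ?exprn_gt0//.
have {}H : Ex P (entry predT gam V T n) <= 1.
  apply: le_trans (_ : _ <= V 0%N (Some i0)) _; last by rewrite /V expr0.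
  apply: le_trans (H _ _).
  - rewrite lerDr sumr_ge0// => m _; rewrite addr_ge0//; apply: Ex_ge0 => w.
      rewrite /stay !mulr_ge0 ?(ltW (weight_gt0 _ _ _ _))//; first by rewrite /V; case: (st w m).
      rewrite subr_ge0 ler_nat; case: leP => // h; case: leP => // h'.
      by have := le_lt_trans (le_trans (le_jump_time w (leqnSn m)) h) h'; rewrite ltxx.
    by rewrite /exit /= mulr0 !mul0r.
  - by [].
  - move=> m i t t0 _; rewrite /gen /V /gam.
    rewrite (eq_bigr (fun j => q i j t * 2 ^+ m)); last first.
      by move=> j _; rewrite exprS; ring.
    by rewrite -mulr_suml -mulrDl mulr_le0_ge0// addrC subr_le0.
rewrite mulrC -ExZ; last exact: bmfun_jump_le.
rewrite -[leRHS]mulr1; apply: le_trans (_ : expR (Lam * T) * Ex P (entry predT gam V T n) <= _); last first.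
  by rewrite ler_wpM2l// expR_ge0.
rewrite -ExZ; last exact: bmfun_entry.
apply: le_Ex.
- by apply: bmfunM; [exact: bmfun_cst|exact: bmfun_jump_le].
- by apply: bmfunM; [exact: bmfun_cst|exact: bmfun_entry].
move=> w; rewrite /entry al mul1r.
case: (boolP (jump_time w n <= T%:E)%E) => [h|_]; last by rewrite !mulr0.
have sn : st w n <> None by move=> /jump_time_None e; rewrite e in h.
rewrite !mulr1 WE// mulrA -expRD /V; case: (st w n) sn => // i _.
rewrite ler_peMl// -expR0 ler_expR mulNr subr_ge0 ler_wpM2l//.
exact: theta_le.
Qed.

Lemma weight_le gam C T m w : 0 <= T -> (forall x, bmfun (gam x)) ->
  (forall x t, `|gam x t| <= C) -> weight gam T m w <= expR (C * T).
Proof.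
move=> T0 bg gC; have C0 : 0 <= C by apply: le_trans (gC None 0).
apply: (@le_trans _ _ (expR (C * theta T m w))); last first.
  by rewrite ler_expR ler_wpM2l// theta_le.
elim: m => [|m IH]; first by rewrite /= theta0// mulr0 expR0.
rewrite /= -expRD.
have -> : C * theta T m.+1 w = C * theta T m w + C * (theta T m.+1 w - theta T m w) by ring.
rewrite [leRHS]expRD ler_pM ?expR_ge0 ?(ltW (weight_gt0 _ _ _ _))// ler_expR.
by rewrite (le_trans (ler_norm _))// prim_Lipschitz ?theta_ge0 ?le_theta.
Qed.

(** Lets [n] tend to infinity in Dynkin's formula at a fixed horizon: [n] jumps by time [T] have
    geometrically small probability, and weights and values are bounded. *)
Lemma entry_tail ok gam C V D T : 0 <= T -> (forall x, bmfun (gam x)) ->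
  (forall x t, `|gam x t| <= C) -> (forall m x, `|V m x| <= D) ->
  exists2 K, 0 <= K & forall n, `|Ex P (entry ok gam V T n)| <= K / 2 ^+ n.
Proof.
move=> T0 bg gC VD; have [K K0 KP] := jump_tail T0.
have D0 : 0 <= D by apply: le_trans (VD 0%N None).
pose E := expR (C * T) * D.
have E0 : 0 <= E by rewrite mulr_ge0// expR_ge0.
exists (E * K) => [|n]; first exact: mulr_ge0.
have H (s : R) : `|s| = 1 -> s * Ex P (entry ok gam V T n) <= E * K / 2 ^+ n.
  move=> s1; rewrite -mulrA; apply: le_trans (_ : E * Ex P (fun w => (jump_time w n <= T%:E)%E%:R) <= _); last first.
    by rewrite ler_wpM2l.
  rewrite -!ExZ; [|exact: bmfun_jump_le|exact: bmfun_entry].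
  apply: le_Ex.
  - by apply: bmfunM; [exact: bmfun_cst|exact: bmfun_entry].
  - by apply: bmfunM; [exact: bmfun_cst|exact: bmfun_jump_le].
  move=> w; rewrite /entry mulrA ler_wpM2r// (le_trans (ler_norm _))//.
  rewrite !normrM s1 mul1r /E ler_pM ?mulr_ge0//.
  rewrite (ger0_norm (ltW (weight_gt0 _ _ _ _))).
  apply: le_trans (@weight_le gam C T n w T0 bg gC).
  rewrite -[leRHS]mul1r ler_wpM2r ?(ltW (weight_gt0 _ _ _ _))//.
  by case: (alive _ _ _); rewrite ?normr1 ?normr0.
rewrite ler_norml lerNl; apply/andP; split.
  by rewrite -mulN1r H// normrN1.
by rewrite -[leLHS]mul1r H// normr1.
Qed.

End tail.

End dynkin_bounds.

(** * Elementary estimates for limits in the horizon and the jump number *)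

Lemma expRN_small (R : realType) (a D e : R) : 0 < a -> 0 <= D -> 0 < e ->
  exists2 t, 0 <= t & forall s, t <= s -> D * expR (- a * s) <= e.
Proof.
move=> a0 D0 e0; exists (D / (a * e)) => [|s ts]; first by rewrite divr_ge0// mulr_ge0// ltW.
have ds : D <= a * e * s by rewrite mulrC -ler_pdivrMr ?mulr_gt0.
rewrite mulNr expRN ler_pdivrMr ?expR_gt0// (le_trans ds)//.
rewrite -mulrA mulrCA ler_wpM2l ?(ltW e0)//.
by rewrite (le_trans _ (expR_ge1Dx _))// lerDr.
Qed.

Lemma half_pow_small (R : realType) (K e : R) : 0 <= K -> 0 < e ->
  exists n0, forall n, (n0 <= n)%N -> K / 2 ^+ n <= e.
Proof.
move=> K0 e0; pose n0 := Num.bound (K / e); exists n0 => n n0n.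
rewrite ler_pdivrMr ?exprn_gt0// mulrC -ler_pdivrMr//.
have Ke : 0 <= K / e by rewrite divr_ge0// ltW.
rewrite (le_trans (ltW (archi_boundP Ke)))// -natrX ler_nat -/n0.
by rewrite (leq_trans n0n)// ltnW// ltn_expl.
Qed.

Lemma ler_sum_ord (R : numDomainType) (n n' : nat) (F : nat -> R) :
  (n <= n')%N -> (forall m, 0 <= F m) -> \sum_(m < n) F m <= \sum_(m < n') F m.
Proof.
move=> nn' F0; rewrite -!(big_mkord xpredT) [leRHS](big_cat_nat _ (n := n))//=.
by rewrite lerDl sumr_ge0.
Qed.

Lemma sumB_le (R : numDomainType) n (F F' G G' : nat -> R) a :
  (forall m, F' m - F m <= a * (G' m - G m)) ->
  \sum_(m < n) F' m - \sum_(m < n) F m <= a * (\sum_(m < n) G' m - \sum_(m < n) G m).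
Proof. by move=> FG; rewrite -!sumrB mulr_sumr; exact: ler_sum. Qed.

Lemma le_ExB d (U : measurableType d) (R : realType) (P : probability U R)
    (f f' g g' : U -> R) a :
  bmfun f -> bmfun f' -> bmfun g -> bmfun g' ->
  (forall w, f' w - f w <= a * (g' w - g w)) ->
  Ex P f' - Ex P f <= a * (Ex P g' - Ex P g).
Proof.
move=> bf bf' bg bg' fg; rewrite -!ExB// -ExZ; last exact: bmfunB.
apply: le_Ex => //; first exact: bmfunB.
by apply: bmfunM; [exact: bmfun_cst|exact: bmfunB].
Qed.

Lemma le_ExZ d (U : measurableType d) (R : realType) (P : probability U R)
    (f g : U -> R) a :
  bmfun f -> bmfun g -> (forall w, f w <= a * g w) -> Ex P f <= a * Ex P g.
Proof.
move=> bf bg fg; rewrite -ExZ//; apply: le_Ex => //.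
by apply: bmfunM => //; exact: bmfun_cst.
Qed.

(** The comparison of horizons in [hitting_lower]: [a] and [a'] are the discounts at [T] and [T'],
    [B] is the undiscounted mass still alive, [E] and [H] are the hitting sums without and with
    discount, [en] is the leftover entry term; primes refer to [T']. *)
Fact lower_algebra (R : realFieldType)
    (B B' E E' H H' en en' a Ai a' ec Dk K tn eps y : R) :
  a * Ai = 1 -> 0 < a -> 0 <= a' -> Ai * Dk * (a' * ec) <= eps / 2 ->
  Ai * K / tn <= eps / 2 -> B' <= ec * Dk -> E' <= y -> H' - H <= a * (E' - E) ->
  en' <= K / tn -> 0 <= en -> a * B + H + en <= a' * B' + H' + en' ->
  B + E <= y + eps.
Proof.
move=> aA a0 a'0 h1 h2 sb ub hd en1 en0 G.
have h3 : a' * B' <= a' * (ec * Dk) by rewrite ler_wpM2l.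
have h1a : a * (Ai * Dk * (a' * ec)) <= a * (eps / 2) by rewrite ler_wpM2l// ltW.
have h2a : a * (Ai * K / tn) <= a * (eps / 2) by rewrite ler_wpM2l// ltW.
rewrite !mulrA aA !mul1r in h1a h2a.
have h4 : a * E' <= a * y by rewrite ler_wpM2l// ltW.
rewrite -(ler_pM2l a0).
move: h3 h4 h1a h2a hd en1 G; move: (K / tn) => k; lra.
Qed.

(** The final estimate of [hitting_lower]: near the supremum [s] of the hitting sums [E], the bound
    [B + E <= s] leaves almost nothing for the mass [B] still alive. *)
Fact lower_algebra' (R : realFieldType) (st B E E0 en Kt s v k eps : R) :
  0 <= k -> v <= st + E + en -> st <= k * B -> B + E <= s -> en <= Kt ->
  Kt <= eps / 2 -> E <= s -> s - eps / (2 * (k + 1)) < E0 -> E0 <= E -> 0 < eps ->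
  v <= s + eps.
Proof.
move=> k0 dge stb k1 en1 h2 u1 Ysup sub eps0.
have h3 : k * B <= k * (eps / (2 * (k + 1))) by rewrite ler_wpM2l//; lra.
have h4 : k * (eps / (2 * (k + 1))) <= eps / 2.
  by rewrite mulrCA ler_wpM2l ?(ltW eps0)// ler_pdivrMr ?mulr_gt0//; lra.
lra.
Qed.

(** * Hitting times *)

Section nonneg.
Context (R : realType) (S : pfinType).
Variables (ok : pred (option S)) (gam : option S -> R -> R) (V : nat -> option S -> R).
Hypothesis V0 : forall m x, 0 <= V m x.

Lemma jump_le_decr m T (w : Omega R S) :
  (jump_time w m.+1 <= T%:E)%E%:R <= (jump_time w m <= T%:E)%E%:R :> R.
Proof.
rewrite ler_nat; case: (boolP (jump_time w m.+1 <= T%:E)%E) => // h.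
by rewrite (le_trans (le_jump_time w (leqnSn m)) h).
Qed.

Lemma stay_ge0 T m w : 0 <= stay ok gam V T m w.
Proof.
rewrite /stay mulr_ge0 ?subr_ge0 ?jump_le_decr//.
by rewrite mulr_ge0// mulr_ge0// ltW// weight_gt0.
Qed.

Lemma entry_ge0 T m w : 0 <= entry ok gam V T m w.
Proof. by rewrite /entry !mulr_ge0// ltW// weight_gt0. Qed.

End nonneg.

Section hitting.
Context (R : realType) (S : pfinType) (A : ptopologicalType) (M : ctmdp R S A).
Variables (i0 : S) (pi : policy M) (P : probability (Omega R S) R).
Hypothesis law : process_law i0 pi P.
Variable q : S -> S -> R -> R.
Hypothesis qE : forall i j t, 0 <= t -> pol_rate pi (Some i) t j = (q i j t)%:E.
Hypothesis bq : forall i j, bmfun (q i j).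
Variable z : S.

Definition avoid (x : option S) : bool := x != Some z.

(* [hit gam T m] is exp of the integral of [gam] up to the hitting time of [z],
   on the event that it is the (m+1)-st jump time and at most [T]. *)
Definition hit (gam : option S -> R -> R) T m w : R :=
  (alive avoid m w)%:R * (st w m.+1 == Some z)%:R *
  weight gam T m.+1 w * (jump_time w m.+1 <= T%:E)%E%:R.

Lemma exit_hit gam V T m w : V m.+1 (Some z) = 1 ->
  exit avoid gam V T m w = hit gam T m w.
Proof.
move=> Vz; rewrite /exit /hit /avoid negbK.
by case: eqVneq => [->|_]; rewrite ?Vz ?mulr1// !(mulr0, mul0r).
Qed.

Lemma hit_ge0 gam T m w : 0 <= hit gam T m w.
Proof. by rewrite /hit !mulr_ge0 ?expR_ge0// ltW// weight_gt0. Qed.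

Lemma bmfun_hit gam T m : 0 <= T -> (forall x, bmfun (gam x)) -> bmfun (hit gam T m).
Proof.
move=> T0 bg; apply: (@eq_bmfun _ _ _ (exit avoid gam (fun _ _ => 1) T m)).
  by move=> w; rewrite exit_hit.
exact: bmfun_exit.
Qed.

Lemma le_hit gam T T' m w : 0 <= T -> T <= T' -> hit gam T m w <= hit gam T' m w.
Proof.
move=> T0 TT'; case: (boolP (jump_time w m.+1 <= T%:E)%E) => h; last first.
  by rewrite {1}/hit (negPf h) mulr0 hit_ge0.
rewrite /hit (weight_eq gam T0 TT' h) h.
by rewrite (le_trans h)// lee_fin.
Qed.

(** In Dynkin's formula the exits are the hits, as [V] is 1 at [z] after a jump, and the remaining
    terms are nonnegative. *)
Lemma hitting_upper gam V T n : (forall x, bmfun (gam x)) ->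
  (forall m x, 0 <= V m x) -> (forall m, V m None = 0) ->
  (forall m, V m.+1 (Some z) = 1) ->
  (forall m i t, 0 <= t -> (m == 0)%N || (i != z) -> gen q gam V m i t <= 0) ->
  0 <= T -> \sum_(m < n) Ex P (hit gam T m) <= V 0%N (Some i0).
Proof.
move=> bg V0 VN Vz genV T0.
apply: le_trans (dynkin_le law qE bq (ok := avoid) n bg VN genV T0).
rewrite -[leLHS]addr0 lerD//; last by apply: Ex_ge0 => w; exact: entry_ge0.
apply: ler_sum => m _; rewrite (eq_Ex P (fun w => exit_hit gam T w (Vz m))) lerDr.
by apply: Ex_ge0 => w; exact: stay_ge0.
Qed.

Section lower.
Variables (gam : option S -> R -> R) (C kappa : R).
Hypothesis bgam : forall x, bmfun (gam x).
Hypothesis gamC : forall x t, `|gam x t| <= C.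
Hypothesis kappaC : C < kappa.
Let gamk x t := gam x t - kappa.

Let bgamk x : bmfun (gamk x).
Proof. by apply: bmfunB => //; exact: bmfun_cst. Qed.

Lemma weight_shift T m w : 0 <= T ->
  weight gamk T m w = expR (- kappa * theta T m w) * weight gam T m w.
Proof.
move=> T0; elim: m => [|m IH]; first by rewrite /= theta0// mulr0 expR0 mulr1.
have pE x t : 0 <= t -> prim (gamk x) t = prim (gam x) t + - kappa * t.
  by move=> t0; rewrite primD ?prim_cst//; exact: bmfun_cst.
rewrite [LHS]/= [in RHS]/= IH !pE ?theta_ge0//.
rewrite opprD !expRD.
have := expRxMexpNx_1 (- kappa * theta T m w).
move: (expR (- kappa * theta T m w)) (expR (- (- kappa * theta T m w))) => a a' aa'.
move: (expR _) (expR _) (expR _) => b c d.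
by rewrite -[RHS]mul1r -aa'; move: (weight _ _ _ _) => W; ring.
Qed.

(** In the sojourn that contains [T] the truncated end is [T] itself, so the discount is
    deterministic and factors out. *)
Lemma stay_shift ok V T m w : 0 <= T ->
  stay ok gamk V T m w = expR (- kappa * T) * stay ok gam V T m w.
Proof.
move=> T0; rewrite /stay weight_shift//.
case: (boolP (jump_time w m.+1 <= T%:E)%E) => h.
  by rewrite (le_trans (le_jump_time w (leqnSn m)) h) subrr !mulr0.
have -> : theta T m.+1 w = T by rewrite theta_T// ltW// ltNge.
by move: (expR (- kappa * T)) (weight gam T m.+1 w) => a W; ring.
Qed.

(** Hits by time [T] cancel in both differences; a hit after [T] is discounted at least by the
    factor at [T], since [kappa > C >= 0]. *)
Lemma hit_shift_le T T' m w : 0 <= T -> T <= T' ->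
  hit gamk T' m w - hit gamk T m w <=
  expR (- kappa * T) * (hit gam T' m w - hit gam T m w).
Proof.
move=> T0 TT'; have T'0 := le_trans T0 TT'.
case: (boolP (jump_time w m.+1 <= T%:E)%E) => h.
  have h' : (jump_time w m.+1 <= T'%:E)%E by rewrite (le_trans h)// lee_fin.
  rewrite /hit !(weight_eq _ T0 TT' h) h h' !subrr mulr0//.
have -> : hit gamk T m w = 0 by rewrite /hit (negPf h) mulr0.
have -> : hit gam T m w = 0 by rewrite /hit (negPf h) mulr0.
rewrite !subr0.
have -> : hit gamk T' m w = expR (- kappa * theta T' m.+1 w) * hit gam T' m w.
  by rewrite /hit weight_shift//; move: (expR _) (weight _ _ _ _) => a W; ring.
rewrite ler_wpM2r ?hit_ge0// ler_expR !mulNr lerN2 ler_wpM2l//.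
  by rewrite (le_trans _ (ltW kappaC))// (le_trans _ (gamC None 0)).
rewrite -lee_fin theta_fin// le_min lee_fin TT' andbT ltW// ltNge//.
Qed.

Lemma Ex_hit_shift_le T T' m : 0 <= T -> T <= T' ->
  Ex P (hit gamk T' m) - Ex P (hit gamk T m) <=
  expR (- kappa * T) * (Ex P (hit gam T' m) - Ex P (hit gam T m)).
Proof.
move=> T0 TT'; have T'0 := le_trans T0 TT'.
apply: le_ExB; try exact: bmfun_hit.
by move=> w; exact: hit_shift_le.
Qed.

Lemma stay_le_scale ok V W k T m : 0 <= T -> (forall m x, V m x <= k * W m x) ->
  Ex P (stay ok gam V T m) <= k * Ex P (stay ok gam W T m).
Proof.
move=> T0 VW; apply: le_ExZ; [exact: bmfun_stay|exact: bmfun_stay|move=> w].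
rewrite /stay [leRHS]mulrA ler_wpM2r ?subr_ge0 ?jump_le_decr//.
rewrite [leRHS]mulrCA ler_wpM2l//.
by rewrite mulr_ge0// ltW// (@weight_gt0 _ _ gam T m.+1).
Qed.

(** At most one sojourn contains [T]: the differences of indicators telescope to at most 1. *)
Lemma sum_stay_le V D T n : 0 <= T -> (forall m x, 0 <= V m x <= D) ->
  \sum_(m < n) Ex P (stay avoid gam V T m) <= expR (C * T) * D.
Proof.
move=> T0 VD; have D0 : 0 <= D by have /andP[/le_trans h /h] := VD 0%N None.
rewrite -Ex_sum; last by move=> m; exact: bmfun_stay.
rewrite -[leRHS](Ex_cst P); apply: le_Ex.
- by apply: bmfun_sum => m; exact: bmfun_stay.
- exact: bmfun_cst.
move=> w; apply: (@le_trans _ _ (expR (C * T) * D *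
    \sum_(m < n) ((jump_time w m <= T%:E)%E%:R - (jump_time w m.+1 <= T%:E)%E%:R))).
  rewrite mulr_sumr; apply: ler_sum => m _; rewrite /stay ler_wpM2r//.
    by rewrite subr_ge0 jump_le_decr.
  have /andP[v0 vD] := VD m (st w m).
  rewrite ler_pM//.
    by rewrite mulr_ge0// ltW// (@weight_gt0 _ _ gam T m.+1).
  apply: le_trans (weight_le m.+1 w T0 bgam gamC).
  rewrite -[leRHS]mul1r ler_wpM2r ?(ltW (@weight_gt0 _ _ gam T m.+1 w))//.
  by case: (alive _ _ _).
rewrite -[leRHS]mulr1 ler_wpM2l ?mulr_ge0 ?expR_ge0//.
rewrite -(big_mkord xpredT (fun m => (jump_time w m <= T%:E)%E%:R - (jump_time w m.+1 <= T%:E)%E%:R)).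
rewrite (@telescope_sumr_eq _ 0 n (fun m => - (jump_time w m <= T%:E)%E%:R))//; last first.
  by move=> k _; rewrite opprK addrC.
rewrite jump_time0 lee_fin T0 opprK.
by rewrite addrC lerBlDr lerDl.
Qed.

Local Opaque stay exit entry hit weight.

(* A subsolution [V] alone does not exclude that mass stays away from [z]
   forever.  Under the discounted [gam - kappa], [Vk] bounds the mass still alive
   at [T] by the mass hitting [z] after [T], and the latter is a tail of a
   bounded sum. *)
Lemma hitting_lower V Vk c D Dk x :
  (forall m i t, 0 <= t -> (m == 0)%N || (i != z) -> 0 <= gen q gam V m i t) ->
  (forall m x, 0 <= V m x <= D) -> (forall m, V m None = 0) ->
  (forall m, V m.+1 (Some z) = 1) ->
  (forall m i t, 0 <= t -> (m == 0)%N || (i != z) -> 0 <= gen q gamk Vk m i t) ->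
  0 < c -> (forall m i, c <= Vk m (Some i) <= Dk) -> (forall m, Vk m None = 0) ->
  (forall m, Vk m.+1 (Some z) = 1) ->
  (forall T n, 0 <= T -> \sum_(m < n) Ex P (hit gam T m) <= x) ->
  V 0%N (Some i0) <= x.
Proof.
move=> genV VD VN Vz genk c0 kD kN kz hx.
have Vk0 m y : 0 <= Vk m y <= Dk.
  case: y => [i|]; last first.
    rewrite kN lexx/=; have /andP[h1 h2] := kD 0%N i0.
    by rewrite (le_trans (ltW c0))// (le_trans h1).
  by have /andP[h1 h2] := kD m i; rewrite (le_trans (ltW c0)).
have Vk0' m y : 0 <= Vk m y by have /andP[] := Vk0 m y.
have V0' m y : 0 <= V m y by have /andP[] := VD m y.
have Dk0 : 0 <= Dk by have /andP[/le_trans h /h] := Vk0 0%N None.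
have D0 : 0 <= D by have /andP[/le_trans h /h] := VD 0%N None.
have C0 : 0 <= C by apply: le_trans (gamC None 0).
have abs0D (y E : R) : 0 <= y <= E -> `|y| <= E by move=> /andP[? ?]; rewrite ger0_norm.
pose b T m := Ex P (stay avoid gam Vk T m).
pose e T m := Ex P (hit gam T m).
have b0 T m : 0 <= b T m by apply: Ex_ge0 => w; exact: stay_ge0.
have e0 T m : 0 <= e T m by apply: Ex_ge0 => w; exact: hit_ge0.
(* The mass alive at [T] is paid for by hits after [T]: the discounted Dynkin sums grow with the
   horizon, and at a distant [T'] the discounted mass still alive is negligible because [kappa]
   exceeds [C]. Any bound [y] on the hitting sums thus bounds mass and hits together. *)
have key y : (forall T n, 0 <= T -> \sum_(m < n) e T m <= y) ->
    forall T n, 0 <= T -> \sum_(m < n) b T m + \sum_(m < n) e T m <= y.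
  move=> hy T n0 T0; apply/ler_addgt0Pr => eps eps0.
  have kC : 0 < kappa - C by rewrite subr_gt0.
  have eps2 : 0 < eps / 2 by rewrite divr_gt0.
  (* The factor [expR (kappa * T)] anticipates the final division by the discount at [T]. *)
  have [t1 t10 Ht1] := expRN_small kC (mulr_ge0 (expR_ge0 (kappa * T)) Dk0) eps2.
  pose T' := Num.max T t1.
  have TT' : T <= T' by rewrite le_max lexx.
  have T'0 := le_trans T0 TT'.
  have [K K0 HK] := entry_tail law qE bq avoid (V := Vk) T'0 bgamk
    (fun y t => le_trans (ler_normB (gam y t) kappa) (lerD (gamC y t) (lexx `|kappa|)))
    (fun m y => abs0D _ _ (Vk0 m y)).
  have [n1 Hn1] := half_pow_small (mulr_ge0 (expR_ge0 (kappa * T)) K0) eps2.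
  pose n := maxn n0 n1.
  have n0n : (n0 <= n)%N by rewrite leq_maxl.
  apply: le_trans (lerD (ler_sum_ord n0n (b0 T)) (ler_sum_ord n0n (e0 T))) _.
  have dm := dynkin_mono law qE bq (ok := avoid) bgamk kN genk n T0 TT'.
  have stE U m : 0 <= U -> Ex P (stay avoid gamk Vk U m) = expR (- kappa * U) * b U m.
    move=> U0; rewrite /b -ExZ; last exact: bmfun_stay.
    by apply: eq_Ex => w; exact: stay_shift.
  have exE U m : Ex P (exit avoid gamk Vk U m) = Ex P (hit gamk U m).
    by apply: eq_Ex => w; exact: exit_hit.
  have SE U : 0 <= U ->
      \sum_(m < n) (Ex P (stay avoid gamk Vk U m) + Ex P (exit avoid gamk Vk U m)) =
      expR (- kappa * U) * (\sum_(m < n) b U m) + \sum_(m < n) Ex P (hit gamk U m).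
    move=> U0; rewrite big_split mulr_sumr; congr (_ + _); apply: eq_bigr => m _.
      exact: stE.
    exact: exE.
  have eqle (s t : R) : s = t -> s <= t by move=> ->.
  have {dm}G : expR (- kappa * T) * (\sum_(m < n) b T m) + \sum_(m < n) Ex P (hit gamk T m) +
      Ex P (entry avoid gamk Vk T n) <=
      expR (- kappa * T') * (\sum_(m < n) b T' m) + \sum_(m < n) Ex P (hit gamk T' m) +
      Ex P (entry avoid gamk Vk T' n).
    apply: le_trans (le_trans _ dm) _; apply: lerD; try exact: lexx.
      by apply: eqle; apply: esym; exact: SE.
    by apply: eqle; exact: SE.
  have en0 : 0 <= Ex P (entry avoid gamk Vk T n) by apply: Ex_ge0 => w; exact: entry_ge0.
  have en1 : Ex P (entry avoid gamk Vk T' n) <= K / 2 ^+ n.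
    by rewrite (le_trans (ler_norm _)).
  have hd : \sum_(m < n) Ex P (hit gamk T' m) - \sum_(m < n) Ex P (hit gamk T m) <=
      expR (- kappa * T) * (\sum_(m < n) e T' m - \sum_(m < n) e T m).
    exact: (@sumB_le _ n (fun m => Ex P (hit gamk T m)) (fun m => Ex P (hit gamk T' m))
      (e T) (e T') _ (fun m => Ex_hit_shift_le m T0 TT')).
  have sb : \sum_(m < n) b T' m <= expR (C * T') * Dk by exact: sum_stay_le.
  have ub := hy T' n T'0.
  have tT' : t1 <= T' by rewrite le_max lexx orbT.
  have h1 := Ht1 T' tT'.
  have h2 := Hn1 n (leq_maxr _ _).
  have aA : expR (- kappa * T) * expR (kappa * T) = 1.
    by rewrite mulNr mulrC expRxMexpNx_1.
  have aC : expR (- (kappa - C) * T') = expR (- kappa * T') * expR (C * T').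
    by rewrite -expRD; congr expR; ring.
  rewrite aC in h1.
  have a0 : 0 < expR (- kappa * T) by exact: expR_gt0.
  have a'0 : 0 <= expR (- kappa * T') by exact: expR_ge0.
  exact: (lower_algebra aA a0 a'0 h1 h2 sb ub hd en1 en0 G).
(* [key] is applied with the least bound, the supremum of the hitting sums; at a horizon where this
   is almost attained, the mass alive is almost 0. *)
pose Y : set R := [set y | exists T n, 0 <= T /\ y = \sum_(m < n) e T m].
have supY : has_sup Y.
  split; first by exists (\sum_(m < 0) e 0 m), 0, 0%N.
  by exists x => _ [T [n [T0 ->]]]; exact: hx.
have ubY T n : 0 <= T -> \sum_(m < n) e T m <= sup Y.
  by move=> T0; apply: ub_le_sup; [case: supY|exists T, n].
have Yx : sup Y <= x.
  by apply: ge_sup; [case: supY|move=> _ [T [n [T0 ->]]]; exact: hx].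
apply: le_trans Yx; apply/ler_addgt0Pr => eps eps0.
have Dc0 : 0 <= D / c by rewrite divr_ge0// ltW.
have d0 : 0 < D / c + 1 by rewrite ltr_wpDl.
(* The mass in [V] is at most [D / c] times the mass in [Vk]; the tolerance is divided accordingly,
   with [+ 1] against a zero factor. *)
have [_ [T [n [T0 ->]]] Ysup] := sup_adherent (divr_gt0 eps0 (mulr_gt0 (ltr0n R 2) d0)) supY.
have [K K0 HK] := entry_tail law qE bq avoid (V := V) T0 bgam gamC
    (fun m y => abs0D _ _ (VD m y)).
have [n1 Hn1] := half_pow_small K0 (divr_gt0 eps0 (ltr0n R 2)).
pose n' := maxn n n1.
have dge := dynkin_ge law qE bq (ok := avoid) bgam VN genV n' T0; rewrite big_split/= in dge.
have sub : \sum_(m < n) e T m <= \sum_(m < n') e T m.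
  by apply: ler_sum_ord => //; exact: leq_maxl.
have exE m : Ex P (exit avoid gam V T m) = e T m.
  by apply: eq_Ex => w; exact: exit_hit.
rewrite [X in _ + X + _](eq_bigr (fun m : 'I_n' => e T m)) in dge; last by move=> m _; exact: exE.
have stb : \sum_(m < n') Ex P (stay avoid gam V T m) <= D / c * \sum_(m < n') b T m.
  rewrite mulr_sumr; apply: ler_sum => m _; apply: stay_le_scale => // {}m [i|].
    have /andP[_ vD] := VD m (Some i); have /andP[cv _] := kD m i.
    by rewrite (le_trans vD)// mulrAC ler_pdivlMr// ler_wpM2l.
  by rewrite VN kN mulr0.
have k1 := key (sup Y) ubY T n' T0.
have en1 : Ex P (entry avoid gam V T n') <= K / 2 ^+ n' by rewrite (le_trans (ler_norm _)).
have h2 := Hn1 n' (leq_maxr _ _).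
have u1 := ubY T n' T0.
exact: (lower_algebra' Dc0 dge stb k1 en1 h2 u1 Ysup sub eps0).
Qed.

End lower.
End hitting.

(** * Path integrals *)

Section integral_eventually.
Context d (T : measurableType d) (R : realType) (P : probability T R).
Local Open Scope ereal_scope.

(* The exponentials of path integrals below are not shown to be measurable, so
   the next lemmas compare lower integrals. *)
Lemma le_integral_ge0 (f g : T -> \bar R) : (forall x, 0 <= f x) ->
  (forall x, f x <= g x) -> \int[P]_x f x <= \int[P]_x g x.
Proof.
move=> f0 fg; have g0 x : 0 <= g x by rewrite (le_trans (f0 x)).
rewrite !ge0_integralTE//; apply: le_ereal_sup => _ [h /= hf <-].
by exists h => // x; rewrite (le_trans (hf x)).
Qed.

Lemma integral_ae_ge0 (F H : T -> \bar R) (N : set T) :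
  measurable N -> P N = 0 -> measurable_fun setT H -> (forall w, 0 <= H w) ->
  (forall w, 0 <= F w) -> (forall w, ~ N w -> F w = H w) ->
  \int[P]_w F w = \int[P]_w H w.
Proof.
move=> mN PN mH H0 F0 FH.
apply/eqP; rewrite eq_le; apply/andP; split.
(* [H'] is measurable, infinite on [N] and equal to [H] elsewhere; it dominates [F] everywhere,
   whether or not [F] is measurable. *)
- pose H' w := H w + +oo * (\1_N w)%:E.
  have H'E w : ~ N w -> H' w = H w.
    by move=> wN; rewrite /H' indicE memNset//= mule0 adde0.
  have FH' w : F w <= H' w.
    case: (boolP (w \in N)) => [wN|/negP wN].
      by rewrite /H' indicE wN mule1 addey ?leey// gt_eqF// (lt_le_trans _ (H0 w)).
    by rewrite H'E ?FH// => Nw; apply: wN; exact: mem_set.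
  apply: (@le_trans _ _ (\int[P]_w H' w)); first exact: le_integral_ge0.
  have mH' : measurable_fun setT H'.
    apply: emeasurable_funD => //; apply: emeasurable_funM => //.
    by apply/measurable_EFinP; exact: measurable_indic.
  rewrite (@ge0_ae_eq_integral _ _ _ P setT H' H)//.
  - by move=> w _; rewrite (le_trans (F0 w)).
  - exists N; split => // w /= wH; apply: contrapT => wN; apply: wH => _; exact: H'E.
- rewrite (@ge0_negligible_integral _ _ _ P setT N)// integral_mkcond.
  apply: le_integral_ge0 => w; rewrite patchE.
    by case: ifP.
  by case: ifPn => [|_//]; rewrite inE => -[_ wN]; rewrite FH.
Qed.

(** [F] is a functional of the whole path, while each [G k] uses finitely many jumps and a finite
    horizon. Almost surely the sequence is eventually constant, so monotone convergence identifies
    the integral of [F]. *)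
Lemma integral_eventually (F : T -> \bar R) (G : nat -> T -> R) (N : set T) :
  measurable N -> P N = 0 -> (forall k, bmfun (G k)) ->
  (forall k w, (0 <= G k w)%R) -> (forall k w, (G k w <= G k.+1 w)%R) ->
  (forall w, 0 <= F w) ->
  (forall w, ~ N w -> exists k0, forall k, (k0 <= k)%N -> F w = (G k w)%:E) ->
  \int[P]_w F w = ereal_sup (range (fun k => (Ex P (G k))%:E)).
Proof.
move=> mN PN bG G0 Gnd F0 FG.
have ndG w : nondecreasing_seq (fun k => (G k w)%:E).
  by apply/nondecreasing_seqP => k; rewrite lee_fin.
have mG k : measurable_fun setT (fun w => (G k w)%:E).
  by apply/measurable_EFinP; case: (bG k).
pose H w := limn (fun k => (G k w)%:E).
have cH w : (G k w)%:E @[k --> \oo] --> H w by exact: ereal_nondecreasing_is_cvgn.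
have mH : measurable_fun setT H.
  by apply: (emeasurable_fun_cvg _ _ mG) => w _; exact: cH.
have H0 w : 0 <= H w.
  apply: lime_ge; first exact: ereal_nondecreasing_is_cvgn.
  by apply: nearW => k; rewrite lee_fin.
rewrite (integral_ae_ge0 mN PN mH H0 F0); last first.
  move=> w /FG[k0 Hk]; apply/esym/cvg_lim => //.
  apply: cvg_near_cst; exists k0 => // k /= k0k.
  by rewrite (Hk k).
rewrite monotone_convergence//; last by move=> k w _; rewrite lee_fin.
apply/cvg_lim => //.
under eq_fun do rewrite -ExE//.
apply: ereal_nondecreasing_cvgn; apply/nondecreasing_seqP => k.
by rewrite lee_fin; exact: le_Ex.
Qed.

End integral_eventually.

Section pathwise.
Context (R : realType) (S : pfinType).
Variable gam : option S -> R -> R.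
Hypothesis bgam : forall x, bmfun (gam x).
Implicit Types (w : Omega R S) (m l n : nat) (T t : R).

Definition action T m w : R := \sum_(l < m)
  (prim (gam (st w l)) (theta T l.+1 w) - prim (gam (st w l)) (theta T l w)).

Lemma Rintegral_itvco (f : R -> R) a b c : bmfun f -> 0 <= a -> a <= b -> b <= c ->
  \int[lebesgue_measure]_(t in `[0, c[) (f t * (a <= t < b)%R%:R) = prim f b - prim f a.
Proof.
move=> bf a0 ab bc; rewrite primB//.
rewrite (Rintegral_itv_obnd_cbnd (bmfun_itv_integrable _ _ _ _ bf)).
rewrite -(Rintegral_itv_bndo_bndc (bmfun_itv_integrable _ _ _ _ bf)).
rewrite [in RHS](_ : [set` `[a, b[] = [set` `[0, c[] `&` [set` `[a, b[]); last first.
  apply/seteqP; split => t /=; last by case.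
  rewrite !in_itv/= => /andP[at1 tb]; rewrite at1 tb (le_trans a0 at1) (lt_le_trans tb bc)//.
rewrite Rintegral_mkcondr; apply: eq_Rintegral => t _.
by rewrite patchE mem_setE in_itv/=; case: ifP => _; rewrite ?mulr1// mulr0.
Qed.

Lemma Rintegral_itv_sum n (f : nat -> R -> R) a b : (forall l, bmfun (f l)) ->
  \int[lebesgue_measure]_(t in `[a, b[) (\sum_(l < n) f l t) =
  \sum_(l < n) \int[lebesgue_measure]_(t in `[a, b[) f l t.
Proof.
move=> bf; elim: n => [|n IH].
  rewrite big_ord0 -[RHS](mul0r (fine (lebesgue_measure (`[a, b[%classic : set R)))).
  by rewrite -Rintegral_cst//; apply: eq_Rintegral => t _; rewrite big_ord0.
rewrite big_ord_recr/= -IH -RintegralD//; last 2 first.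
- by apply: bmfun_itv_integrable; exact: bmfun_sum.
- exact: bmfun_itv_integrable.
by apply: eq_Rintegral => t _; rewrite big_ord_recr.
Qed.

Lemma bmfun_itvco (f : R -> R) a b : bmfun f -> bmfun (fun t => f t * (a <= t < b)%R%:R).
Proof.
move=> bf; apply: bmfunM => //.
apply: (@eq_bmfun _ _ _ (\1_(`[a, b[%classic : set R))); last exact: bmfun_indic.
by move=> t; rewrite indicE mem_setE in_itv.
Qed.

Variable F : option S -> R -> \bar R.
Hypothesis FE : forall i t, 0 <= t -> F (Some i) t = (gam (Some i) t)%:E.

Definition path_integrand T m w t : R :=
  \sum_(l < m) gam (st w l) t * (theta T l w <= t < theta T l.+1 w)%R%:R.

Lemma bmfun_path_integrand T m w : bmfun (path_integrand T m w).
Proof. by apply: bmfun_sum => l; exact: bmfun_itvco. Qed.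

Lemma path_integrandE T m w t : 0 <= T -> 0 <= t -> t < theta T m.+1 w ->
  F (xi w t) t = (path_integrand T m.+1 w t)%:E.
Proof.
move=> T0 t0 tm.
have tT : t < T by rewrite (lt_le_trans tm)// theta_le.
have ltE l : (t < theta T l w) = (t%:E < jump_time w l)%E.
  by rewrite -lte_fin theta_fin// lt_min lte_fin tT andbT.
have leE l : (theta T l w <= t) = (jump_time w l <= t%:E)%E by rewrite leNgt ltE -leNgt.
have ex : exists l, (t%:E < jump_time w l.+1)%E by exists m; rewrite -ltE.
have [l tl lmin] := ex_minnP ex.
have lt : (jump_time w l <= t%:E)%E.
  case: l {tl} lmin => [|l] lmin; first by rewrite jump_time0 lee_fin.
  by rewrite leNgt; apply/negP => /lmin; rewrite ltnn.
have lm : (l < m.+1)%N by rewrite ltnS lmin// -ltE.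
rewrite (xiE lt tl); case sl: (st w l) => [i|]; last first.
  by have := jump_time_None sl => e; rewrite e in lt.
rewrite FE//; congr (_%:E).
rewrite /path_integrand (bigD1 (Ordinal lm))//= leE ltE lt tl sl mulr1 big1 ?addr0//.
move=> [k km] /=; rewrite -val_eqE/= => kl; rewrite leE ltE.
case: (ltngtP k l) => [h|h|e]; last by rewrite e eqxx in kl.
- by rewrite [(t%:E < _)%E]ltNge (le_trans (le_jump_time w h) lt) andbF mulr0.
- by rewrite leNgt (lt_le_trans tl (le_jump_time w h)) mulr0.
Qed.

Lemma Rintegral_path_integrand T m w : 0 <= T ->
  \int[lebesgue_measure]_(t in `[0, theta T m w[) path_integrand T m w t = action T m w.
Proof.
move=> T0; rewrite /path_integrand.
rewrite (@Rintegral_itv_sum m (fun l t => gam (st w l) t * (theta T l w <= t < theta T l.+1 w)%R%:R)).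
  apply: eq_bigr => l _; rewrite Rintegral_itvco ?theta_ge0 ?le_theta//.
by move=> l; exact: bmfun_itvco.
Qed.

Lemma EFin_Rintegral_itv (f : R -> R) (b b' : bool) x y : bmfun f ->
  (\int[lebesgue_measure]_(t in [set` Interval (BSide b x) (BSide b' y)]) (f t)%:E =
   (\int[lebesgue_measure]_(t in [set` Interval (BSide b x) (BSide b' y)]) f t)%R%:E)%E.
Proof.
move=> bf; rewrite /Rintegral fineK//; apply: integrable_fin_num => //.
exact: bmfun_itv_integrable.
Qed.

Lemma integral_path_itvco T m w : 0 <= T ->
  (\int[lebesgue_measure]_(t in `[0%R, theta T m.+1 w[) F (xi w t) t = (action T m.+1 w)%:E)%E.
Proof.
move=> T0; rewrite -Rintegral_path_integrand// -EFin_Rintegral_itv; last exact: bmfun_path_integrand.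
apply: eq_integral => t; rewrite mem_setE in_itv/= => /andP[t0 tm].
exact: path_integrandE.
Qed.

Lemma integral_path_itvcc T m w : 0 <= T -> (jump_time w m <= T%:E)%E ->
  (T%:E < jump_time w m.+1)%E ->
  (\int[lebesgue_measure]_(t in `[0%R, T]) F (xi w t) t = (action T m.+1 w)%:E)%E.
Proof.
move=> T0 mT Tm.
have thT : theta T m.+1 w = T by rewrite theta_T// ltW.
(* At [t = T] all truncated sojourns are over, so [path_integrand] vanishes there while [xi] is
   still in the [m]-th state. On [[0, T]] the function [f] corrects this one point. *)
pose f t : R := if t < T then path_integrand T m.+1 w t else gam (st w m) T.
have bf : bmfun f.
  apply: (@eq_bmfun _ _ _ (fun t => path_integrand T m.+1 w t * \1_(`]-oo, T[%classic : set R) t +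
      gam (st w m) T * \1_(`[T, +oo[%classic : set R) t)).
    move=> t; rewrite /f !indicE !mem_setE !in_itv/= andbT.
    by case: ltP => _; rewrite ?(mulr1, mulr0) ?addr0 ?add0r.
  apply: bmfunD; apply: bmfunM.
  - exact: bmfun_path_integrand.
  - exact: bmfun_indic.
  - exact: bmfun_cst.
  - exact: bmfun_indic.
transitivity (\int[lebesgue_measure]_(t in `[0%R, T]) (f t)%:E)%E.
  apply: eq_integral => t; rewrite mem_setE in_itv/= => /andP[t0 tT].
  rewrite /f; case: ltP => [h|h]; first by apply: path_integrandE => //; rewrite thT.
  have -> : t = T by apply/le_anti; rewrite tT.
  rewrite (xiE mT Tm); case sm: (st w m) => [i|]; first by rewrite FE.
  by have := jump_time_None sm => e; rewrite e in mT.
rewrite EFin_Rintegral_itv// -(Rintegral_itv_bndo_bndc (bmfun_itv_integrable _ _ _ _ bf)).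
congr (_%:E); rewrite -Rintegral_path_integrand// thT; apply: eq_Rintegral => t.
by rewrite mem_setE in_itv/= /f => /andP[_ ->].
Qed.

Lemma weight_action T m w : weight gam T m w = expR (action T m w).
Proof.
elim: m => [|m IH]; first by rewrite /action big_ord0 expR0.
by rewrite /= IH /action big_ord_recr/= -!expRD.
Qed.

End pathwise.

Section hitting_time.
Context (R : realType) (S : pfinType) (z : S).
Implicit Types (w : Omega R S) (m l : nat).

(** The initial state is never tested by [alive], hence [0 < l]; [tau] likewise counts visits only
    from the first jump on. *)
Lemma alive_avoid m w l : alive (avoid z) m w -> (0 < l)%N -> (l <= m)%N ->
  st w l <> Some z.
Proof.
elim: m => [|m IH] /=; first by case: l.
move=> /andP[al am] l0; rewrite leq_eqVlt => /predU1P[->|]; last exact: IH.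
by move=> e; move: am; rewrite /avoid e eqxx.
Qed.

Lemma tau_hit m w : alive (avoid z) m w -> st w m.+1 = Some z ->
  tau z w = jump_time w m.+1.
Proof.
move=> al sm; have sm' : st w m.+1 <> None by rewrite sm.
have fm := jump_time_fin_num sm'.
apply/eqP; rewrite eq_le; apply/andP; split.
- apply: ereal_inf_lbound; exists (fine (jump_time w m.+1)); rewrite ?fineK//=.
  split; first by rewrite fineK// le_jump_time.
  rewrite (@xiE _ _ w _ m.+1) ?fineK// lt_jump_time//.
  exact: jump_time_fin.
- apply: le_ereal_inf_tmp => _ [t [t1 xt] <-]; rewrite leNgt; apply/negP => tm.
  have [l [lt tl sl]] : exists l, [/\ (jump_time w l <= t%:E)%E, (t%:E < jump_time w l.+1)%E & Some z = st w l].
    move: xt; rewrite /xi; set Q := (X in xget _ X).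
    case: (xgetP None Q) => [x _ Qx xz|_ //]; move: Qx; rewrite xz.
    by case => l [? ? ?]; exists l.
  apply: (alive_avoid (l := l) al) => //.
    by case: l {sl} lt tl => // _ h; have := lt_le_trans h t1; rewrite ltxx.
  rewrite leqNgt; apply/negP => ml.
  by have := le_lt_trans (le_trans (le_jump_time w ml) lt) tm; rewrite ltxx.
Qed.

Lemma hit_unique m l w : alive (avoid z) m w -> st w m.+1 = Some z ->
  alive (avoid z) l w -> st w l.+1 = Some z -> l = m.
Proof.
move=> am sm al sl; case: (ltngtP l m) => // h.
- by have := alive_avoid am (ltn0Sn l) h.
- by have := alive_avoid al (ltn0Sn m) h.
Qed.

End hitting_time.

(** * Growth rates *)

Section averages.
Context (R : realType) (A : ptopologicalType).
Variables (k : R.-pker (measurableTypeR R) ~> (borel A)) (D : set (borel A)).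
Hypothesis mD : measurable D.
Hypothesis kD : forall t, 0 <= t -> k t D = 1%E.
Implicit Types (f g : borel A -> R).

Definition bounded_on f := measurable_fun D f /\ exists C, forall a, D a -> `|f a| <= C.

Definition avg f (t : R) : R := (\int[k t]_(a in D) f a)%R.

Lemma bounded_on_integrable f t : 0 <= t -> bounded_on f ->
  (k t).-integrable D (EFin \o f).
Proof.
move=> t0 [mf [C fC]]; apply: measurable_bounded_integrable => //.
- by rewrite kD// ltry.
- exists C; split; first by rewrite num_real.
  by move=> x Cx y Dy /=; rewrite (le_trans (fC _ Dy))// ltW.
Qed.

Lemma avgE f t : 0 <= t -> bounded_on f ->
  (\int[k t]_(a in D) (f a)%:E = (avg f t)%:E)%E.
Proof.
move=> t0 bf; rewrite /avg /Rintegral fineK//; apply: integrable_fin_num => //.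
exact: bounded_on_integrable.
Qed.

Lemma bounded_onD f g : bounded_on f -> bounded_on g -> bounded_on (fun a => f a + g a).
Proof.
move=> [mf [C fC]] [mg [E gE]]; split; first exact: measurable_funD.
by exists (C + E) => a Da; rewrite (le_trans (ler_normD _ _))// lerD ?fC ?gE.
Qed.

Lemma bounded_onZ c f : bounded_on f -> bounded_on (fun a => c * f a).
Proof.
move=> [mf [C fC]]; split; first by apply: measurable_funM.
by exists (`|c| * C) => a Da; rewrite normrM ler_wpM2l// fC.
Qed.

Lemma bounded_on_cst c : bounded_on (fun=> c).
Proof. by split => //; exists `|c|. Qed.

Lemma bounded_on_sum (I : Type) (s : seq I) (F : I -> borel A -> R) :
  (forall i, bounded_on (F i)) -> bounded_on (fun a => \sum_(i <- s) F i a).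
Proof.
move=> bF; elim: s => [|i s IH].
  rewrite (_ : (fun _ => _) = fun=> 0); first exact: bounded_on_cst.
  by apply/funext => a; rewrite big_nil.
rewrite (_ : (fun _ => _) = fun a => F i a + \sum_(i <- s) F i a).
  exact: bounded_onD.
by apply/funext => a; rewrite big_cons.
Qed.

Lemma avgD f g t : 0 <= t -> bounded_on f -> bounded_on g ->
  avg (fun a => f a + g a) t = avg f t + avg g t.
Proof. by move=> t0 bf bg; rewrite /avg RintegralD//; exact: bounded_on_integrable. Qed.

Lemma avgZ c f t : 0 <= t -> bounded_on f -> avg (fun a => c * f a) t = c * avg f t.
Proof. by move=> t0 bf; rewrite /avg RintegralZl//; exact: bounded_on_integrable. Qed.

Lemma avg_cst c t : 0 <= t -> avg (fun=> c) t = c.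
Proof. by move=> t0; rewrite /avg Rintegral_cst// kD//= mulr1. Qed.

Lemma avg_sum (I : Type) (s : seq I) (F : I -> borel A -> R) t : 0 <= t ->
  (forall i, bounded_on (F i)) ->
  avg (fun a => \sum_(i <- s) F i a) t = \sum_(i <- s) avg (F i) t.
Proof.
move=> t0 bF; elim: s => [|i s IH].
  rewrite big_nil -[RHS](avg_cst 0 t0); congr avg.
  by apply/funext => a; rewrite big_nil.
rewrite big_cons -IH -avgD//; last exact: bounded_on_sum.
by congr avg; apply/funext => a; rewrite big_cons.
Qed.

Lemma avg_ge0 f t : (forall a, D a -> 0 <= f a) -> 0 <= avg f t.
Proof. by move=> f0; apply: Rintegral_ge0. Qed.

Lemma avg_eq f g t : (forall a, D a -> f a = g a) -> avg f t = avg g t.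
Proof. by move=> fg; apply: eq_Rintegral => a; rewrite inE; exact: fg. Qed.

(** Negative times are cut off because the mass of [k t] on [D] is known only for [t >= 0]. *)
Lemma bmfun_avg f : bounded_on f -> bmfun (fun t => avg f t * (0 <= t)%R%:R).
Proof.
move=> bf; have [mf [C fC]] := bf.
have C0 (a : borel A) : D a -> 0 <= C by move=> Da; apply: le_trans (fC a Da).
(* Kernel integrals of nonnegative functions are measurable; adding [C] makes the integrand
   nonnegative on [D], and as [D] has mass 1 the shift is subtracted exactly. *)
pose h (p : measurableTypeR R * borel A) : \bar R := ((fun a => (f a + C)%:E) \_ D) p.2.
have h0 p : (0 <= h p)%E.
  rewrite /h patchE; case: ifPn => //; rewrite inE => Dp.
  by rewrite lee_fin -lerBlDr sub0r; have := fC _ Dp; rewrite ler_norml => /andP[].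
have mh : measurable_fun setT h.
  apply: (@measurableT_comp _ _ _ _ _ _ ((fun a => (f a + C)%:E) \_ D)) => //.
  apply/(measurable_restrictT _ mD); apply/measurable_EFinP.
  exact: measurable_funD.
have mI := measurable_fun_integral_finite_kernel h k h0 mh.
have E t : 0 <= t -> avg f t = fine (\int[k t]_a h (t, a))%E - C.
  move=> t0; rewrite /h/= -integral_mkcond (avgE t0); last first.
    by apply: bounded_onD => //; exact: bounded_on_cst.
  by rewrite /= avgD// ?avg_cst ?addrK//; exact: bounded_on_cst.
split.
  rewrite (_ : (fun _ => _) = (fun t : R => (fine (\int[k t]_a h (t, a))%E - C) *
     \1_(`[0, +oo[%classic : set R) t)); last first.
    apply/funext => t; rewrite indicE mem_setE in_itv/= andbT.
    by case: (leP 0 t) => t0; rewrite ?mulr0// E.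
  apply: measurable_funM => //; apply: measurable_funB => //.
  by apply: measurableT_comp => //; exact: fine_measurable.
exists `|C| => t; case: (leP 0 t) => t0; last by rewrite mulr0 normr0.
rewrite mulr1 ler_norml; apply/andP; split.
  rewrite -subr_ge0 opprK -[X in _ + X](avg_cst _ t0) -avgD//; last exact: bounded_on_cst.
  apply: avg_ge0 => a Da; have := fC _ Da; rewrite ler_norml => /andP[+ _].
  by have := ler_norm C; lra.
rewrite -subr_ge0 -[X in X - _](avg_cst _ t0) -mulN1r -avgZ// -avgD//; last 2 first.
- exact: bounded_on_cst.
- exact: bounded_onZ.
apply: avg_ge0 => a Da; have := fC _ Da; rewrite ler_norml => /andP[_ +].
by have := ler_norm C; lra.
Qed.

End averages.

Lemma measurable_jump_set (R : realType) (S : pfinType) (T : R) n :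
  measurable [set w : Omega R S | (jump_time w n <= T%:E)%E].
Proof.
rewrite (_ : [set w | _] = setT `&` (fun w => jump_time w n) @^-1` [set` `]-oo, T%:E]]).
  by apply: measurable_jump_time => //; exact: emeasurable_itv.
by rewrite setTI; apply/seteqP; split => w /=; rewrite in_itv.
Qed.

Lemma prob_jump_le (R : realType) (S : pfinType) (P : probability (Omega R S) R) (T : R) n :
  P [set w : Omega R S | (jump_time w n <= T%:E)%E] =
  (Ex P (fun w => (jump_time w n <= T%:E)%E%:R))%:E.
Proof.
rewrite ExE; last exact: bmfun_jump_le.
rewrite (_ : (fun w => ((jump_time w n <= T%:E)%E%:R : R)%:E) =
    (fun w => (\1_[set w | (jump_time w n <= T%:E)%E] w)%:E)).
  by rewrite integral_indic ?setIT//; exact: measurable_jump_set.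
apply/funext => w; rewrite indicE; congr ((nat_of_bool _)%:R%:E).
by apply/idP/idP => [h|/set_mem//]; apply/mem_set.
Qed.

Section growth.
Context (R : realType) (S : pfinType) (A : ptopologicalType) (M : ctmdp R S A).
Variables (i0 : S) (pi : policy M) (P : probability (Omega R S) R).
Hypothesis law : process_law i0 pi P.
Variables (q : S -> S -> R -> R) (c : option S -> R -> R) (lambda : R).
Hypothesis qE : forall i j t, 0 <= t -> pol_rate pi (Some i) t j = (q i j t)%:E.
Hypothesis bq : forall i j, bmfun (q i j).
Hypothesis cE : forall i t, 0 <= t -> pol_cost pi (Some i) t = (c (Some i) t)%:E.
Hypothesis bc : forall x, bmfun (c x).

Definition reward x t : R := lambda * c x t.
Definition one (m : nat) (x : option S) : R := (x != None)%:R.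

Lemma breward x : bmfun (reward x).
Proof. by apply: bmfunM => //; exact: bmfun_cst. Qed.

Lemma action_reward T m w : 0 <= T -> action reward T m w = lambda * action c T m w.
Proof.
move=> T0; rewrite /action mulr_sumr; apply: eq_bigr => l _.
by rewrite /reward !primZ// -mulrBr.
Qed.

Definition growth T := (\int[P]_w expeR (lambda%:E *
  \int[lebesgue_measure]_(t in `[0%R, T]) pol_cost pi (xi w t) t))%E.

(** If all jumps occur by time [T], so does the [n]-th for each [n], and [jump_tail] makes its
    probability tend to 0. *)
Lemma explosion_null T : 0 <= T ->
  P [set w | forall n, (jump_time w n <= T%:E)%E] = 0%E /\
  measurable [set w : Omega R S | forall n, (jump_time w n <= T%:E)%E].
Proof.
move=> T0; have [K K0 HK] := jump_tail law qE bq T0.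
pose B n := [set w : Omega R S | (jump_time w n <= T%:E)%E].
have mB n : measurable (B n) by exact: measurable_jump_set.
have EB n : (P (B n) <= (K / 2 ^+ n)%:E)%E by rewrite prob_jump_le lee_fin.
have mN : measurable [set w : Omega R S | forall n, (jump_time w n <= T%:E)%E].
  rewrite (_ : [set w | _] = \bigcap_n B n); first exact: bigcapT_measurable.
  by apply/seteqP; split => [w h n _|w h n]; [exact: h|exact: (h n I)].
split => //; apply/eqP; rewrite eq_le measure_ge0 andbT.
apply/lee_addgt0Pr => e e0; rewrite add0e.
have [n0 Hn0] := half_pow_small K0 e0.
apply: le_trans (_ : P (B n0) <= _)%E; first by apply: le_measure; rewrite ?inE// => w; exact.
by apply: le_trans (EB n0) _; rewrite lee_fin; exact: Hn0.
Qed.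

(** Without explosion exactly one sojourn contains [T]; its [stay] term, with [one] as function, is
    the exponential of the whole integral, and the other terms vanish. *)
Lemma growthE T : 0 <= T ->
  growth T = ereal_sup (range (fun n =>
    (Ex P (fun w => \sum_(m < n) stay predT reward one T m w))%:E)).
Proof.
move=> T0; have [PN mN] := explosion_null T0.
have one0 m x : 0 <= one m x by [].
apply: (integral_eventually mN PN).
- by move=> n; apply: bmfun_sum => m; exact: (bmfun_stay _ breward).
- by move=> n w; apply: sumr_ge0 => m _; exact: stay_ge0.
- by move=> n w; rewrite big_ord_recr/= lerDl; exact: stay_ge0.
- by move=> w; exact: expeR_ge0.
move=> w /= /existsNP[n0 Hn0].
have ex : exists n, (T%:E < jump_time w n)%E by exists n0; rewrite ltNge; apply/negP.
have [n Tn nmin] := ex_minnP ex.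
case: n Tn nmin => [|m]; first by rewrite jump_time0 lte_fin ltNge T0.
move=> Tm mmin.
have mT : (jump_time w m <= T%:E)%E by rewrite leNgt; apply/negP => /mmin; rewrite ltnn.
have sm : st w m != None by apply: contraTneq mT => /jump_time_None ->.
exists m.+1 => n mn.
rewrite (integral_path_itvcc bc cE T0 mT Tm) -EFinM /= -action_reward//.
congr (_%:E); rewrite -weight_action (bigD1 (Ordinal mn))//= big1 ?addr0; last first.
  move=> [l ln] /=; rewrite -val_eqE/= => lm; rewrite /stay.
  case: (ltngtP l m) => [h|h|e]; last by rewrite e eqxx in lm.
  - by rewrite !(le_trans (le_jump_time w _) mT) ?subrr ?mulr0// ltnW.
  - rewrite !leNgt !(lt_le_trans Tm (le_jump_time w _)) ?subrr ?mulr0// ltnW//.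
have al : forall l, alive predT l w by elim=> //= l ->.
by rewrite /stay al mT leNgt Tm /= /one sm subr0 !mulr1 mul1r.
Qed.

End growth.

Lemma finite_gt0_lb (R : realDomainType) (S : finType) (s0 : S) (u : S -> R) :
  (forall i, 0 < u i) -> exists2 c, 0 < c & forall i, c <= u i.
Proof.
move=> u0; case: (@arg_minP _ _ _ s0 predT u isT) => k _ kmin.
by exists (u k) => // i; exact: kmin.
Qed.

Lemma finite_ub (R : realDomainType) (S : finType) (s0 : S) (u : S -> R) :
  exists c, forall i, u i <= c.
Proof.
case: (@arg_maxP _ _ _ s0 predT u isT) => k _ kmax.
by exists (u k) => i; exact: kmax.
Qed.

Lemma bmfun_uniform d (T : measurableType d) (R : realType) (I : finType)
    (f : I -> T -> R) : (forall i, bmfun (f i)) ->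
  exists C, forall i x, `|f i x| <= C.
Proof.
move=> bf; have /choice[C HC] i : exists C, forall x, `|f i x| <= C.
  by have [_ [C HC]] := bf i; exists C.
exists (\sum_i `|C i|) => i x; apply: (le_trans (HC i x)).
by rewrite (bigD1 i)//= (le_trans (ler_norm _))// lerDl sumr_ge0.
Qed.

Section limsup.
Context (R : realType).
Local Open Scope ereal_scope.

Lemma limf_esup_pinfty_ge (f : R -> \bar R) (g d : R) :
  (forall T, (0 < T)%R -> (g + d / T)%:E <= f T) ->
  g%:E <= limf_esup f (pinfty_nbhs R).
Proof.
move=> H; apply: le_ereal_inf_tmp => _ [V [N [_ NV]] <-].
apply/lee_addgt0Pr => e e0.
pose T := (Num.max N (`|d| / e) + 1)%R.
have T0 : (0 < T)%R.
  by rewrite ltr_wpDl// le_max; apply/orP; right; rewrite divr_ge0// ltW.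
have VT : V T by apply: NV; rewrite /T ltr_pwDr// le_max lexx.
apply: (@le_trans _ _ (f T + e%:E)); last first.
  by rewrite leeD2r//; apply: ereal_sup_ubound; exists T.
apply: (@le_trans _ _ ((g + d / T)%:E + e%:E)); last by rewrite leeD2r// H.
rewrite -EFinD lee_fin -addrA lerDl -(opprK e) subr_ge0 lerNl.
rewrite -mulNr ler_pdivrMr// (le_trans (ler_norm _))// normrN.
rewrite mulrC -ler_pdivrMr// (le_trans _ (_ : Num.max N (`|d| / e) <= T)%R) ?lerDl//.
by rewrite le_max lexx orbT.
Qed.

Lemma limf_esup_pinfty_le (f : R -> \bar R) (g d : R) :
  (forall T, (0 < T)%R -> f T <= (g + d / T)%:E) ->
  limf_esup f (pinfty_nbhs R) <= g%:E.
Proof.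
move=> H; apply/lee_addgt0Pr => e e0.
pose N := (`|d| / e)%R.
have N0 : (0 <= N)%R by rewrite divr_ge0// ltW.
apply: (@le_trans _ _ (ereal_sup (f @` [set T | (N < T)%R]))).
  apply: ereal_inf_lbound; exists [set T | (N < T)%R] => //.
  by exists N; split; rewrite ?num_real.
apply: ge_ereal_sup => _ [T /= NT <-].
have T0 : (0 < T)%R by rewrite (le_lt_trans N0).
apply: (le_trans (H _ T0)); rewrite -EFinD lee_fin lerD2l.
rewrite ler_pdivrMr// (le_trans (ler_norm _))// mulrC -ler_pdivrMr//.
exact: ltW.
Qed.

End limsup.

Section growth_bounds.
Context (R : realType) (S : pfinType) (A : ptopologicalType) (M : ctmdp R S A).
Variables (i0 : S) (pi : policy M) (P : probability (Omega R S) R).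
Hypothesis law : process_law i0 pi P.
Variables (q : S -> S -> R -> R) (c : option S -> R -> R) (lambda : R).
Hypothesis lambda0 : 0 < lambda.
Hypothesis qE : forall i j t, 0 <= t -> pol_rate pi (Some i) t j = (q i j t)%:E.
Hypothesis bq : forall i j, bmfun (q i j).
Hypothesis cE : forall i t, 0 <= t -> pol_cost pi (Some i) t = (c (Some i) t)%:E.
Hypothesis bc : forall x, bmfun (c x).
Hypothesis qs : forall i t, 0 <= t -> \sum_j q i j t = 0.

(** The last term disappears when [V] does not depend on [m]; what remains is the operator of the
    optimality equation. It matters where a value at jump number 0 is altered. *)
Lemma gen_sum0 gam V m i t : 0 <= t -> gen q gam V m i t =
  gam (Some i) t * V m (Some i) + \sum_j q i j t * V m.+1 (Some j) -
  q i i t * (V m.+1 (Some i) - V m (Some i)).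
Proof.
move=> t0; rewrite /gen -addrA; congr (_ + _).
have -> : \sum_j q i j t * V m.+1 (Some j) = \sum_j q i j t * (V m.+1 (Some j) - V m (Some i)).
  under [RHS]eq_bigr do rewrite mulrBr.
  by rewrite sumrB -mulr_suml qs// mul0r subr0.
by rewrite [in RHS](bigD1 i)//= addrAC subrr add0r.
Qed.

Variables (u : S -> R) (g : R).
Hypothesis u0 : forall i, 0 < u i.
Let rho := lambda * g.
Let V (m : nat) (x : option S) : R := if x is Some i then u i else 0.
Let gam x t := reward c lambda x t - rho.

Let bgam x : bmfun (gam x).
Proof. by apply: bmfunB; [exact: breward|exact: bmfun_cst]. Qed.

Let X T n := Ex P (fun w => \sum_(m < n) stay predT (reward c lambda) (@one R S) T m w).

Let X_sum T n : 0 <= T ->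
  X T n = \sum_(m < n) Ex P (stay predT (reward c lambda) (@one R S) T m).
Proof.
by move=> T0; rewrite /X Ex_sum// => m; apply: bmfun_stay => // x; exact: breward.
Qed.

Let stayE T m : 0 <= T -> Ex P (stay predT gam V T m) =
  expR (- rho * T) * Ex P (stay predT (reward c lambda) V T m).
Proof.
move=> T0; rewrite -ExZ; last by apply: bmfun_stay => // x; exact: breward.
by apply: eq_Ex => w; apply: stay_shift => // x; exact: breward.
Qed.

Let exit0 T m : Ex P (exit predT gam V T m) = 0.
Proof.
by rewrite -[RHS](Ex_cst P); apply: eq_Ex => w; rewrite /exit /= mulr0 !mul0r.
Qed.

Lemma growth_ge : (forall i t, 0 <= t ->
    rho * u i <= lambda * c (Some i) t * u i + \sum_j q i j t * u j) ->
  exists2 a, 0 < a & forall T, 0 <= T ->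
    ((a * expR (rho * T))%:E <= growth pi P lambda T)%E.
Proof.
move=> sub; have [U Uu] := finite_ub i0 u.
have U0 : 0 < U by apply: lt_le_trans (Uu i0).
(* The constant comes from comparing [u] with [one]: here [u <= U * one], while in [growth_le] a
   positive lower bound [U] of [u] gives [U * one <= u]. *)
exists (u i0 / U) => [|T T0]; first exact: divr_gt0.
have genV m i t : 0 <= t -> (m == 0)%N || true -> 0 <= gen q gam V m i t.
  move=> t0 _; rewrite gen_sum0//= subrr mulr0 subr0 /gam /reward mulrBl.
  by rewrite addrAC subr_ge0 sub.
have VU m x : `|V m x| <= U.
  by case: x => [i|] /=; rewrite ?normr0 ?(ltW U0)// gtr0_norm.
have [C gC] := bmfun_uniform bgam.
have [K K0 HK] := entry_tail law qE bq predT T0 bgam gC VU.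
have XE n : expR (- rho * T) * (U * X T n) >= u i0 - K / 2 ^+ n.
  have := dynkin_ge law qE bq (ok := predT) bgam (fun=> erefl) genV n T0.
  rewrite lerBlDr => /le_trans; apply; apply: lerD; last first.
    by rewrite (le_trans (ler_norm _)).
  rewrite X_sum// !mulr_sumr; apply: ler_sum => m _.
  rewrite exit0 addr0 stayE// ler_wpM2l ?expR_ge0//; apply: stay_le_scale => //.
    by move=> x; exact: breward.
  move=> l [i|]; rewrite /one /= ?mulr1//.
  by rewrite mulr0.
rewrite (growthE law lambda qE bq cE bc)//; set s := ereal_sup _.
have Xs n : ((X T n)%:E <= s)%E by apply: ereal_sup_ubound; exists n.
case: s Xs => [s Xs|_|/(_ 0%N)//]; last by rewrite leey.
rewrite lee_fin mulrAC ler_pdivrMr//.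
have H : u i0 <= expR (- rho * T) * (U * s).
  apply/ler_addgt0Pr => e e0; have [n Hn] := half_pow_small K0 e0.
  have := XE n; have := Hn n (leqnn n).
  have : expR (- rho * T) * (U * X T n) <= expR (- rho * T) * (U * s).
    by rewrite ler_wpM2l ?expR_ge0// ler_wpM2l ?(ltW U0)// -lee_fin.
  by move: (expR _ * _) (expR _ * _) (K / _) => a b k; lra.
rewrite -ler_pdivlMr ?expR_gt0// -expRN -mulNr.
by rewrite [s * U]mulrC [leRHS]mulrC.
Qed.

Lemma growth_le : (forall i t, 0 <= t ->
    lambda * c (Some i) t * u i + \sum_j q i j t * u j <= rho * u i) ->
  exists2 a, 0 < a & forall T, 0 <= T ->
    (growth pi P lambda T <= (a * expR (rho * T))%:E)%E.
Proof.
move=> sup; have [U U0 Uu] := finite_gt0_lb i0 u0.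
exists (u i0 / U) => [|T T0]; first exact: divr_gt0.
have genV m i t : 0 <= t -> (m == 0)%N || true -> gen q gam V m i t <= 0.
  move=> t0 _; rewrite gen_sum0//= subrr mulr0 subr0 /gam /reward mulrBl.
  by rewrite addrAC subr_le0 sup.
have V0 m x : 0 <= V m x by case: x => [i|] //=; rewrite ltW.
rewrite (growthE law lambda qE bq cE bc)//; apply: ge_ereal_sup => _ [n _ <-].
rewrite lee_fin -/(X T n) mulrAC ler_pdivlMr//.
have H : expR (- rho * T) * (U * X T n) <= u i0.
  have /(_ n) := dynkin_le law qE bq (ok := predT) _ bgam (fun=> erefl) genV T0.
  apply: le_trans; rewrite -[leLHS]addr0 lerD//; last first.
    by apply: Ex_ge0 => w; exact: entry_ge0.
  rewrite X_sum// !mulr_sumr; apply: ler_sum => m _.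
  rewrite exit0 addr0 stayE// ler_wpM2l ?expR_ge0//.
  rewrite mulrC -ler_pdivlMr// mulrC; apply: stay_le_scale => //.
    by move=> x; exact: breward.
  move=> l [i|]; rewrite /one /=; last by rewrite mulr0.
  by rewrite mulrC ler_pdivlMr// mul1r.
rewrite -ler_pdivrMr ?expR_gt0// -expRN -mulNr.
by rewrite mulrC [X T n * U]mulrC.
Qed.

(** The constant [a] changes the average only by [ln a / (lambda * T)], which the limit superior
    ignores. *)
Lemma J_ge (a : R) (PP : S -> policy M -> probability (Omega R S) R) :
  PP i0 pi = P -> 0 < a ->
  (forall T, 0 <= T -> ((a * expR (rho * T))%:E <= growth pi P lambda T)%E) ->
  (g%:E <= J PP lambda i0 pi)%E.
Proof.
move=> PE a0 H; apply: (@limf_esup_pinfty_ge _ _ _ (ln a / lambda)) => T T0.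
rewrite PE -/(growth pi P lambda T).
have lT : 0 < (lambda * T)^-1 by rewrite invr_gt0 mulr_gt0.
have aT : 0 < a * expR (rho * T) by rewrite mulr_gt0// expR_gt0.
apply: (@le_trans _ _ (((lambda * T)^-1)%:E * lne (a * expR (rho * T))%:E)%E); last first.
  rewrite lee_pmul2l// lee_lne ?H ?(ltW T0)//; rewrite in_itv/= ?leey ?andbT.
    by rewrite lee_fin ltW.
  by rewrite (le_trans _ (H _ (ltW T0)))// lee_fin ltW.
rewrite lne_EFin// lnM ?posrE ?expR_gt0// expRK -EFinM lee_fin.
rewrite le_eqVlt; apply/orP; left; apply/eqP; rewrite /rho.
by field; rewrite !gt_eqF.
Qed.

Lemma J_le (a : R) (PP : S -> policy M -> probability (Omega R S) R) :
  PP i0 pi = P -> 0 < a ->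
  (forall T, 0 <= T -> (growth pi P lambda T <= (a * expR (rho * T))%:E)%E) ->
  (J PP lambda i0 pi <= g%:E)%E.
Proof.
move=> PE a0 H; apply: (@limf_esup_pinfty_le _ _ _ (ln a / lambda)) => T T0.
rewrite PE -/(growth pi P lambda T).
have lT : 0 < (lambda * T)^-1 by rewrite invr_gt0 mulr_gt0.
have aT : 0 < a * expR (rho * T) by rewrite mulr_gt0// expR_gt0.
have G0 : (0 <= growth pi P lambda T)%E by apply: integral_ge0 => w _; exact: expeR_ge0.
apply: (@le_trans _ _ (((lambda * T)^-1)%:E * lne (a * expR (rho * T))%:E)%E).
  rewrite lee_pmul2l// lee_lne ?H ?(ltW T0)//; rewrite in_itv/= ?leey ?andbT//.
  by rewrite lee_fin ltW.
rewrite lne_EFin// lnM ?posrE ?expR_gt0// expRK -EFinM lee_fin.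
rewrite le_eqVlt; apply/orP; left; apply/eqP; rewrite /rho.
by field; rewrite !gt_eqF.
Qed.

End growth_bounds.

(** * First passage under a stationary policy *)

Section stationary.
Context (R : realType) (S : pfinType) (A : ptopologicalType) (M : ctmdp R S A).
Variables (f : spolicy M) (i0 : S) (P : probability (Omega R S) R).
Hypothesis law : process_law i0 (stat f) P.

Let q i j (t : R) := rate M i (f i) j.

Let qE i j t : 0 <= t -> pol_rate (stat f) (Some i) t j = (q i j t)%:E.
Proof.
move=> _; rewrite /= integral_dirac; first 1 last.
- exact: adm_measurable.
- by apply/measurable_EFinP; exact: rate_measurable.
by rewrite diracE mem_set ?mul1e//; exact: sel_adm.
Qed.

Let bq i j : bmfun (q i j).
Proof. exact: bmfun_cst. Qed.

Let qs i t : 0 <= t -> \sum_j q i j t = 0.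
Proof. by move=> _; apply: rate_sum0; exact: sel_adm. Qed.

Let q0 i j t : j != i -> 0 <= q i j t.
Proof. by move=> ji; apply: rate_ge0 => //; exact: sel_adm. Qed.

Lemma stat_cost i t : pol_cost (stat f) (Some i) t = (sel_cost f (Some i))%:E.
Proof.
rewrite /= integral_dirac; first 1 last.
- exact: adm_measurable.
- by apply/measurable_EFinP; exact: cost_measurable.
by rewrite diracE mem_set ?mul1e//; exact: sel_adm.
Qed.

Lemma stat_growth_le (lambda g : R) (u : S -> R) (PP : S -> policy M -> probability (Omega R S) R) :
  PP i0 (stat f) = P -> 0 < lambda -> (forall i, 0 < u i) ->
  (forall i, lambda * cost M i (f i) * u i + \sum_j rate M i (f i) j * u j <=
     lambda * g * u i) ->
  (J PP lambda i0 (stat f) <= g%:E)%E.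
Proof.
move=> PE l0 u0 sup.
have [a a0 Ha] := growth_le law qE bq (c := fun x _ => sel_cost f x)
  (fun i t _ => stat_cost i t) (fun x => bmfun_cst _ _) qs u0 (fun i t _ => sup i).
exact: J_le PE a0 Ha.
Qed.

Variables (z : S) (lambda g : R).
Hypothesis lambda0 : 0 < lambda.

Let excess x (t : R) := sel_cost f x - g.
Let bexcess x : bmfun (excess x).
Proof. exact: bmfun_cst. Qed.
Let gam := reward excess lambda.
Let bgam x : bmfun (gam x).
Proof. by apply: breward. Qed.
(** With zero reward all weights are 1 and the hitting sums are probabilities, from which almost
    sure hitting is derived. *)
Let zero (x : option S) (t : R) : R := 0.
Let bzero x : bmfun (zero x).
Proof. exact: bmfun_cst. Qed.

Definition passage := (\int[P]_w expeR (lambda%:E *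
  \int[lebesgue_measure]_(t in [set t : R | (0 <= t)%R /\ t%:E < tau z w])
    (sel_cost f (xi w t) - g)%:E))%E.

Let weight0 T m w : 0 <= T -> weight zero T m w = 1.
Proof.
move=> T0; elim: m => //= m ->.
by rewrite !prim_cst ?theta_ge0// !mul0r oppr0 expR0 !mulr1.
Qed.

Let sum_hit0_le T m w : 0 <= T ->
  \sum_(l < m) hit z zero T l w <= 1 - (alive (avoid z) m w)%:R.
Proof.
move=> T0; elim: m => [|m IH]; first by rewrite big_ord0 /= subrr.
rewrite big_ord_recr/= (le_trans (lerD IH (lexx _)))//.
rewrite /hit weight0// mulr1 /avoid; case: (alive _ _ _) => /=; last first.
  by rewrite !mul0r addr0.
rewrite subrr add0r mul1r; case: eqVneq => //= _; rewrite ?subr0 ?subrr ?mul0r//.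
by rewrite mul1r; case: (_ <= _)%E.
Qed.

Section two_states.
Variable y : S.
Hypothesis yz : y != z.
Hypothesis irr : crossing (fun i j => rate M i (f i) j).

Lemma stat_hitting_lower gam' V D x : (forall x, bmfun (gam' x)) ->
  (forall m i t, 0 <= t -> (m == 0)%N || (i != z) -> 0 <= gen q gam' V m i t) ->
  (forall m x, 0 <= V m x <= D) -> (forall m, V m None = 0) ->
  (forall m, V m.+1 (Some z) = 1) ->
  (forall T n, 0 <= T -> \sum_(m < n) Ex P (hit z gam' T m) <= x) ->
  V 0%N (Some i0) <= x.
Proof.
move=> bgam' genV VD VN Vz Hx.
have [C gC] := bmfun_uniform bgam'.
have C0 : 0 <= C by apply: le_trans (gC None 0).
(* The first [C] pays for a reward as low as [- C], and [C + 1] is the discount, so away from [z]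
   the weight [psi] is a subsolution for the discounted reward. *)
have [psi [psi0 psiz psik]] := hitting_weight z (C + (C + 1))
  (fun i j => @q0 i j 0) irr.
have zB : ~~ (fun i => i != z) z by rewrite /= eqxx.
have [k [b [+ bz]]] := irr (B := fun i => i != z) zB yz.
rewrite negbK => /eqP-> {k zB} qzb.
pose s := \sum_(j | j != z) rate M z (f z) j * psi j.
have s0 : 0 < s.
  rewrite /s (bigD1 b)//= ltr_wpDr ?mulr_gt0//; apply: sumr_ge0 => j /andP[jz _].
  by apply: mulr_ge0; [exact: (@q0 _ _ 0)|rewrite ltW].
(* For a start at [z] the value must be small enough for the flow [s] out of [z] to dominate: [E]
   bounds the discounted loss together with the exit rate, and [v0 * E = s]. *)
pose E := C + (C + 1) + `|rate M z (f z) z|.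
have E0 : 0 < E by rewrite /E; have := normr_ge0 (rate M z (f z) z); lra.
pose v0 := s / E; have v00 : 0 < v0 by exact: divr_gt0.
pose W m i := if (m == 0)%N && (i == z) then v0 else psi i.
pose Vk m (x : option S) := if x is Some i then W m i else 0.
have [c c0 Hc] := finite_gt0_lb i0 psi0.
have [D' HD] := finite_ub i0 psi.
apply: (hitting_lower law qE bq bgam' gC (kappa := C + 1) _ genV VD VN Vz
  (Vk := Vk) (c := Num.min c v0) (Dk := Num.max D' v0)) => //.
- by rewrite ltrDl.
- move=> m i t t0 mi; rewrite gen_sum0//=; have gCi := gC (Some i) t.
  have [/andP[/eqP-> /eqP iz]|nz] := boolP ((m == 0)%N && (i == z)).
    rewrite iz /W/= eqxx (bigD1 z)//= -/s.
    have sE : v0 * E = s by rewrite /v0 divfK ?gt_eqF.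
    have : v0 * (gam' (Some z) t + C + `|rate M z (f z) z| + q z z t) >= 0.
      rewrite mulr_ge0 ?(ltW v00)//; move: gCi; rewrite iz ler_norml => /andP[? _].
      have : - q z z t <= `|rate M z (f z) z| by rewrite ler_normr lexx orbT.
      lra.
    rewrite -sE /E; move: (`|_|) (gam' _ _) (psi z) (q z z t) => a e p qq; nra.
  have iz : i != z by apply: contraNneq nz => iz; move: mi; rewrite iz eqxx orbF andbT.
  rewrite /W (negPf iz) andbF subrr mulr0 subr0.
  have := psik _ iz; rewrite -[\sum_j _ * psi j]/(\sum_j q i j t * psi j).
  have : psi i * (gam' (Some i) t + C) >= 0.
    by rewrite mulr_ge0 ?(ltW (psi0 i))//; move: gCi; rewrite ler_norml; lra.
  move: (\sum_j _) (gam' _ _) (psi i) => a e p; nra.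
- by rewrite lt_min c0.
- move=> m i; rewrite /Vk /W; case: ifP => _.
    by rewrite ge_min le_max !lexx !orbT.
  by rewrite ge_min le_max Hc HD.
Qed.

(** One index serves as jump bound and horizon, which makes the sums a single nondecreasing
    sequence. *)
Let hits (gam' : option S -> R -> R) k w : R := \sum_(m < k) hit z gam' k%:R m w.

Let bhits gam' k : (forall x, bmfun (gam' x)) -> bmfun (hits gam' k).
Proof. by move=> bg; apply: bmfun_sum => m; apply: bmfun_hit. Qed.

Let Ex_hits_ge gam' T n : 0 <= T -> (forall x, bmfun (gam' x)) ->
  exists k, \sum_(m < n) Ex P (hit z gam' T m) <= Ex P (hits gam' k).
Proof.
move=> T0 bg; pose k := maxn n (Num.bound T).
have Tk : T <= k%:R.
  by rewrite (le_trans (ltW (archi_boundP T0)))// ler_nat leq_maxr.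
exists k; rewrite /hits Ex_sum; last by move=> m; exact: bmfun_hit.
apply: (@le_trans _ _ (\sum_(m < n) Ex P (hit z gam' k%:R m))).
  apply: ler_sum => m _; apply: le_Ex => [||w]; first exact: bmfun_hit.
    exact: bmfun_hit.
  exact: le_hit.
apply: (@ler_sum_ord _ _ _ (fun m => Ex P (hit z gam' k%:R m))).
  exact: leq_maxl.
by move=> m; apply: Ex_ge0 => w; exact: hit_ge0.
Qed.

Let never := [set w : Omega R S | forall k, hits zero k w <= 0].

Let measurable_never : measurable never.
Proof.
rewrite (_ : never = \bigcap_k [set w | hits zero k w <= 0]); last first.
  by apply/seteqP; split => [w h n _|w h n]; [exact: h|exact: (h n I)].
apply: bigcapT_measurable => k; have [mh _] := bhits k bzero.
have := mh measurableT _ (measurable_itv `]-oo, 0%R]); rewrite setTI.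
by congr measurable; apply/seteqP; split => w /=; rewrite in_itv.
Qed.

Let never0 : P never = 0%E.
Proof.
have bN : bmfun (\1_never : Omega R S -> R) by exact: bmfun_indic.
have EN : P never = (Ex P \1_never)%:E by rewrite ExE// integral_indic// setIT.
rewrite EN; congr (_%:E); apply/eqP; rewrite eq_le Ex_ge0 ?andbT; last first.
  by move=> w; rewrite indicE.
rewrite -[leRHS](subrr 1) lerBrDr addrC -lerBrDr.
(* The constant 1 on [S] is harmonic for zero reward, so the lower bound applies to it, with the
   probability of hitting, 1 minus that of [never], as bound of the hitting sums. *)
pose V (m : nat) (x : option S) : R := if x is Some i then 1 else 0.
apply: (@stat_hitting_lower zero V 1) => //.
- by move=> m i t t0 _; rewrite gen_sum0// /zero mul0r subrr mulr0 subr0 add0r /V -mulr_suml qs// mul0r.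
- by move=> m [i|] /=; rewrite ?lexx ler01.
move=> T n T0; have [k] := Ex_hits_ge n T0 bzero.
move=> /le_trans; apply; rewrite -[X in X - _](Ex_cst P) -ExB//; last exact: bmfun_cst.
apply: le_Ex => [||w]; first exact: bhits.
  by apply: bmfunB => //; exact: bmfun_cst.
have := sum_hit0_le k w (ler0n R k); rewrite -/(hits zero k w) indicE.
case: (boolP (w \in never)) => [/set_mem/(_ k)|_ /le_trans].
  by rewrite subrr.
by apply; rewrite subr0 gerBl.
Qed.

(** Off [never] exactly one hit occurs; its term is the exponential of the integral up to [tau z],
    as soon as [k] exceeds its jump number and time. *)
Let passage_sup : passage = ereal_sup (range (fun k => (Ex P (hits gam k))%:E)).
Proof.
apply: (integral_eventually measurable_never never0).
- by move=> k; exact: bhits.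
- by move=> k w; apply: sumr_ge0 => m _; exact: hit_ge0.
- move=> k w; rewrite /hits [leRHS]big_ord_recr/= ler_wpDr ?hit_ge0//.
  by apply: ler_sum => m _; apply: le_hit; rewrite ?ler_nat.
- by move=> w; exact: expeR_ge0.
move=> w /existsNP[k0 /negP]; rewrite -ltNge => h0.
have [m [al /eqP sm mk]] : exists m, [/\ alive (avoid z) m w, st w m.+1 == Some z &
    (jump_time w m.+1 <= k0%:R%:E)%E].
  apply: contrapT => nh; move: h0; rewrite /hits big1 ?ltxx// => m _; rewrite /hit.
  case: (boolP (alive _ _ _)) => h1; rewrite ?mul0r//.
  case: (boolP (_ == _)) => h2; rewrite ?(mulr0, mul0r)//.
  case: (boolP (_ <= _)%E) => h3; rewrite ?(mulr0, mul0r)//.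
  by exfalso; apply: nh; exists m.
exists (maxn k0 m.+1) => k; rewrite geq_max => /andP[k0k mk'].
have mkk : (jump_time w m.+1 <= k%:R%:E)%E by rewrite (le_trans mk)// lee_fin ler_nat.
have k0' : 0 <= k%:R :> R by [].
rewrite /hits (bigD1 (Ordinal mk'))//= big1 ?addr0; last first.
  move=> l; rewrite -val_eqE/= => lm; rewrite /hit.
  case: (boolP (alive _ _ _)) => h1; rewrite ?mul0r//.
  case: (boolP (_ == _)) => /eqP h2; rewrite ?(mulr0, mul0r)//.
  by move: lm; rewrite (hit_unique al sm h1 h2) eqxx.
rewrite /hit al sm eqxx mkk !mul1r mulr1 weight_action /gam action_reward//.
rewrite -/(expeR (_)%:E) EFinM; congr (expeR (_ * _)%E).
rewrite -(@integral_path_itvco _ _ excess bexcess (fun x _ => (sel_cost f x - g)%:E)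
  (fun i t _ => erefl) k%:R m w k0').
congr (integral _ _ _); apply/seteqP; split => t /=; rewrite in_itv/= (tau_hit al sm).
  by move=> [-> /=]; rewrite -(theta_jump k0' mkk) lte_fin.
by move=> /andP[-> h]; rewrite -(theta_jump k0' mkk) lte_fin.
Qed.

Lemma passage_ge V D : 
  (forall m i t, 0 <= t -> (m == 0)%N || (i != z) -> 0 <= gen q gam V m i t) ->
  (forall m x, 0 <= V m x <= D) -> (forall m, V m None = 0) ->
  (forall m, V m.+1 (Some z) = 1) -> ((V 0%N (Some i0))%:E <= passage)%E.
Proof.
move=> genV VD VN Vz; rewrite passage_sup; set x := ereal_sup _.
have Hx k : ((Ex P (hits gam k))%:E <= x)%E by apply: ereal_sup_ubound; exists k.
case: x Hx => [x Hx|_|/(_ 0%N)//]; last by rewrite leey.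
rewrite lee_fin; apply: (stat_hitting_lower bgam genV VD VN Vz) => T n T0.
by have [k /le_trans] := Ex_hits_ge n T0 bgam; apply; rewrite -lee_fin.
Qed.

Lemma passage_le V :
  (forall m i t, 0 <= t -> (m == 0)%N || (i != z) -> gen q gam V m i t <= 0) ->
  (forall m x, 0 <= V m x) -> (forall m, V m None = 0) ->
  (forall m, V m.+1 (Some z) = 1) -> (passage <= (V 0%N (Some i0))%:E)%E.
Proof.
move=> genV V0 VN Vz; rewrite passage_sup; apply: ge_ereal_sup => _ [k _ <-].
rewrite lee_fin Ex_sum; last by move=> m; exact: bmfun_hit.
exact: (hitting_upper law qE bq k bgam V0 VN Vz genV).
Qed.

End two_states.

Section one_state.
Hypothesis Sz : forall i : S, i = z.

(** A single state leaves no jump to make, so the first sojourn is almost surely infinite and the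
    constant [cost - g] is integrated over the half-line. *)
Lemma passage1 :
  passage = expeR (lambda%:E * ((cost M z (f z) - g)%:E * +oo))%E.
Proof.
pose N := \bigcup_k [set w : Omega R S | (jump_time w 1 <= k%:R%:E)%E].
have mN : measurable N by apply: bigcupT_measurable => k; exact: measurable_jump_set.
have PN : P N = 0%E.
  apply/negligibleP => //; apply: negligible_bigcup => k.
  apply/negligibleP; first exact: measurable_jump_set.
  apply: etrans (prob_jump_le P k%:R 1) _; apply/eqP; rewrite eqe eq_le Ex_ge0// andbT.
  (* This function passes from 0 to 1 at the first jump and, with no other state available, has zero
     generator; [hitting_upper] then gives probability 0 for a first jump by time [k]. *)
  pose V (m : nat) (x : option S) : R := if x is Some i then (m != 0)%:R else 0.
  have := @hitting_upper _ _ _ _ _ _ _ law _ qE bq z zero V k%:R 1 bzero.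
  rewrite big_ord1 /= => H; apply: le_trans (H _ _ _ _ _) => //.
  - apply: le_Ex => [||w]; first exact: bmfun_jump_le.
      exact: bmfun_hit.
    rewrite /hit weight0//=; case: (boolP (_ <= _)%E) => h; rewrite ?mulr0// mulr1.
    case: eqVneq => [_|/eqP]; first by rewrite !mulr1.
    by case s1: (st w 1) => [i|]; [rewrite (Sz i)|rewrite jump_time_None in h].
  - by move=> m [i|] /=.
  - move=> m i t t0 _; rewrite /gen big1 ?addr0 /zero ?mul0r// => j.
    by rewrite (Sz i) (Sz j) eqxx.
rewrite /passage (@integral_ae_ge0 _ _ _ _ _
   (cst (expeR (lambda%:E * ((cost M z (f z) - g)%:E * +oo))%E)) N) //.
- rewrite integral_cst// -[RHS]mule1; congr (_ * _)%E; exact: probability_setT.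
- by move=> w /=; exact: expeR_ge0.
- by move=> w; exact: expeR_ge0.
move=> w wN /=; have w1 : jump_time w 1 = +oo%E.
  case w1: (jump_time w 1) (jump_time_ge0 w 1) => [r| |]// r0; exfalso; apply: wN.
  exists (Num.bound r) => //=; rewrite w1 lee_fin ltW// archi_boundP//.
have -> : tau z w = +oo%E.
  rewrite /tau (_ : [set _ | t in _] = set0) ?ereal_inf0//.
  by apply/seteqP; split => // x [t [/=]]; rewrite w1.
congr (expeR (_ * _)%E).
rewrite (_ : [set t | _] = `[0%R, +oo[%classic); last first.
  by apply/seteqP; split => t /=; rewrite in_itv/= andbT; [case|rewrite ltry].
transitivity (\int[lebesgue_measure]_(t in `[0%R, +oo[) cst (cost M z (f z) - g)%:E t)%E.
  apply: eq_integral => t; rewrite mem_setE in_itv/= andbT => t0.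
  rewrite (@xiE _ _ w t 0) ?jump_time0 ?w1 ?ltry ?lee_fin//.
  case s0: (st w 0) (@traj_start _ _ w) => [i|//] _.
  by rewrite /= (Sz i).
rewrite integral_cst//; congr (_ * _)%E.
by apply: etrans (lebesgue_measure_itv `[0%R, +oo[) _; rewrite /= ltry.
Qed.
End one_state.

Hypothesis irr : irreducible f.
Variable u : S -> R.
Hypothesis u0 : forall i, 0 < u i.
Hypothesis uz : u z = 1.

Let V (m : nat) (x : option S) : R := if x is Some i then u i else 0.

Let gen_u m i t : 0 <= t -> gen q gam V m i t =
  lambda * cost M i (f i) * u i + \sum_j rate M i (f i) j * u j - lambda * g * u i.
Proof. by move=> t0; rewrite gen_sum0// subrr mulr0 subr0 /gam /reward /excess /=; ring. Qed.

Let one_state_cost : (forall i, i = z) ->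
  lambda * cost M z (f z) * u z + \sum_j rate M z (f z) j * u j = lambda * cost M z (f z).
Proof.
move=> Sz; rewrite uz mulr1 (eq_bigr (fun j => rate M z (f z) j)) ?rate_sum0 ?addr0//.
  exact: sel_adm.
by move=> j _; rewrite (Sz j) uz mulr1.
Qed.

Lemma passage_subsolution :
  (forall i, lambda * g * u i <=
     lambda * cost M i (f i) * u i + \sum_j rate M i (f i) j * u j) ->
  ((u i0)%:E <= passage)%E.
Proof.
move=> sub; have [/existsP[y yz]|] := boolP [exists y, y != z].
  have [U HU] := finite_ub i0 u.
  apply: (@passage_ge y yz (irreducible_crossing irr) V U) => //.
  - by move=> m i t t0 _; rewrite gen_u// subr_ge0.
  - move=> m [i|] /=; first by rewrite (ltW (u0 i)) HU.
    by rewrite lexx (le_trans _ (HU i0))// ltW.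
rewrite negb_exists => /forallP Sz; have {}Sz i : i = z by apply/eqP; rewrite -[_ == _]negbK.
rewrite passage1// (Sz i0) uz.
(* With one state the inequality says that [g] is at most the cost; equality gives the exponent
   [0 * +oo = 0] and passage value 1, strict inequality gives [+oo]. *)
have := sub z; rewrite one_state_cost// uz mulr1 ler_pM2l// le_eqVlt => /predU1P[<-|gc].
  by rewrite subrr mul0e mule0 expeR0.
by rewrite gt0_muley ?lte_fin ?subr_gt0// gt0_muley ?leey// lte_fin.
Qed.

Lemma passage_supersolution :
  (forall i, lambda * cost M i (f i) * u i + \sum_j rate M i (f i) j * u j <=
     lambda * g * u i) ->
  (passage <= (u i0)%:E)%E.
Proof.
move=> sup; have [/existsP[y yz]|] := boolP [exists y, y != z].
  apply: (@passage_le y yz (irreducible_crossing irr) V) => //.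
  - by move=> m i t t0 _; rewrite gen_u// subr_le0.
  - by move=> m [i|] //=; rewrite ltW.
rewrite negb_exists => /forallP Sz; have {}Sz i : i = z by apply/eqP; rewrite -[_ == _]negbK.
rewrite passage1// (Sz i0) uz.
have := sup z; rewrite one_state_cost// uz mulr1 ler_pM2l// le_eqVlt => /predU1P[->|gc].
  by rewrite subrr mul0e mule0 expeR0.
by rewrite lt0_muley ?lte_fin ?subr_lt0// gt0_muleNy ?lte_fin//= lee_fin.
Qed.

(* The slack at [z] is spent on the value at time 0 only: a trajectory that
   starts at [z] is weighted by more than [u z] until its first jump. *)
Lemma passage_strict (d K : R) : i0 = z -> 0 < d -> 0 <= K ->
  (forall i, (lambda * g + d) * u i <=
     lambda * cost M i (f i) * u i + \sum_j rate M i (f i) j * u j) ->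
  lambda * (g - cost M z (f z)) - rate M z (f z) z <= K ->
  ((1 + d / (K + 1))%:E <= passage)%E.
Proof.
move=> i0z d0 K0 sub HK; have [/existsP[y yz]|] := boolP [exists y, y != z].
  have [U HU] := finite_ub i0 u.
  (* Raising the value at [z] by [e] at jump number 0 lowers the generator there by at most [e * K],
     which is below the slack [d = e * (K + 1)]. *)
  pose e := d / (K + 1); have e0 : 0 < e by rewrite divr_gt0// ltr_wpDl.
  have eK : e * (K + 1) = d by rewrite /e divfK// gt_eqF// ltr_wpDl.
  pose W m i := if (m == 0)%N && (i == z) then 1 + e else u i.
  pose V' m (x : option S) := if x is Some i then W m i else 0.
  have -> : 1 + e = V' 0%N (Some i0) by rewrite /V' /W i0z !eqxx.
  apply: (@passage_ge y yz (irreducible_crossing irr) V' (U + (1 + e))) => //.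
  - move=> m i t t0 mi; rewrite gen_sum0//= {2}/W/=.
    have {sub} := sub i; rewrite -[\sum_j _ * u j]/(\sum_j q i j t * u j).
    have [/andP[/eqP-> /eqP iz]|nz] := boolP ((m == 0)%N && (i == z)).
      rewrite iz /W/= eqxx uz /gam /reward /excess /= !mulr1.
      rewrite -[rate M z (f z) z]/(q z z t) in HK.
      have := ler_wpM2l (ltW e0) HK; rewrite -[q z z t * (_ - _)]/(q z z t * (1 - (1 + e))).
      move: (\sum_j _) (q z z t) (cost _ _ _) => a b c; nra.
    have iz : i != z by apply: contraNneq nz => iz; move: mi; rewrite iz eqxx orbF andbT.
    rewrite /W (negPf iz) andbF subrr mulr0 subr0 /gam /reward /excess /=.
    have := mulr_ge0 (ltW d0) (ltW (u0 i)).
    move: (\sum_j _) (u i) (cost _ _ _) => a b c; nra.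
  - move=> m [i|]; rewrite /V' /W; last first.
      by rewrite lexx; have := HU i0; have := u0 i0; lra.
    by case: ifP => _; have := HU i; have := u0 i; lra.
rewrite negb_exists => /forallP Sz; have {}Sz i : i = z by apply/eqP; rewrite -[_ == _]negbK.
rewrite passage1//.
have := sub z; rewrite one_state_cost// uz mulr1 => h.
have gc : g < cost M z (f z) by rewrite -(ltr_pM2l lambda0); lra.
by rewrite gt0_muley ?lte_fin ?subr_gt0// gt0_muley ?leey// lte_fin.
Qed.

End stationary.

(** * Lower bound over randomized Markov policies *)

Section policy_lower_bound.
Context (R : realType) (S : pfinType) (A : ptopologicalType) (M : ctmdp R S A).
Variables (i0 : S) (pi : policy M) (PP : S -> policy M -> probability (Omega R S) R).
Hypothesis law : process_law i0 pi (PP i0 pi).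
Variable C : R.
Hypothesis boundC : forall i a, adm M i a ->
  `|cost M i a| <= C /\ forall j, `|rate M i a j| <= C.

Let bcost i : bounded_on (adm M i) (cost M i).
Proof. by split; [exact: cost_measurable|exists C => a /boundC[]]. Qed.

Let brate i j : bounded_on (adm M i) (fun a => rate M i a j).
Proof. by split; [exact: rate_measurable|exists C => a /boundC[]]. Qed.

(** For fixed [u] the inequality is affine in cost and rates, so it survives averaging over the
    actions; the averages are the time-dependent coefficients fed to [growth_ge]. *)
Lemma policy_J_ge (lambda g : R) (u : S -> R) : 0 < lambda -> (forall i, 0 < u i) ->
  (forall i a, adm M i a ->
    lambda * g * u i <= lambda * cost M i a * u i + \sum_j rate M i a j * u j) ->
  (g%:E <= J PP lambda i0 pi)%E.
Proof.
move=> l0 u0 sub; have mD i := adm_measurable M i; have kD i t := @pol_adm _ _ _ _ pi i t.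
pose av i f := avg (pi i) (adm M i) f.
pose q i j t := av i (fun a => rate M i a j) t * (0 <= t)%R%:R.
pose c x t := if x is Some i then av i (cost M i) t * (0 <= t)%R%:R else 0.
have qE i j t : 0 <= t -> pol_rate pi (Some i) t j = (q i j t)%:E.
  by move=> t0; rewrite /= (avgE (mD i) (kD i) t0 (brate i j)) /q t0 mulr1.
have cE i t : 0 <= t -> pol_cost pi (Some i) t = (c (Some i) t)%:E.
  by move=> t0; rewrite /= (avgE (mD i) (kD i) t0 (bcost i)) /c t0 mulr1.
have bq i j : bmfun (q i j) by apply: bmfun_avg (brate i j) => //; exact: kD.
have bc x : bmfun (c x).
  case: x => [i|]; last exact: bmfun_cst.
  by apply: bmfun_avg (bcost i) => //; exact: kD.
have qs i t : 0 <= t -> \sum_j q i j t = 0.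
  move=> t0; rewrite -mulr_suml -(avg_sum (mD i) (kD i) _ t0 (brate i)).
  have -> : avg (pi i) (adm M i) (fun a => \sum_j rate M i a j) t =
      avg (pi i) (adm M i) (fun=> 0) t by apply: avg_eq => a; exact: rate_sum0.
  by rewrite (avg_cst (mD i) (kD i))// mul0r.
have Lge i t : 0 <= t ->
    lambda * g * u i <= lambda * c (Some i) t * u i + \sum_j q i j t * u j.
  move=> t0; rewrite /c /q t0 mulr1.
  pose F a := u i * lambda * cost M i a + \sum_j u j * rate M i a j.
  have bS : bounded_on (adm M i) (fun a => \sum_j u j * rate M i a j).
    by apply: bounded_on_sum => j; exact: bounded_onZ.
  have bF : bounded_on (adm M i) F by apply: bounded_onD => //; exact: bounded_onZ.
  have -> : lambda * av i (cost M i) t * u i +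
      \sum_j av i (fun a => rate M i a j) t * 1 * u j = av i F t.
    rewrite /av (avgD (mD i) (kD i))//; last exact: bounded_onZ.
    rewrite (avgZ (mD i) (kD i))//.
    rewrite (avg_sum (mD i) (kD i))//; last by move=> j; exact: bounded_onZ.
    congr (_ + _); first by ring.
    by apply: eq_bigr => j _; rewrite (avgZ (mD i) (kD i))//; ring.
  rewrite -subr_ge0 -[X in _ - X](avg_cst (mD i) (kD i) _ t0) -mulN1r -(avgZ (mD i) (kD i))//; last exact: bounded_on_cst.
  rewrite -(avgD (mD i) (kD i))//; last by apply: bounded_onZ; exact: bounded_on_cst.
  apply: avg_ge0 => a Da; rewrite mulN1r subr_ge0 (le_trans (sub _ _ Da))// /F.
  rewrite le_eqVlt; apply/orP; left; apply/eqP; congr (_ + _); first by ring.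
  by apply: eq_bigr => j _; rewrite mulrC.
have [a a0 Ha] := growth_ge law qE bq cE bc qs u0 Lge.
exact: J_ge a0 Ha.
Qed.

End policy_lower_bound.

(** * First passage values, average costs and [gbar] *)

Lemma lne_scale_ge (R : realType) (lambda x : R) (p : \bar R) : 0 < lambda ->
  0 < x -> (x%:E <= p)%E -> ((ln x / lambda)%:E <= (lambda^-1)%:E * lne p)%E.
Proof.
move=> l0 x0 xp; rewrite mulrC EFinM lee_pmul2l ?lte_fin ?invr_gt0//.
rewrite (_ : (ln x)%:E = lne x%:E); last by rewrite lne_EFin.
rewrite lee_lne// in_itv/= leey andbT ?lee_fin ?(ltW x0)//.
by rewrite (le_trans _ xp)// lee_fin ltW.
Qed.

Lemma lne_scale_le (R : realType) (lambda x : R) (p : \bar R) : 0 < lambda ->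
  0 < x -> (0 <= p)%E -> (p <= x%:E)%E -> ((lambda^-1)%:E * lne p <= (ln x / lambda)%:E)%E.
Proof.
move=> l0 x0 p0 px; rewrite mulrC EFinM lee_pmul2l ?lte_fin ?invr_gt0//.
rewrite (_ : (ln x)%:E = lne x%:E); last by rewrite lne_EFin.
by rewrite lee_lne// in_itv/= leey andbT// lee_fin ltW.
Qed.

Local Open Scope ereal_scope.

Theorem theorem3p2 (R : realType) (S : pfinType) (A : ptopologicalType)
  (M : ctmdp R S A) (lambda : R) (lambda_gt0 : (0 < lambda)%R)
  (P : S -> policy M -> probability (Omega R S) R)
  (P_law : forall i pi, process_law i pi (P i pi))
  (adm_compact : forall i, compact (adm M i))
  (cost_cont : forall i, {within adm M i, continuous (cost M i)})
  (rate_cont : forall i j, {within adm M i, continuous (fun a => rate M i a j)})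
  (irr : forall f : spolicy M, irreducible f)
  (z : S) :
  exists (g : R) (h : S -> R),
    [/\ gbar P lambda z = g%:E,
        forall i, hstar P lambda z g i = (h i)%:E,
        forall i, (lambda * g * expR (lambda * h i))%:E = oe_inf M lambda h i,
        exists f : spolicy M, attains lambda h f &
        forall f : spolicy M, attains lambda h f ->
          (forall i, Jstar P lambda i = J P lambda i (stat f) /\
                     J P lambda i (stat f) = g%:E) /\
          optimal P lambda (stat f)].
Proof.
have r_cont i : {within adm M i, continuous (fun a => lambda * cost M i a)%R}.
  by move=> a; apply: cvgM; [exact: cvg_cst|exact: cost_cont].
have irr' (f : S -> A) : (forall i, adm M i (f i)) ->
    crossing (fun i => rate M i (f i)).
  by move=> fa; exact: (irreducible_crossing (irr (SPolicy fa))).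
have [C C0 boundC] := coefficients_bounded (adm_nonempty M) adm_compact cost_cont rate_cont.
have [rho [v [v0 sub [f0 f0adm f0eq]]]] := optimality_equation_solution z
  (adm_nonempty M) adm_compact r_cont rate_cont (@rate_ge0 _ _ _ M)
  (@rate_sum0 _ _ _ M) irr'.
(* First passage pays 1 on arrival at [z], whence the normalisation [u z = 1]; then [h z = 0], which
   puts [g] itself in [Gset]. *)
pose u i := (v i / v z)%R; pose g := (rho / lambda)%R; pose h i := (ln (u i) / lambda)%R.
have u0 i : (0 < u i)%R by exact: divr_gt0.
have uz : u z = 1%R by rewrite /u divff// gt_eqF.
have lg : (lambda * g = rho)%R by rewrite /g mulrC divfK// gt_eqF.
have eh i : expR (lambda * h i) = u i.
  by rewrite /h [(lambda * _)%R]mulrC divfK ?gt_eqF// lnK ?posrE.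
pose L i a := (lambda * cost M i a * u i + \sum_j rate M i a j * u j)%R.
have Lv i a : (L i a = (lambda * cost M i a * v i + \sum_j rate M i a j * v j) / v z)%R.
  rewrite mulrDl mulr_suml /L /u mulrA; congr (_ + _)%R.
  by apply: eq_bigr => j _; rewrite mulrA.
have uv i : (lambda * g * u i = rho * v i / v z)%R by rewrite lg mulrA.
have subu i a : adm M i a -> (lambda * g * u i <= L i a)%R.
  by move=> ia; rewrite uv Lv ler_pM2r ?invr_gt0//; exact: sub.
have rhsE i a : oe_rhs M lambda h i a = L i a.
  by rewrite /oe_rhs eh; congr (_ + _)%R; apply: eq_bigr => j _; rewrite eh mulrC.
pose f : spolicy M := SPolicy f0adm.
have fE i : L i (f i) = (lambda * g * u i)%R by rewrite uv Lv -f0eq.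
have infE i : oe_inf M lambda h i = (lambda * g * u i)%:E.
  apply/eqP; rewrite eq_le; apply/andP; split.
    by apply: ereal_inf_lbound; exists (f i); [exact: f0adm|rewrite rhsE fE].
  by apply: le_ereal_inf_tmp => _ [a ia <-]; rewrite rhsE lee_fin subu.
have attE (f' : spolicy M) : attains lambda h f' ->
    forall i, L i (f' i) = (lambda * g * u i)%R.
  by move=> af i; have := af i; rewrite rhsE infE => -[].
have fatt : attains lambda h f by move=> i; rewrite rhsE infE fE.
have hle (f' : spolicy M) i : (h i)%:E <= hfun P lambda z g i f'.
  apply: (@lne_scale_ge _ _ (u i)) => //.
  apply: (passage_subsolution (P_law i (stat f')) lambda_gt0 (irr f') u0 uz) => j.
  exact/subu/sel_adm.
have hge i : hfun P lambda z g i f <= (h i)%:E.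
  apply: (@lne_scale_le _ _ (u i)) => //.
    by apply: integral_ge0 => w _; exact: expeR_ge0.
  apply: (passage_supersolution (P_law i (stat f)) lambda_gt0 (irr f) u0 uz) => j.
  by rewrite -/(L j (f j)) fE.
have hstarE i : hstar P lambda z g i = (h i)%:E.
  apply/eqP; rewrite eq_le; apply/andP; split.
    by apply: (le_trans _ (hge i)); apply: ereal_inf_lbound; exists f.
  by apply: le_ereal_inf_tmp => _ [f' _ <-].
have Jge i pi : g%:E <= J P lambda i pi.
  exact: (policy_J_ge (P_law i pi) boundC lambda_gt0 u0 subu).
have Jeq (f' : spolicy M) i : attains lambda h f' -> J P lambda i (stat f') = g%:E.
  move=> af; apply/eqP; rewrite eq_le Jge andbT.
  apply: (stat_growth_le (P_law i (stat f')) erefl lambda_gt0 u0) => j.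
  by rewrite -/(L j (f' j)) attE.
have JstarE i : Jstar P lambda i = g%:E.
  apply/eqP; rewrite eq_le; apply/andP; split.
    by rewrite -(Jeq f i fatt); apply: ereal_inf_lbound; exists (stat f).
  by apply: le_ereal_inf_tmp => _ [pi _ <-].
exists g, h; split => //.
- apply/eqP; rewrite eq_le; apply/andP; split.
    apply: ereal_inf_lbound; exists g => //=.
    by rewrite /Gset /= hstarE /h uz ln1 mul0r.
  apply: le_ereal_inf_tmp => _ [g1 /= Gg1 <-]; rewrite lee_fin leNgt; apply/negP => g1g.
  (* Lowering [g] to [g1] leaves the slack [d * u] in the inequality for every action. *)
  pose d := (lambda * (g - g1))%R; have d0 : (0 < d)%R by rewrite mulr_gt0// subr_gt0.
  (* [K] has to serve every selector at once, so that the positive lower bound on [hfun] survives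
     the infimum over [f']; the bound [C] from compactness of the action sets makes this
     possible. *)
  pose K := (`|lambda * g1| + (lambda * C + C))%R.
  have K0 : (0 <= K)%R by rewrite !addr_ge0// ?mulr_ge0// ltW.
  have dK : (0 < d / (K + 1))%R by rewrite divr_gt0// ltr_wpDl.
  have : (ln (1 + d / (K + 1)) / lambda)%:E <= 0.
    apply: le_trans Gg1; apply: le_ereal_inf_tmp => _ [f' _ <-].
    apply: lne_scale_ge => //; first by rewrite addr_gt0.
    apply: (passage_strict (P_law z (stat f')) lambda_gt0 (irr f') u0 uz) => //.
      move=> j; apply: le_trans (subu _ _ (sel_adm f' j)).
      by rewrite /d -mulrDr addrC subrK.
    have [c1 q1] := boundC _ _ (sel_adm f' z).
    have := q1 z; have := ler_norm (lambda * g1); move: c1; rewrite !ler_norml /K.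
    rewrite mulrBr => /andP[c1 _] ? /andP[? _].
    have := ler_wpM2l (ltW lambda_gt0) c1; lra.
  by rewrite lee_fin pmulr_lle0 ?invr_gt0// leNgt ln_gt0// ltrDl.
- by move=> i; rewrite eh infE.
- by exists f.
- move=> f' af; split=> [i|i]; first by rewrite JstarE Jeq.
  by rewrite JstarE Jeq.
Qed.
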